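(* Let $\Omega\subset\mathbb{R}^2$ be an open, bounded, simply connected domain with smooth boundary, let $p\ge \tfrac32$ and $f\in L^p(\Omega)$. Then for every $\theta<\tfrac13$ the set of $C^{1,\theta}(\bar\Omega)$ very weak solutions of $$\mathcal{D}\mathrm{et}\, D^2 v = f \quad\text{in }\Omega$$ is dense in $C^0(\bar\Omega)$. More precisely, for every $\underline v\in C^0(\bar\Omega)$ and every $\epsilon>0$ there exists $\overline v\in C^{1,\theta}(\bar\Omega)$ which is a distributional solution of $\mathcal{D}\mathrm{et}\, D^2 \overline v = f$ in $\Omega$ and satisfies $\sup_{\bar\Omega}|\underline v-\overline v|<\epsilon$.
   Context: For $v\in W^{1,2}_{loc}(\Omega)$ the very weak Hessian is the distribution $$\mathcal{D}\mathrm{et}\, D^2 v := \partial^2_{12}(\partial_1 v\,\partial_2 v) - \tfrac12\partial^2_{22}\big((\partial_1 v)^2\big) - \tfrac12 \partial^2_{11}\big((\partial_2 v)^2\big) = -\tfrac12\,\mathrm{curl}\,\mathrm{curl}(\nabla v\otimes\nabla v),$$ where for a $2\times2$ matrix field $A$, $\mathrm{curl}\,\mathrm{curl}\,A=\partial_{22}A_{11}-\partial_{12}A_{12}-\partial_{12}A_{21}+\partial_{11}A_{22}$. A very weak (distributional) solution of $\mathcal{D}\mathrm{et}\, D^2 v=f$ is a $v$ for which this distribution equals $f$. *)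

(* Defs.v *)
From HB Require Import structures.
From mathcomp Require Import all_boot all_order all_algebra.
From mathcomp Require Import all_classical all_reals all_analysis.
Set Implicit Arguments. Unset Strict Implicit. Unset Printing Implicit Defensive.
Import Order.TTheory GRing.Theory Num.Theory.
Import numFieldNormedType.Exports.
Local Open Scope classical_set_scope.
Local Open Scope ring_scope.

Section Defs.
Variable R : realType.
Local Notation P2 := (R * R)%type.

Definition dist2 (x y : P2) : R :=
  Num.sqrt ((x.1 - y.1) ^+ 2 + (x.2 - y.2) ^+ 2).

Definition pd1 (f : P2 -> R) : P2 -> R :=
  fun x => derive1 (fun t => f (t, x.2)) x.1.
Definition pd2 (f : P2 -> R) : P2 -> R :=
  fun x => derive1 (fun t => f (x.1, t)) x.2.
Definition pd (i : bool) (f : P2 -> R) : P2 -> R :=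
  if i then pd2 f else pd1 f.

Definition has_partials (f : P2 -> R) (x : P2) : Prop :=
  derivable (fun t => f (t, x.2)) x.1 1 /\ derivable (fun t => f (x.1, t)) x.2 1.

Definition smooth2 (f : P2 -> R) : Prop :=
  forall s : seq bool, continuous (foldr pd f s) /\
     (forall x, has_partials (foldr pd f s) x).

Definition test_function (Om : set P2) (phi : P2 -> R) : Prop :=
  smooth2 phi /\
  exists K : set P2, [/\ compact K, K `<=` Om & forall x, ~ K x -> phi x = 0].

Definition leb2 := (@lebesgue_measure R \x @lebesgue_measure R)%E.

Definition smooth_boundary (Om : set P2) : Prop :=
  exists rho : P2 -> R, [/\ smooth2 rho,
    Om = [set x | rho x < 0] &
    forall x, rho x = 0 -> (pd1 rho x, pd2 rho x) <> (0, 0)].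

Definition bounded2 (Om : set P2) : Prop :=
  exists M : R, forall x, Om x -> `|x.1| <= M /\ `|x.2| <= M.

Definition simply_connected2 (Om : set P2) : Prop :=
  [/\ Om !=set0,
    (forall x y, Om x -> Om y -> exists g : R -> P2,
       [/\ {within `[0, 1]%classic, continuous g}, g 0 = x, g 1 = y &
           forall t, `[0, 1]%classic t -> Om (g t)]) &
    (forall g : R -> P2, {within `[0, 1]%classic, continuous g} ->
       (forall t, `[0, 1]%classic t -> Om (g t)) -> g 0 = g 1 ->
       exists H : P2 -> P2,
         [/\ {within `[0, 1]%classic `*` `[0, 1]%classic, continuous H},
             (forall s t, `[0, 1]%classic s -> `[0, 1]%classic t -> Om (H (s, t))),
             (forall t, `[0, 1]%classic t -> H (0, t) = g t),
             (forall t, `[0, 1]%classic t -> H (1, t) = H (1, 0)) &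
             (forall s, `[0, 1]%classic s -> H (s, 0) = H (s, 1))])].

Definition Lp (Om : set P2) (p : R) (f : P2 -> R) : Prop :=
  measurable_fun Om f /\
  (\int[leb2]_(x in Om) ((`|f x| `^ p)%:E) < +oo)%E.

(* C^{1,theta}(closure Om): v continuous on the closure, both partials exist
   on Om, v and its partials are bounded and theta-Hoelder on Om (hence
   extend continuously to the closure) *)
Definition C1theta (Om : set P2) (theta : R) (v : P2 -> R) : Prop :=
  [/\ {within closure Om, continuous v},
      (forall x, Om x -> has_partials v x) &
      exists C : R, forall x y, Om x -> Om y ->
        [/\ `|v x| <= C, `|pd1 v x| <= C & `|pd2 v x| <= C] /\
        [/\ `|v x - v y| <= C * dist2 x y `^ theta,
            `|pd1 v x - pd1 v y| <= C * dist2 x y `^ theta &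
            `|pd2 v x - pd2 v y| <= C * dist2 x y `^ theta]].

(* very weak Hessian Det D^2 v = f in the sense of distributions:
   <d12(v1 v2) - 1/2 d22(v1^2) - 1/2 d11(v2^2), phi>
     = int v1 v2 phi_12 - 1/2 v1^2 phi_22 - 1/2 v2^2 phi_11 = int f phi *)
Definition very_weak_hessian_eq (Om : set P2) (v f : P2 -> R) : Prop :=
  forall phi, test_function Om phi ->
    (\int[leb2]_(x in Om)
       ((pd1 v x * pd2 v x * pd2 (pd1 phi) x
         - 2^-1 * (pd1 v x) ^+ 2 * pd2 (pd2 phi) x
         - 2^-1 * (pd2 v x) ^+ 2 * pd1 (pd1 phi) x)%:E)
     = \int[leb2]_(x in Om) ((f x * phi x)%:E))%E.

End Defs.

(* Main.v *)
(* Modulo fields annihilated by curl curl (the trivial fields, i.e. symmetrised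
   gradients), the equation says that A - grad v (x) grad v / 2 vanishes, where
   - curl curl A = f.  Write this difference, modulo trivial fields, as
   c1 xi (x) xi + c2 eta (x) eta + c3 zeta (x) zeta, the three directions being
   used cyclically.  Since constants are trivial, c1 may be replaced by c1 + k > 0;
   adding to v the corrugation a sin(lam x.xi) / lam with a^2 = 4 (c1 + k) then
   cancels the first term, and the oscillating remainders are integrated by parts
   modulo trivial fields, which gains powers of 1/lam and moves what is left to
   the other two coefficients.  At each step frequencies grow by T^3 and amplitudes
   shrink by tau, where T tau is large and tau (T^3)^theta <= 1/2; this is possible
   exactly because theta < 1/3.  All functions stay in classes
   |d^k g| <= M L^k 8^(k(k-1)/2), which are stable under products and
   derivatives, so v need not be mollified.

   As f is only in L^(3/2), A is replaced at stage j by the diagonal field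
   diag(a_j, b_j), the convolution of f with explicit kernels built from
   sqrt(l^-2 + z^2) with l = T^(3j); - curl curl of it is f convolved with an
   approximate identity, and its increments are O(T^(-2j)) by Young's inequality
   |f| b <= t |f|^(3/2) + t^-2 b^3.  The initial datum is approximated uniformly
   by mollifying a McShane inf-convolution. *)
Require Import Defs.
From HB Require Import structures.
From mathcomp Require Import all_boot all_order all_algebra.
From mathcomp Require Import all_classical all_reals all_analysis.
From mathcomp Require Import measurable_realfun ring lra zify.
Set Implicit Arguments. Unset Strict Implicit. Unset Printing Implicit Defensive.
Import Order.TTheory GRing.Theory Num.Theory.
Import numFieldNormedType.Exports.
Local Open Scope classical_set_scope.
Local Open Scope ring_scope.

(** The exponent 1/3 comes from a single term. Crossing the corrugation with the Hessian of v leaves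
    an error of size amplitude times Hessian over frequency, and its component along the second
    direction of the frame cannot be integrated by parts. With amplitude s and Hessian about s L /
    tau this error is about s^2 / (T^3 tau). It goes into the coefficient removed at the next step,
    so it may be as large as a small multiple of (s tau)^2: this is the condition that T tau be
    large. All other remainders are integrated by parts twice and gain T^-6, about tau^6, which is
    just what the squared amplitude loses over the three steps until a coefficient has its turn
    again. Hence frequencies grow by T^3 while amplitudes shrink by about 1/T.

    The exponent 3/2 meets the same rate. At scale l the cube of the kernel has mass about l^-2, the
    balanced choice in Young's inequality is t = l^(-2/3) = T^(-2j), and since 1/T <= tau the
    increments of A decay at least as fast as the admissible coefficients tau^(2j). *)

Definition slice {R : realType} (i : bool) (f : R * R -> R) (x : R * R) : R -> R :=
  if i then (fun t => f (x.1, t)) else (fun t => f (t, x.2)).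
Definition coord_of {R : realType} (i : bool) (x : R * R) : R := if i then x.2 else x.1.

(** Estimates live on a square around the domain: two of its points are joined by two axis-parallel
    segments inside it, so mean value arguments go through whatever the shape of [Om]. *)
Definition square {R : realType} (r : R) : set (R * R) :=
  [set x | `|x.1| < r /\ `|x.2| < r].

(** * Partial derivatives with bounds of every order *)

Section Partials.
Context {R : realType}.
Local Notation P2 := (R * R)%type.
Implicit Types (f g : P2 -> R) (x : P2) (i : bool).

Lemma pdE i f x : pd i f x = 'D_1 (slice i f x) (coord_of i x).
Proof. by case: i; rewrite /= ?/pd1 ?/pd2 derive1E. Qed.

Lemma has_partialsP f x :
  has_partials f x <-> (forall i, derivable (slice i f x) (coord_of i x) 1).
Proof.
split; first by case=> h1 h2; case; [exact: h2|exact: h1].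
by move=> h; split; [exact: (h false)|exact: (h true)].
Qed.

Lemma slice_coord i f x : slice i f x (coord_of i x) = f x.
Proof. by case: i; case: x. Qed.

Lemma partials_is_derive f x i :
  has_partials f x -> is_derive (coord_of i x) 1 (slice i f x) (pd i f x).
Proof. by move=> /has_partialsP/(_ i)/derivableP; rewrite pdE. Qed.

Lemma is_derive_partials f x (d : bool -> R) :
  (forall i, is_derive (coord_of i x) 1 (slice i f x) (d i)) ->
  has_partials f x /\ forall i, pd i f x = d i.
Proof.
move=> h; split; first by apply/has_partialsP => i; exact: (@ex_derive _ _ _ _ _ _ _ (h i)).
by move=> i; rewrite pdE; exact: derive_val.
Qed.

Lemma partialsD f g x : has_partials f x -> has_partials g x ->
  has_partials (fun y => f y + g y) x /\
  forall i, pd i (fun y => f y + g y) x = pd i f x + pd i g x.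
Proof.
move=> hf hg; apply: is_derive_partials => i.
have := is_deriveD (partials_is_derive i hf) (partials_is_derive i hg).
by case: i.
Qed.

Lemma partialsM f g x : has_partials f x -> has_partials g x ->
  has_partials (fun y => f y * g y) x /\
  forall i, pd i (fun y => f y * g y) x = pd i f x * g x + f x * pd i g x.
Proof.
move=> hf hg; apply: is_derive_partials => i.
have := is_deriveM (partials_is_derive i hf) (partials_is_derive i hg).
rewrite !slice_coord => h; apply: is_derive_eq; first by case: i h => h; exact: h.
by rewrite /GRing.scale/= addrC mulrC.
Qed.

Lemma partials_cst (c : R) x :
  has_partials (fun=> c) x /\ forall i, pd i (fun=> c) x = 0.
Proof.
by apply: is_derive_partials => -[]; exact: is_derive_cst.
Qed.

Lemma partials_comp (h : R -> R) (d : R) f x : has_partials f x ->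
  is_derive (f x) 1 h d ->
  has_partials (fun y => h (f y)) x /\
  forall i, pd i (fun y => h (f y)) x = d * pd i f x.
Proof.
move=> hf hh; apply: is_derive_partials => i.
have hfi := partials_is_derive i hf.
have hh' : is_derive (slice i f x (coord_of i x)) 1 h d by rewrite slice_coord.
have := is_derive1_comp hh' hfi.
rewrite /GRing.scale/= => k; by case: i k {hfi hh'}.
Qed.

Section Local.
Variable r : R.
Local Notation U := (square r).

Lemma square_near i x : U x ->
  \forall t \near coord_of i x, U (if i then (x.1, t) else (t, x.2)).
Proof.
move=> [h1 h2].
have H (u : R) : `|u| < r -> \forall t \near u, `|t| < r.
  move=> ur; apply/nbhs_ballP; exists (r - `|u|); first by rewrite /= subr_gt0.
  move=> t; rewrite /ball /= ltrBrDr distrC; apply: le_lt_trans.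
  by rewrite -{1}(subrK u t) ler_normD.
by case: i => /=; [have := H _ h2|have := H _ h1]; apply: filterS => t tr; split.
Qed.

Lemma slice_near i f g x : (forall y, U y -> f y = g y) -> U x ->
  \forall t \near coord_of i x, slice i f x t = slice i g x t.
Proof.
move=> fg Ux; have := square_near i Ux; apply: filterS => t.
by case: i => /= /fg.
Qed.

Lemma pd_eq f g : (forall y, U y -> f y = g y) ->
  forall i y, U y -> pd i f y = pd i g y.
Proof.
by move=> fg i y Uy; rewrite !pdE; apply: near_eq_derive; exact: slice_near.
Qed.

Lemma has_partials_eq f g : (forall y, U y -> f y = g y) ->
  forall y, U y -> has_partials f y -> has_partials g y.
Proof.
move=> fg y Uy /has_partialsP h; apply/has_partialsP => i.
by apply: near_eq_derivable (h i); exact: slice_near.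
Qed.

(** [G k] bounds every word of k partials, in whatever order they are taken; differentiating shifts
    the sequence [G]. *)
Fixpoint bnd (n : nat) (G : nat -> R) (f : P2 -> R) : Prop :=
  (forall x, U x -> `|f x| <= G 0%N) /\
  (if n is m.+1 then (forall x, U x -> has_partials f x) /\
     (forall i, bnd m (fun k => G k.+1) (pd i f)) else True).

Lemma bnd_norm n G f : bnd n G f -> forall x, U x -> `|f x| <= G 0%N.
Proof. by case: n => [|n] []. Qed.

Lemma bnd_eq n G f g : (forall y, U y -> f y = g y) -> bnd n G f -> bnd n G g.
Proof.
elim: n G f g => [|n IH] G f g fg /= [h1 h2]; split.
- by move=> x Ux; rewrite -fg//; exact: h1.
- by [].
- by move=> x Ux; rewrite -fg//; exact: h1.
- case: h2 => h2 h3; split.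
    by move=> x Ux; apply: (has_partials_eq fg Ux); exact: h2.
  by move=> i; apply: IH (h3 i); exact: pd_eq.
Qed.

Lemma bnd_le n G H f : (forall k, G k <= H k) -> bnd n G f -> bnd n H f.
Proof.
elim: n G H f => [|n IH] G H f GH /= [h1 h2]; split => //.
- by move=> x Ux; exact: le_trans (h1 _ Ux) (GH _).
- by move=> x Ux; exact: le_trans (h1 _ Ux) (GH _).
- case: h2 => h2 h3; split => // i; apply: IH (h3 i) => k; exact: GH.
Qed.

Lemma bndW n m G f : (m <= n)%N -> bnd n G f -> bnd m G f.
Proof.
elim: n m G f => [|n IH] [|m] G f //= mn [h1 h2]; split => //.
by case: h2 => h2 h3; split => // i; exact: IH (h3 i).
Qed.

Lemma bnd_ge0 n G f x : U x -> bnd n G f -> forall k, (k <= n)%N -> 0 <= G k.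
Proof.
move=> Ux; elim: n G f => [|n IH] G f /= [h1 h2] [|k] kn //.
- exact: le_trans (h1 _ Ux).
- exact: le_trans (h1 _ Ux).
- by case: h2 => _ /(_ true)/IH; apply.
Qed.

Lemma bndD n G H f g : bnd n G f -> bnd n H g ->
  bnd n (fun k => G k + H k) (fun x => f x + g x).
Proof.
elim: n G H f g => [|n IH] G H f g /= [f1 f2] [g1 g2]; split => //.
- by move=> x Ux; rewrite (le_trans (ler_normD _ _))// lerD ?f1 ?g1.
- by move=> x Ux; rewrite (le_trans (ler_normD _ _))// lerD ?f1 ?g1.
- case: f2 => f2 f3; case: g2 => g2 g3; split.
    by move=> x Ux; case: (partialsD (f2 _ Ux) (g2 _ Ux)).
  move=> i; apply: bnd_eq (IH _ _ _ _ (f3 i) (g3 i)) => y Uy.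
  by case: (partialsD (f2 _ Uy) (g2 _ Uy)) => _ ->.
Qed.

Definition leib (G H : nat -> R) (k : nat) : R :=
  \sum_(j < k.+1) 'C(k, j)%:R * (G j * H (k - j)%N).

Lemma leib0 G H : leib G H 0 = G 0%N * H 0%N.
Proof. by rewrite /leib big_ord1 bin0 mul1r. Qed.

(** Pascal's rule. The two sums belong to f' g and f g', which closes the induction in [bndM]. *)
Lemma leibS G H k : leib G H k.+1 =
  leib (fun j => G j.+1) H k + leib G (fun j => H j.+1) k.
Proof.
rewrite /leib big_ord_recl /= bin0 mul1r subn0.
under eq_bigr do rewrite /bump /= add1n binS natrD mulrDl subSS.
rewrite big_split /= addrA addrC; congr (_ + _).
rewrite [in RHS]big_ord_recl /= bin0 mul1r subn0; congr (_ + _).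
rewrite big_ord_recr /= bin_small // mul0r addr0; apply: eq_bigr => j _.
by rewrite /bump /= add1n subnSK.
Qed.

Lemma bndM n G H f g : bnd n G f -> bnd n H g ->
  bnd n (leib G H) (fun x => f x * g x).
Proof.
elim: n G H f g => [|n IH] G H f g /= [f1 f2] [g1 g2].
  by split => // x Ux; rewrite leib0 normrM ler_pM ?f1 ?g1.
case: f2 => f2 f3; case: g2 => g2 g3.
split; first by move=> x Ux; rewrite leib0 normrM ler_pM ?f1 ?g1.
split; first by move=> x Ux; case: (partialsM (f2 _ Ux) (g2 _ Ux)).
move=> i; apply: (@bnd_le _
   (fun k => leib (fun j => G j.+1) H k + leib G (fun j => H j.+1) k)).
  by move=> k; rewrite leibS.
have hf : bnd n G f by apply: (@bndW n.+1) => //=; split.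
have hg : bnd n H g by apply: (@bndW n.+1) => //=; split.
apply: bnd_eq (bndD (IH _ _ _ _ (f3 i) hg) (IH _ _ _ _ hf (g3 i))) => y Uy.
by case: (partialsM (f2 _ Uy) (g2 _ Uy)) => _ ->.
Qed.

Lemma bndZ n G (c : R) f : bnd n G f ->
  bnd n (fun k => `|c| * G k) (fun x => c * f x).
Proof.
elim: n G f => [|n IH] G f /= [f1 f2].
  by split => // x Ux; rewrite normrM ler_wpM2l ?f1.
case: f2 => f2 f3.
split; first by move=> x Ux; rewrite normrM ler_wpM2l ?f1.
have E x : U x -> has_partials (fun x => c * f x) x /\
    forall i, pd i (fun x => c * f x) x = c * pd i f x.
  move=> Ux; have [c1 c2] := partials_cst c x.
  have [h1 h2] := partialsM c1 (f2 _ Ux); split => // i.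
  by rewrite h2 c2 mul0r add0r.
split; first by move=> x /E[].
by move=> i; apply: bnd_eq (IH _ _ (f3 i)) => y /E[_ ->].
Qed.

End Local.
End Partials.

(** * Weighted smoothness classes *)

Section Weights.
Context {R : realType}.

(* With these weights the Leibniz rule costs only a factor 3 (wt_leib), while
   one derivative merely replaces L by 8 L (cls_pd): no derivative is lost. *)
Fixpoint wt (k : nat) : R := if k is j.+1 then 8 ^+ j * wt j else 1.

Lemma wt_ge1 k : 1 <= wt k.
Proof.
by elim: k => //= k IH; rewrite mulr_ege1// exprn_ege1// ler1n.
Qed.

Lemma wt_ge0 k : 0 <= wt k.
Proof. exact: le_trans ler01 (wt_ge1 k). Qed.

(** The exponent k(k-1)/2 of the weight is quadratic, so splitting k = j + m leaves the gap
    [8 ^+ (j * m)]. This gap beats the binomial coefficients in [wt_leib]. *)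
Lemma wtD j m : wt (j + m) = 8 ^+ (j * m) * (wt j * wt m).
Proof.
elim: j => [|j IH]; first by rewrite mul0n expr0 !mul1r.
by rewrite addSn /= IH mulSn !exprD; ring.
Qed.

(** The two end terms j = 0 and j = k count 1 each. For 0 < j < k one has j (k - j) >= k - 1, so by
    [wtD] all inner terms together count at most 2^k 8 / 8^k <= 1. *)
Lemma wt_leib k : leib wt wt k <= 3 * wt k.
Proof.
case: k => [|[|k]]; first by rewrite leib0 /=; lra.
  by rewrite leibS !leib0 /=; lra.
set n := k.+2.
have E j : (j <= n)%N -> 'C(n, j)%:R * (wt j * wt (n - j)) <=
    wt n * ((j == 0%N)%:R + (j == n)%:R + 'C(n, j)%:R * (8 / 8 ^+ n)).
  move=> jn; have [->|j0] := eqVneq j 0%N.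
    rewrite bin0 subn0 /= !mul1r mulr1n -addrA mulrDr mulr1 lerDl.
    apply: mulr_ge0; first by rewrite !mulr_ge0 ?exprn_ge0 ?wt_ge0.
    by rewrite add0r; apply: divr_ge0 => //; exact: exprn_ge0.
  have [ejn|/eqP jn'] := j =P n.
    rewrite ejn binn subnn !mul1r mulr1 add0r mulrDr mulr1 lerDl.
    apply: mulr_ge0; first exact: wt_ge0.
    by apply: divr_ge0 => //; exact: exprn_ge0.
  rewrite !add0r [leRHS]mulrCA ler_wpM2l ?ler0n//.
  have -> : wt n = 8 ^+ (j * (n - j)) * (wt j * wt (n - j)) by rewrite -wtD subnKC.
  rewrite mulrAC -[leLHS]mul1r.
  rewrite ler_wpM2r ?mulr_ge0 ?wt_ge0//.
  rewrite mulrA ler_pdivlMr ?exprn_gt0// mul1r -exprSr.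
  rewrite ler_eXn2l ?ltr1n//; move: jn j0 jn'; rewrite /n; clear.
  move=> h1 /eqP h2 /eqP h3; nia.
rewrite /leib; apply: (@le_trans _ _ (\sum_(j < n.+1)
    wt n * ((j == 0 :> nat)%:R + (j == n :> nat)%:R + 'C(n, j)%:R * (8 / 8 ^+ n)))).
  by apply: ler_sum => j _; apply: E; rewrite -ltnS.
rewrite -mulr_sumr mulrC ler_wpM2r ?wt_ge0// !big_split /= -mulr_suml.
have -> : \sum_(i < n.+1) (i == 0 :> nat)%:R = 1 :> R.
  by rewrite big_ord_recl /= big1 ?addr0.
have -> : \sum_(i < n.+1) (i == n :> nat)%:R = 1 :> R.
  rewrite big_ord_recr /= eqxx big1 ?add0r// => i _.
  by rewrite (ltn_eqF (ltn_ord i)).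
have -> : \sum_(i < n.+1) 'C(n, i)%:R = 2 ^+ n :> R.
  rewrite -natr_sum -natrX (_ : (2 ^ n)%N = ((1 + 1) ^ n)%N)// expnDn; congr (_%:R).
  by apply: eq_bigr => i _; rewrite !exp1n !muln1.
have -> : (2 ^+ n * (8 / 8 ^+ n) : R) = 8 / 4 ^+ n.
  rewrite (_ : 8 = 2 * 4 :> R); last by lra.
  rewrite [in X in _ / X]exprMn; field.
  by rewrite !expf_neq0// pnatr_eq0.
have : 8 / 4 ^+ n <= 1 :> R.
  rewrite ler_pdivrMr ?exprn_gt0// mul1r /n !exprS.
  have : 1 <= 4 ^+ k :> R by rewrite exprn_ege1// ler1n.
  lra.
lra.
Qed.

End Weights.

Section Class.
Context {R : realType}.
Variable r : R.
Local Notation U := (square r).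
Local Notation P2 := (R * R)%type.
Implicit Types (f g : P2 -> R) (x : P2) (i : bool).

(** [M] is an amplitude and [L] a frequency. One pair serves all orders of differentiation, so
    products and derivatives are estimated by arithmetic on (M, L). *)
Definition cls (M L : R) f :=
  forall n, bnd r n (fun k => M * L ^+ k * wt k) f.

Lemma cls_eq M L f g : (forall y, U y -> f y = g y) -> cls M L f -> cls M L g.
Proof. by move=> fg h n; exact: bnd_eq (h n). Qed.

Lemma cls_norm M L f : cls M L f -> forall x, U x -> `|f x| <= M.
Proof. by move=> h x Ux; have := bnd_norm (h 0%N) Ux; rewrite expr0 !mulr1. Qed.

Lemma cls_partials M L f : cls M L f -> forall x, U x -> has_partials f x.
Proof. by move=> /(_ 1%N)[_ []]. Qed.

Lemma leib_scale M N L (F G : nat -> R) k :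
  leib (fun j => M * L ^+ j * F j) (fun j => N * L ^+ j * G j) k =
  M * N * L ^+ k * leib F G k.
Proof.
rewrite /leib mulr_sumr; apply: eq_bigr => j _.
have -> : L ^+ k = L ^+ j * L ^+ (k - j) by rewrite -exprD subnKC// -ltnS.
ring.
Qed.

Local Notation w M L := (fun k : nat => M * L ^+ k * wt k).

Lemma bnd_clsM n M N L f g : 0 <= M -> 0 <= N -> 0 <= L ->
  bnd r n (w M L) f -> bnd r n (w N L) g ->
  bnd r n (w (3 * M * N) L) (fun x => f x * g x).
Proof.
move=> M0 N0 L0 hf hg; apply: bnd_le (bndM hf hg) => k.
rewrite leib_scale [leRHS](_ : _ = M * N * L ^+ k * (3 * wt k)); last by ring.
by rewrite ler_wpM2l ?wt_leib// !mulr_ge0// exprn_ge0.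
Qed.

Lemma bnd_clsZ n M c L f :
  bnd r n (w M L) f -> bnd r n (w (`|c| * M) L) (fun x => c * f x).
Proof. by move=> hf; apply: bnd_le (bndZ c hf) => k; rewrite !mulrA. Qed.

Lemma bnd_clsD n M N L f g :
  bnd r n (w M L) f -> bnd r n (w N L) g -> bnd r n (w (M + N) L) (fun x => f x + g x).
Proof. by move=> hf hg; apply: bnd_le (bndD hf hg) => k; rewrite !mulrDl. Qed.

Lemma bnd_cls_le n M N L K f : 0 <= M -> M <= N -> 0 <= L -> L <= K ->
  bnd r n (w M L) f -> bnd r n (w N K) f.
Proof.
move=> M0 MN L0 LK; apply: bnd_le => k.
by rewrite ler_wpM2r ?wt_ge0// ler_pM ?exprn_ge0 ?lerXn2r ?nnegrE// (le_trans L0).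
Qed.

Lemma cls_le M L M' L' f : 0 <= M -> M <= M' -> 0 <= L -> L <= L' ->
  cls M L f -> cls M' L' f.
Proof. by move=> M0 MM L0 LL h n; exact: bnd_cls_le (h n). Qed.

Lemma clsD M N L f g : cls M L f -> cls N L g ->
  cls (M + N) L (fun x => f x + g x).
Proof. by move=> hf hg n; exact: bnd_clsD (hf n) (hg n). Qed.

Lemma clsZ M L (c : R) f : cls M L f -> cls (`|c| * M) L (fun x => c * f x).
Proof. by move=> hf n; exact: bnd_clsZ (hf n). Qed.

Lemma clsN M L f : cls M L f -> cls M L (fun x => - f x).
Proof.
move=> hf; have := clsZ (-1) hf; rewrite normrN1 mul1r.
by apply: cls_eq => y _; rewrite mulN1r.
Qed.

Lemma clsB M N L f g : cls M L f -> cls N L g ->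
  cls (M + N) L (fun x => f x - g x).
Proof. by move=> hf hg; exact: (clsD hf (clsN hg)). Qed.

Lemma clsM M N L f g : 0 <= M -> 0 <= N -> 0 <= L -> cls M L f -> cls N L g ->
  cls (3 * M * N) L (fun x => f x * g x).
Proof. by move=> M0 N0 L0 hf hg n; exact: bnd_clsM (hf n) (hg n). Qed.

Lemma cls_pd M L f i : cls M L f -> cls (M * L) (8 * L) (pd i f).
Proof.
move=> h n; have [_ [_ /(_ i)]] := h n.+1; apply: bnd_le => k /=.
rewrite le_eqVlt; apply/orP; left; apply/eqP; rewrite exprS exprMn; ring.
Qed.

Lemma bnd_cst n G (c : R) : `|c| <= G 0%N -> (forall k, 0 <= G k) ->
  bnd r n G (fun=> c).
Proof.
elim: n G c => [|n IH] G c cG G0; first by split.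
split => //; split; first by move=> x _; case: (partials_cst c x).
move=> i; apply: (@bnd_eq _ _ _ _ (fun=> 0)).
  by move=> y _; case: (partials_cst c y) => _ ->.
by apply: IH => //; rewrite normr0.
Qed.

Lemma cls_cst M L (c : R) : 0 <= L -> `|c| <= M -> cls M L (fun=> c).
Proof.
move=> L0 cM n; apply: bnd_cst; first by rewrite expr0 !mulr1.
move=> k; rewrite !mulr_ge0 ?exprn_ge0 ?wt_ge0//.
exact: le_trans cM.
Qed.

Lemma partials_lin (a b : R) x :
  has_partials (fun y => a * y.1 + b * y.2) x /\
  forall i, pd i (fun y => a * y.1 + b * y.2) x = if i then b else a.
Proof.
have K (c e z : R) : is_derive z 1 (fun t => c * t + e) c.
  have := is_deriveD (is_deriveZ c (is_derive_id z 1)) (is_derive_cst e z 1).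
  by rewrite addr0 /GRing.scale /= mulr1.
apply: is_derive_partials => -[]; last exact: (K a (b * x.2)).
rewrite (_ : slice _ _ _ = (fun t => b * t + a * x.1)); first exact: (K b (a * x.1)).
by apply/funext => t; rewrite /slice /= addrC.
Qed.

Lemma bnd_trig (lam a b : R) n : 0 <= lam -> `|a| <= 1 -> `|b| <= 1 ->
  bnd r n (fun k => lam ^+ k) (fun y => sin (lam * (a * y.1 + b * y.2))) /\
  bnd r n (fun k => lam ^+ k) (fun y => cos (lam * (a * y.1 + b * y.2))).
Proof.
move=> l0 a1 b1.
have S1 y : `|sin (lam * (a * y.1 + b * y.2))| <= 1.
  by rewrite ler_norml sin_geN1 sin_le1.
have C1 y : `|cos (lam * (a * y.1 + b * y.2))| <= 1.
  by rewrite ler_norml cos_geN1 cos_le1.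
pose c i := lam * (if i then b else a).
have Pl x : has_partials (fun y => lam * (a * y.1 + b * y.2)) x /\
    forall i, pd i (fun y => lam * (a * y.1 + b * y.2)) x = c i.
  have := partials_lin (lam * a) (lam * b) x.
  rewrite (_ : (fun y => _) = (fun y => lam * (a * y.1 + b * y.2))); last first.
    by apply/funext => y; ring.
  by case=> h1 h2; split => // i; rewrite h2 /c; case: i.
have cl i : `|c i| <= lam.
  rewrite normrM (ger0_norm l0) -[leRHS]mulr1 ler_wpM2l//.
  by case: i.
have PS x := partials_comp (Pl x).1 (is_derive_sin (lam * (a * x.1 + b * x.2))).
have PC x := partials_comp (Pl x).1 (is_derive_cos (lam * (a * x.1 + b * x.2))).
elim: n => [|n [IH1 IH2]].
  by split; split => // x _; rewrite expr0.
split; split.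
- by move=> x _; rewrite expr0.
- split; first by move=> x _; case: (PS x).
  move=> i; apply: (@bnd_le _ _ _ (fun k => `|c i| * lam ^+ k)).
    by move=> k; rewrite exprS ler_wpM2r ?exprn_ge0.
  apply: bnd_eq (bndZ (c i) IH2) => y _.
  by case: (PS y) => _ ->; rewrite (Pl y).2 mulrC.
- by move=> x _; rewrite expr0.
- split; first by move=> x _; case: (PC x).
  move=> i; apply: (@bnd_le _ _ _ (fun k => `|- c i| * lam ^+ k)).
    by move=> k; rewrite normrN exprS ler_wpM2r ?exprn_ge0.
  apply: bnd_eq (bndZ (- c i) IH1) => y _.
  by case: (PC y) => _ ->; rewrite (Pl y).2; ring.
Qed.

Lemma cls_sin (lam a b : R) : 0 <= lam -> `|a| <= 1 -> `|b| <= 1 ->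
  cls 1 lam (fun y => sin (lam * (a * y.1 + b * y.2))).
Proof.
move=> l0 a1 b1 n; apply: bnd_le (bnd_trig n l0 a1 b1).1 => k.
by rewrite mul1r -[leLHS]mulr1 ler_wpM2l ?wt_ge1// exprn_ge0.
Qed.

Lemma cls_cos (lam a b : R) : 0 <= lam -> `|a| <= 1 -> `|b| <= 1 ->
  cls 1 lam (fun y => cos (lam * (a * y.1 + b * y.2))).
Proof.
move=> l0 a1 b1 n; apply: bnd_le (bnd_trig n l0 a1 b1).2 => k.
by rewrite mul1r -[leLHS]mulr1 ler_wpM2l ?wt_ge1// exprn_ge0.
Qed.

Lemma is_derive_rsqrt (z : R) : 0 < z ->
  is_derive z 1 (fun t => (Num.sqrt t)^-1) (- 2^-1 * (Num.sqrt z)^-1 ^+ 3).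
Proof.
move=> z0; have s0 : 0 < Num.sqrt z by rewrite sqrtr_gt0.
have := is_deriveV (lt0r_neq0 s0) (is_derive1_sqrt z0).
move=> h; rewrite (_ : - 2^-1 * _ = - Num.sqrt z ^- 2 *: (2 * Num.sqrt z)^-1) //.
by rewrite /GRing.scale /=; field; rewrite gt_eqF.
Qed.

(** The function g = (1 + h)^(-1/2) satisfies dg = - g^3 dh / 2, so its bounds of order n + 1 follow
    from those of order n. The threshold 1/54 is where the induction closes: the three products give
    108 eta, to be at most 2. *)
Lemma cls_rsqrt (eta L : R) h : 0 <= eta -> eta <= 54^-1 -> 0 <= L ->
  cls eta L h -> cls 2 L (fun x => (Num.sqrt (1 + h x))^-1).
Proof.
move=> e0 e1 L0 hh; set g := fun x => _.
have h1 x : U x -> 4^-1 <= 1 + h x.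
  move=> Ux; have := cls_norm hh Ux; rewrite ler_norml => /andP[k1 _]; lra.
have g2 x : U x -> `|g x| <= 2.
  move=> Ux; have k := h1 _ Ux.
  rewrite /g ger0_norm ?invr_ge0 ?sqrtr_ge0// -[leRHS]invrK.
  rewrite lef_pV2 ?posrE ?invr_gt0// ?sqrtr_gt0; last by lra.
  rewrite -[leLHS]ger0_norm ?invr_ge0// -sqrtr_sqr ler_sqrt; last by lra.
  by apply: le_trans k; rewrite exprVn; lra.
have Pg x : U x -> has_partials g x /\
    forall i, pd i g x = (- 2^-1 * g x ^+ 3) * pd i h x.
  move=> Ux; have k := h1 _ Ux.
  have [k1 k2] := partials_cst (1 : R) x.
  have [k3 k4] := partialsD k1 (cls_partials hh Ux).
  have hz : 0 < 1 + h x by lra.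
  have [k5 k6] := partials_comp k3 (is_derive_rsqrt hz).
  by split => // i; rewrite k6 k4 k2 add0r.
elim=> [|n IH]; first by split => // x Ux; rewrite expr0 !mulr1; exact: g2.
split; first by move=> x Ux; rewrite expr0 !mulr1; exact: g2.
split; first by move=> x /Pg[].
move=> i.
have hi : bnd r n (fun k => eta * L ^+ k.+1 * wt k.+1) (pd i h).
  by have [_ [_ /(_ i)]] := hh n.+1.
have M1 := bndM (bndM (bndM IH IH) IH) hi.
have M2 := bndZ (- 2^-1) M1.
apply: bnd_eq (bnd_le _ M2) => [y Uy|k].
  by rewrite (Pg _ Uy).2; ring.
rewrite normrN ger0_norm ?invr_ge0//.
have W3 j : leib (leib (fun k => 2 * L ^+ k * wt k) (fun k => 2 * L ^+ k * wt k))
    (fun k => 2 * L ^+ k * wt k) j <= 72 * L ^+ j * wt j.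
  apply: (@le_trans _ _ (leib (fun k => 12 * L ^+ k * wt k)
     (fun k => 2 * L ^+ k * wt k) j)).
    apply: ler_sum => m _; rewrite ler_wpM2l ?ler0n// ler_wpM2r//.
      by rewrite !mulr_ge0 ?exprn_ge0 ?wt_ge0.
    rewrite leib_scale [leRHS](_ : _ = 2 * 2 * L ^+ m * (3 * wt m)); last by ring.
    by rewrite ler_wpM2l ?wt_leib// !mulr_ge0// exprn_ge0.
  rewrite leib_scale [leRHS](_ : _ = 12 * 2 * L ^+ j * (3 * wt j)); last by ring.
  by rewrite ler_wpM2l ?wt_leib// !mulr_ge0// exprn_ge0.
set W := fun k => eta * L ^+ k * wt k.
(* By [leibS] the sum with the shifted sequence of [h] is part of a full Leibniz sum of order k + 1,
   to which [wt_leib] applies. *)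
apply: (@le_trans _ _ (2^-1 * leib (fun k => 72 * L ^+ k * wt k) W k.+1)).
  rewrite ler_wpM2l ?invr_ge0// leibS -[leLHS]add0r lerD//.
    apply: sumr_ge0 => j _.
    by rewrite !mulr_ge0 ?exprn_ge0 ?wt_ge0.
  apply: ler_sum => m _; rewrite ler_wpM2l ?ler0n// ler_wpM2r//.
  by rewrite !mulr_ge0 ?exprn_ge0 ?wt_ge0.
rewrite /W leib_scale.
apply: (@le_trans _ _ (2^-1 * (72 * eta * L ^+ k.+1 * (3 * wt k.+1)))).
  by rewrite !ler_wpM2l ?invr_ge0 ?wt_leib// !mulr_ge0// exprn_ge0.
rewrite [leLHS](_ : _ = (108 * eta) * (L ^+ k.+1 * wt k.+1)); last by field.
rewrite -[leRHS]mulrA ler_wpM2r//; last by lra.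
by rewrite mulr_ge0 ?exprn_ge0 ?wt_ge0.
Qed.

End Class.

(** * Qualitative smoothness, directional derivatives and frames *)

Section Smooth.
Context {R : realType}.
Variable r : R.
Local Notation U := (square r).
Local Notation P2 := (R * R)%type.
Implicit Types (f g : P2 -> R) (x : P2) (i : bool).

(** For objects whose size does not matter, above all the potentials of trivial fields. *)
Definition sm f := exists G, forall n, bnd r n G f.

Lemma sm_cls M L f : cls r M L f -> sm f.
Proof. by move=> h; exists (fun k => M * L ^+ k * wt k). Qed.

Lemma sm_partials f : sm f -> forall x, U x -> has_partials f x.
Proof. by case=> G /(_ 1%N)[_ []]. Qed.

Lemma sm_eq f g : (forall y, U y -> f y = g y) -> sm f -> sm g.
Proof. by move=> fg [G h]; exists G => n; exact: bnd_eq (h n). Qed.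

Lemma smD f g : sm f -> sm g -> sm (fun x => f x + g x).
Proof. by move=> [G hf] [H hg]; eexists => n; exact: bndD (hf n) (hg n). Qed.

Lemma smM f g : sm f -> sm g -> sm (fun x => f x * g x).
Proof. by move=> [G hf] [H hg]; eexists => n; exact: bndM (hf n) (hg n). Qed.

Lemma smZ (c : R) f : sm f -> sm (fun x => c * f x).
Proof. by move=> [G hf]; eexists => n; exact: bndZ (hf n). Qed.

Lemma smN f : sm f -> sm (fun x => - f x).
Proof. by move=> /(smZ (-1)); apply: sm_eq => y _; rewrite mulN1r. Qed.

Lemma smB f g : sm f -> sm g -> sm (fun x => f x - g x).
Proof. by move=> hf hg; exact: smD hf (smN hg). Qed.

Lemma sm_pd f i : sm f -> sm (pd i f).
Proof.
by move=> [G hf]; exists (fun k => G k.+1) => n; have [_ [_]] := hf n.+1; apply.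
Qed.

Lemma sm_cst (c : R) : sm (fun=> c).
Proof. by apply: (@sm_cls `|c| 1); exact: cls_cst. Qed.

Lemma sm_lin (a b : R) : sm (fun x => a * x.1 + b * x.2).
Proof.
pose G k := `|a| * `|r| + `|b| * `|r| + if k is 0%N then 0 else `|a| + `|b|.
have G0 k : 0 <= G k by rewrite /G; case: k => *; rewrite ?addr_ge0 ?mulr_ge0.
exists G => n.
have B x : U x -> `|a * x.1 + b * x.2| <= G 0%N.
  move=> [h1 h2]; rewrite /G addr0 (le_trans (ler_normD _ _))// !normrM lerD//.
    by rewrite ler_wpM2l// ltW// (lt_le_trans h1)// ler_norm.
  by rewrite ler_wpM2l// ltW// (lt_le_trans h2)// ler_norm.
case: n => [|n]; split => //; split.
  by move=> x _; case: (partials_lin a b x).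
move=> i; apply: (@bnd_eq _ _ _ _ (fun=> if i then b else a)).
  by move=> y _; case: (partials_lin a b y) => _ ->.
apply: bnd_cst => //.
have h1 : 0 <= `|a| * `|r| by rewrite mulr_ge0.
have h2 : 0 <= `|b| * `|r| by rewrite mulr_ge0.
have := normr_ge0 a; have := normr_ge0 b.
by rewrite /G; case: i; lra.
Qed.

Definition dop (a : R * R) f : P2 -> R := fun x => a.1 * pd1 f x + a.2 * pd2 f x.

Lemma sm_dop a f : sm f -> sm (dop a f).
Proof.
by move=> h; apply: smD; apply: smZ; [exact: (sm_pd false h)|exact: (sm_pd true h)].
Qed.

Lemma cls_dop a M L f : `|a.1| <= 1 -> `|a.2| <= 1 -> 0 <= M -> 0 <= L ->
  cls r M L f -> cls r (2 * M * L) (8 * L) (dop a f).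
Proof.
move=> a1 a2 M0 L0 h.
have k1 := clsZ a.1 (cls_pd false h); have k2 := clsZ a.2 (cls_pd true h).
apply: cls_le (clsD k1 k2) => //; rewrite ?addr_ge0 ?mulr_ge0//.
rewrite -mulrDl -[leRHS]mulrA ler_wpM2r ?mulr_ge0//; lra.
Qed.

Lemma dopD a f g x : has_partials f x -> has_partials g x ->
  dop a (fun y => f y + g y) x = dop a f x + dop a g x.
Proof.
move=> hf hg; have [_ h] := partialsD hf hg.
by have /= h1 := h false; have /= h2 := h true; rewrite /dop h1 h2; ring.
Qed.

Lemma dopM a f g x : has_partials f x -> has_partials g x ->
  dop a (fun y => f y * g y) x = dop a f x * g x + f x * dop a g x.
Proof.
move=> hf hg; have [_ h] := partialsM hf hg.
by have /= h1 := h false; have /= h2 := h true; rewrite /dop h1 h2; ring.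
Qed.

Lemma partialsZ (c : R) f x : has_partials f x ->
  has_partials (fun y => c * f y) x.
Proof.
by move=> hf; have [h _] := partialsM (partials_cst c x).1 hf.
Qed.

Lemma dopZ a (c : R) f x : has_partials f x ->
  dop a (fun y => c * f y) x = c * dop a f x.
Proof.
move=> hf; have [_ h] := partialsM (partials_cst c x).1 hf.
have [_ k] := partials_cst c x.
have /= h1 := h false; have /= h2 := h true.
have /= k1 := k false; have /= k2 := k true.
by rewrite /dop h1 h2 k1 k2; ring.
Qed.

Lemma dop_comp a (h : R -> R) (d : R) f x : has_partials f x ->
  is_derive (f x) 1 h d -> dop a (fun y => h (f y)) x = d * dop a f x.
Proof.
move=> hf hh; have [_ k] := partials_comp hf hh.
by have /= k1 := k false; have /= k2 := k true; rewrite /dop k1 k2; ring.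
Qed.

Lemma dop_lin a (b c : R) x : dop a (fun y => b * y.1 + c * y.2) x = a.1 * b + a.2 * c.
Proof.
have [_ k] := partials_lin b c x.
by have /= k1 := k false; have /= k2 := k true; rewrite /dop k1 k2.
Qed.

(* A frame is a pair of directional derivatives P, Q with det (P, Q) = 1; the
   phase q2 x1 - q1 x2 satisfies P t = 1 and Q t = 0. *)
Definition frame := ((R * R) * (R * R))%type.

Definition good_frame (fr : frame) :=
  [/\ fr.1.1 * fr.2.2 - fr.1.2 * fr.2.1 = 1,
      `|fr.1.1| <= 1 /\ `|fr.1.2| <= 1, `|fr.2.1| <= 1 /\ `|fr.2.2| <= 1 &
      `|fr.2.1 - fr.1.1| <= 1 /\ `|fr.2.2 - fr.1.2| <= 1].

(* The frame is turned so that the directions of the three components are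
   permuted cyclically; the cube of this map is the identity. *)
Definition rotf (fr : frame) : frame :=
  ((fr.2.1 - fr.1.1, fr.2.2 - fr.1.2), (- fr.1.1, - fr.1.2)).

Lemma good_rotf fr : good_frame fr -> good_frame (rotf fr).
Proof.
case=> d [p1 p2] [q1 q2] [u1 u2]; split => /=.
- by rewrite -d; ring.
- by [].
- by rewrite !normrN.
- split; first by rewrite (_ : _ - _ = - fr.2.1) ?normrN//; ring.
  by rewrite (_ : _ - _ = - fr.2.2) ?normrN//; ring.
Qed.

End Smooth.

Opaque has_partials.

(** * Frames and trivial fields *)

Section Triv.
Context {R : realType}.
Variable r : R.
Local Notation U := (square r).
Local Notation P2 := (R * R)%type.
Local Notation sm := (sm r).
Implicit Types (f g v : P2 -> R) (x : P2) (fr : frame (R := R)).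

(* E1, E2, E3 are the components along P, P-Q, Q of the symmetrised gradient of
   (al, be) in the frame, i.e. of a field annihilated by curl curl. *)
Definition triv fr (E1 E2 E3 : P2 -> R) := exists al be, [/\ sm al, sm be &
  forall x, U x -> [/\ E1 x = dop fr.1 al x,
    E2 x = 2^-1 * (dop fr.2 al x + dop fr.1 be x) & E3 x = dop fr.2 be x]].

Lemma triv_pot fr al be : sm al -> sm be ->
  triv fr (dop fr.1 al) (fun x => 2^-1 * (dop fr.2 al x + dop fr.1 be x))
    (dop fr.2 be).
Proof. by move=> h1 h2; exists al, be. Qed.

Lemma triv_eq fr E1 E2 E3 F1 F2 F3 :
  (forall x, U x -> [/\ E1 x = F1 x, E2 x = F2 x & E3 x = F3 x]) ->
  triv fr E1 E2 E3 -> triv fr F1 F2 F3.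
Proof.
move=> h [al [be [h1 h2 h3]]]; exists al, be; split => // x Ux.
by case: (h _ Ux) => <- <- <-; exact: h3.
Qed.

Lemma trivD fr E1 E2 E3 F1 F2 F3 : triv fr E1 E2 E3 -> triv fr F1 F2 F3 ->
  triv fr (fun x => E1 x + F1 x) (fun x => E2 x + F2 x) (fun x => E3 x + F3 x).
Proof.
move=> [al [be [h1 h2 h3]]] [al' [be' [k1 k2 k3]]].
exists (fun x => al x + al' x), (fun x => be x + be' x); split; [exact: smD..|].
move=> x Ux; case: (h3 _ Ux) => -> -> ->; case: (k3 _ Ux) => -> -> ->.
have p1 := sm_partials h1 Ux; have p2 := sm_partials h2 Ux.
have p3 := sm_partials k1 Ux; have p4 := sm_partials k2 Ux.
by rewrite !dopD//; split => //; ring.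
Qed.

Lemma trivZ fr (c : R) E1 E2 E3 : triv fr E1 E2 E3 ->
  triv fr (fun x => c * E1 x) (fun x => c * E2 x) (fun x => c * E3 x).
Proof.
move=> [al [be [h1 h2 h3]]].
exists (fun x => c * al x), (fun x => c * be x); split; [exact: smZ..|].
move=> x Ux; case: (h3 _ Ux) => -> -> ->.
have p1 := sm_partials h1 Ux; have p2 := sm_partials h2 Ux.
by rewrite !dopZ//; split => //; ring.
Qed.

Definition phase fr (x : P2) := fr.2.2 * x.1 + (- fr.2.1) * x.2.

Lemma sm_phase fr : sm (phase fr).
Proof. exact: sm_lin. Qed.

Lemma partials_phase fr lam x : has_partials (fun y => lam * phase fr y) x.
Proof. by apply: partialsZ; case: (partials_lin fr.2.2 (- fr.2.1) x). Qed.

Lemma dop_phase a fr x : dop a (phase fr) x = a.1 * fr.2.2 - a.2 * fr.2.1.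
Proof. by rewrite dop_lin mulrN. Qed.

Lemma dop_sin a fr lam x : dop a (fun y => sin (lam * phase fr y)) x =
  lam * (a.1 * fr.2.2 - a.2 * fr.2.1) * cos (lam * phase fr x).
Proof.
rewrite (dop_comp _ (partials_phase fr lam x) (is_derive_sin _)).
rewrite dopZ ?dop_phase; first by ring.
by case: (partials_lin fr.2.2 (- fr.2.1) x).
Qed.

Lemma dop_cos a fr lam x : dop a (fun y => cos (lam * phase fr y)) x =
  - (lam * (a.1 * fr.2.2 - a.2 * fr.2.1) * sin (lam * phase fr x)).
Proof.
rewrite (dop_comp _ (partials_phase fr lam x) (is_derive_cos _)).
rewrite dopZ ?dop_phase; first by ring.
by case: (partials_lin fr.2.2 (- fr.2.1) x).
Qed.

Section Frame.
Variable fr : frame (R := R).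
Hypothesis gfr : good_frame fr.
Local Notation P := (dop fr.1).
Local Notation Q := (dop fr.2).
Local Notation S l := (fun x => sin (l * phase fr x)).
Local Notation C l := (fun x => cos (l * phase fr x)).

Lemma PS lam x : P (S lam) x = lam * cos (lam * phase fr x).
Proof. by case: gfr => d _ _ _; rewrite dop_sin d mulr1. Qed.
Lemma QS lam x : Q (S lam) x = 0.
Proof. by rewrite dop_sin; ring. Qed.
Lemma PC lam x : P (C lam) x = - (lam * sin (lam * phase fr x)).
Proof. by case: gfr => d _ _ _; rewrite dop_cos d mulr1. Qed.
Lemma QC lam x : Q (C lam) x = 0.
Proof. by rewrite dop_cos; ring. Qed.
Lemma Pphase x : P (phase fr) x = 1.
Proof. by case: gfr => d _ _ _; rewrite dop_phase. Qed.
Lemma Qphase x : Q (phase fr) x = 0.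
Proof. by rewrite dop_phase; ring. Qed.

Lemma frame_le1 : [/\ `|fr.1.1| <= 1, `|fr.1.2| <= 1, `|fr.2.1| <= 1 & `|fr.2.2| <= 1].
Proof. by case: gfr => _ [? ?] [? ?] _. Qed.

Lemma cls_S lam : 0 <= lam -> cls r 1 lam (S lam).
Proof. by case: frame_le1 => *; apply: cls_sin; rewrite ?normrN. Qed.

Lemma cls_C lam : 0 <= lam -> cls r 1 lam (C lam).
Proof. by case: frame_le1 => *; apply: cls_cos; rewrite ?normrN. Qed.

(** [osc1], [osc2] and [osc3] are the amplitudes left after one integration by parts of an
    oscillating field with vanishing third component. *)
Definition osc1 lam (E1 : P2 -> R) : P2 -> R := fun x => lam^-1 * P E1 x.
Definition osc2 lam (E1 E2 : P2 -> R) : P2 -> R :=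
  fun x => lam^-1 * (2^-1 * Q E1 x + P E2 x).
Definition osc3 lam (E2 : P2 -> R) : P2 -> R := fun x => lam^-1 * (2 * Q E2 x).

(* Modulo trivial fields an oscillating field is one order smaller, except for
   its third component. *)
Lemma conv_sin lam E1 E2 : 0 < lam -> sm E1 -> sm E2 ->
  triv fr (fun x => E1 x * S lam x - osc1 lam E1 x * C lam x)
    (fun x => E2 x * S lam x - osc2 lam E1 E2 x * C lam x)
    (fun x => - (osc3 lam E2 x * C lam x)).
Proof.
move=> l0 h1 h2; have sC := sm_cls (cls_C (ltW l0)).
(* These potentials are antiderivatives in the phase. [P] differentiates the oscillation and
   restores the first two components; [Q] does not see the phase, so the third component only
   receives [Q] of an amplitude, with the gain 1/lam. *)
exists (fun x => - lam^-1 * (E1 x * C lam x)), (fun x => - (2 * lam^-1) * (E2 x * C lam x)).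
split; [exact: smZ (smM h1 sC)|exact: smZ (smM h2 sC)|] => x Ux.
have p1 := sm_partials h1 Ux; have p2 := sm_partials h2 Ux.
have pC := sm_partials sC Ux.
rewrite !dopZ; try exact: (partialsM _ _).1.
rewrite !dopM// !PC !QC /osc1 /osc2 /osc3; have l1 := lt0r_neq0 l0.
by split; field.
Qed.

Lemma conv_cos lam E1 E2 : 0 < lam -> sm E1 -> sm E2 ->
  triv fr (fun x => E1 x * C lam x + osc1 lam E1 x * S lam x)
    (fun x => E2 x * C lam x + osc2 lam E1 E2 x * S lam x)
    (fun x => osc3 lam E2 x * S lam x).
Proof.
move=> l0 h1 h2; have sS := sm_cls (cls_S (ltW l0)).
exists (fun x => lam^-1 * (E1 x * S lam x)), (fun x => (2 * lam^-1) * (E2 x * S lam x)).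
split; [exact: smZ (smM h1 sS)|exact: smZ (smM h2 sS)|] => x Ux.
have p1 := sm_partials h1 Ux; have p2 := sm_partials h2 Ux.
have pC := sm_partials sS Ux.
rewrite !dopZ; try exact: (partialsM _ _).1.
rewrite !dopM// !PS !QS /osc1 /osc2 /osc3; have l1 := lt0r_neq0 l0.
by split; field.
Qed.

Lemma sm_osc1 lam E1 : sm E1 -> sm (osc1 lam E1).
Proof. by move=> h; apply: smZ; exact: sm_dop. Qed.

Lemma sm_osc2 lam E1 E2 : sm E1 -> sm E2 -> sm (osc2 lam E1 E2).
Proof.
move=> h1 h2; apply: smZ; apply: smD; last exact: sm_dop.
by apply: smZ; exact: sm_dop.
Qed.

Lemma cls_osc lam M L E1 E2 : 0 < lam -> 0 <= M -> 0 <= L ->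
  cls r M L E1 -> cls r M L E2 ->
  [/\ cls r (4 * M * (L / lam)) (8 * L) (osc1 lam E1),
      cls r (4 * M * (L / lam)) (8 * L) (osc2 lam E1 E2) &
      cls r (4 * M * (L / lam)) (8 * L) (osc3 lam E2)].
Proof.
move=> l0 M0 L0 h1 h2; case: frame_le1 => f1 f2 f3 f4.
have P1 := cls_dop f1 f2 M0 L0 h1; have P2 := cls_dop f1 f2 M0 L0 h2.
have Q1 := cls_dop f3 f4 M0 L0 h1; have Q2 := cls_dop f3 f4 M0 L0 h2.
have ML : 0 <= M * L by rewrite mulr_ge0.
have i0 : 0 <= lam^-1 by rewrite invr_ge0 ltW.
have X : 0 <= M * (L / lam) by rewrite !mulr_ge0.
split.
- apply: cls_le (clsZ lam^-1 P1); rewrite ?mulr_ge0//.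
  by rewrite ger0_norm// [leLHS](_ : _ = 2 * (M * (L / lam))); [lra|ring].
- apply: cls_le (clsZ lam^-1 (clsD (clsZ 2^-1 Q1) P2)); rewrite ?mulr_ge0 ?addr_ge0 ?mulr_ge0//.
  rewrite !ger0_norm// [leLHS](_ : _ = 3 * (M * (L / lam))); [lra|field].
  by rewrite gt_eqF.
- apply: cls_le (clsZ lam^-1 (clsZ 2 Q2)); rewrite ?mulr_ge0//.
  by rewrite !ger0_norm// [leLHS](_ : _ = 4 * (M * (L / lam))); [lra|ring].
Qed.

(* Modulo trivial fields A - grad v (x) grad v / 2 equals
   c1 xi (x) xi + c2 eta (x) eta + c3 zeta (x) zeta with xi, eta dual to P, Q and
   zeta = xi + eta up to sign; A1, A2, A3 are the coefficients of A in the same basis. *)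
Definition state (A1 A2 A3 v c1 c2 c3 : P2 -> R) :=
  triv fr (fun x => A1 x + A3 x - 2^-1 * (P v x * P v x) - (c1 x + c3 x))
    (fun x => A3 x - 2^-1 * (P v x * Q v x) - c3 x)
    (fun x => A2 x + A3 x - 2^-1 * (Q v x * Q v x) - (c2 x + c3 x)).

Section Algebra.
Variables (v a : P2 -> R) (lam : R).
Hypotheses (l0 : 0 < lam) (sv : sm v) (sa : sm a).

(* The corrugation; taking a ^+ 2 = 4 (c1 + k) cancels c1 + k on average. *)
Definition corr : P2 -> R := fun x => lam^-1 * (a x * S lam x).
(** [E1], [E2], [E3] are what the cross term of grad v and grad [corr] becomes, up to a sine, once
    the derivative is moved from [corr] to v. [F1], [F2] are the amplitudes of the sin (2 lam t)
    terms of the square of grad [corr], after its cos (2 lam t) term has been integrated. [G]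
    carries the products of two derivatives of a. *)
Let E1 : P2 -> R := fun x => lam^-1 * (a x * P (P v) x).
Let E2 : P2 -> R := fun x => lam^-1 * (a x * (2^-1 * (P (Q v) x + Q (P v) x))).
Let E3 : P2 -> R := fun x => lam^-1 * (a x * Q (Q v) x).
Let E1' := osc1 lam E1.
Let E2' := osc2 lam E1 E2.
Let E3' := osc3 lam E2.
Let F1 : P2 -> R := fun x => - (4 * lam)^-1 * (a x * P a x).
Let F2 : P2 -> R := fun x => - (8 * lam)^-1 * (a x * Q a x).
Let G (g : P2 -> R) : P2 -> R := fun x => (4 * lam ^+ 2)^-1 * ((1 - C (2 * lam) x) * g x).

Definition rem1 : P2 -> R := fun x => - (osc1 lam E1' x * S lam x) +
  osc1 (2 * lam) F1 x * C (2 * lam) x - G (fun x => P a x * P a x) x.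
Definition rem2 : P2 -> R := fun x => - (osc2 lam E1' E2' x * S lam x) +
  osc2 (2 * lam) F1 F2 x * C (2 * lam) x - G (fun x => P a x * Q a x) x.
Definition rem3 : P2 -> R := fun x => - (osc3 lam E2' x * S lam x) +
  osc3 (2 * lam) F2 x * C (2 * lam) x - G (fun x => Q a x * Q a x) x.
(** The third-component terms that no integration by parts reduces: the original one, and the one
    created by the first integration. They enter only the coefficient along the second direction,
    which is removed next. *)
Definition incr2 : P2 -> R := fun x => E3 x * S lam x + E3' x * C lam x.

Lemma sm_corr : sm corr.
Proof. by apply: smZ; apply: smM => //; exact: sm_cls (cls_S (ltW l0)). Qed.

Lemma state_step A1 A2 A3 c1 c2 c3 (k : R) :
  (forall x, U x -> a x * a x = 4 * (c1 x + k)) ->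
  state A1 A2 A3 v c1 c2 c3 ->
  state A1 A2 A3 (fun x => v x + corr x)
    (fun x => rem1 x - rem2 x)
    (fun x => c2 x + incr2 x + rem3 x - rem2 x)
    (fun x => c3 x + rem2 x).
Proof.
move=> ha T0.
have sS := sm_cls (cls_S (ltW l0)); have sC := sm_cls (cls_C (ltW l0)).
have l20 : 0 < 2 * lam by rewrite mulr_gt0.
have sS2 := sm_cls (cls_S (ltW l20)).
have sW := sm_corr.
have sPv := sm_dop fr.1 sv; have sQv := sm_dop fr.2 sv.
have sPa := sm_dop fr.1 sa; have sQa := sm_dop fr.2 sa.
have sE1 : sm E1 by apply: smZ; apply: smM => //; exact: sm_dop.
have sE2 : sm E2.
  by apply: smZ; apply: smM => //; apply: smZ; apply: smD; exact: sm_dop.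
have sE1' : sm E1' by exact: sm_osc1.
have sE2' : sm E2' by exact: sm_osc2.
have sF1 : sm F1 by apply: smZ; apply: smM => //; exact: sm_dop.
have sF2 : sm F2 by apply: smZ; apply: smM => //; exact: sm_dop.
(* [T1] moves the derivative off the corrugation in the cross term. [T2] integrates the oscillating
   half of a^2 cos^2. [T3] is the constant field that shifts c1 by k, with potential k times the
   phase. [T4] and [T5] integrate the cross term twice, [T6] the double-frequency term once more. *)
have T1 := trivZ (-1) (triv_pot fr (smM sW sPv) (smM sW sQv)).
have T2 := trivZ (- (8 * lam)^-1) (triv_pot fr (smM (smM sa sa) sS2) (sm_cst r 0)).
have T3 := trivZ (- k) (triv_pot fr (sm_phase fr) (sm_cst r 0)).
have T4 := conv_sin l0 sE1 sE2.
have T5 := conv_cos l0 sE1' sE2'.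
have T6 := conv_sin l20 sF1 sF2.
have T := trivD (trivD (trivD T0 T1) (trivD T2 T3)) (trivD T4 (trivD T5 T6)).
apply: triv_eq T => x Ux /=.
have pv := sm_partials sv Ux; have pW := sm_partials sW Ux.
have pa := sm_partials sa Ux; have pS := sm_partials sS Ux.
have pS2 := sm_partials sS2 Ux.
have pPv := sm_partials sPv Ux; have pQv := sm_partials sQv Ux.
have paa := (partialsM pa pa).1.
have paS := (partialsM pa pS).1.
have [pc0 dc0] := partials_cst (0 : R) x.
have D0 b : dop b (fun=> 0 : R) x = 0.
  by have /= h1 := dc0 false; have /= h2 := dc0 true; rewrite /dop h1 h2; ring.
have l1 := lt0r_neq0 l0.
have e2 : 2 * lam * phase fr x = (lam * phase fr x) *+ 2 by rewrite mulr2n; ring.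
have s2 : sin (2 * lam * phase fr x) = 2 * (sin (lam * phase fr x) * cos (lam * phase fr x)).
  by rewrite e2 sin_mulr2n mulr2n; ring.
have cs := cos2sin2 (lam * phase fr x).
have c2' : cos (2 * lam * phase fr x) = 1 - 2 * sin (lam * phase fr x) ^+ 2.
  by rewrite e2 cos_mulr2n cs mulr2n; ring.
have hPW : P corr x = a x * cos (lam * phase fr x) + lam^-1 * (P a x * sin (lam * phase fr x)).
  by rewrite /corr (dopZ _ _ paS) (dopM _ pa pS) PS; field.
have hQW : Q corr x = lam^-1 * (Q a x * sin (lam * phase fr x)).
  by rewrite /corr (dopZ _ _ paS) (dopM _ pa pS) QS; field.
have c1E : c1 x = 4^-1 * (a x * a x) - k by rewrite ha//; field.
rewrite !(dopD _ pv pW) !(dopM _ pW pPv) !(dopM _ pW pQv) !(dopM _ paa pS2).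
rewrite !(dopM _ pa pa) !D0 !PS !QS Pphase Qphase hPW hQW c1E.
rewrite /rem1 /rem2 /rem3 /incr2 /G /corr /E3 /E3'.
rewrite -/E1' -/E2'.
rewrite /= c2' s2.
have cc : cos (lam * phase fr x) * cos (lam * phase fr x) =
  1 - sin (lam * phase fr x) * sin (lam * phase fr x) by rewrite -!expr2.
move: (osc1 lam E1' x) (osc2 lam E1' E2' x) (osc3 lam E2' x) (osc1 (2 * lam) F1 x)
  (osc2 (2 * lam) F1 F2 x) (osc3 (2 * lam) F2 x) => o1 o2 o3 o4 o5 o6.
move: (E1' x) (E2' x) (osc3 lam E2 x) => w1 w2 w3; rewrite /E1 /E2 /F1 /F2.
move: (P (P v) x) (P (Q v) x) (Q (P v) x) (Q (Q v) x) => h11 h12 h21 h22.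
move: cc {c2' s2 hPW hQW cs e2}; move: (cos (lam * phase fr x)) (sin (lam * phase fr x)) => c s cc.
split; last by field.
(* The two sides differ by a multiple of cos^2 + sin^2 - 1, coming from the non-oscillating half of
   a^2 cos^2. *)
- apply/eqP; rewrite -subr_eq0; apply/eqP.
  rewrite [LHS](_ : _ = 2^-1 * (a x * a x) * (c * c - (1 - s * s))); first by rewrite cc; ring.
  by field.
- by field.
Qed.

End Algebra.

End Frame.

Lemma state_rot fr A1 A2 A3 v c1 c2 c3 : sm v ->
  state fr A1 A2 A3 v c1 c2 c3 -> state (rotf fr) A2 A3 A1 v c2 c3 c1.
Proof.
move=> sv [al [be [h1 h2 h3]]].
(* The potentials are the pairings of one displacement field with P and Q. The new frame is (Q - P,
   - P), so they become be - al and - al. *)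
exists (fun x => be x - al x), (fun x => - 1 * al x); split; [exact: smB|exact: smZ|].
move=> x Ux; have [k1 k2 k3] := h3 _ Ux.
have p1 := sm_partials h1 Ux; have p2 := sm_partials h2 Ux.
have D b : dop b (fun x => be x - al x) x = dop b be x - dop b al x.
  rewrite (_ : (fun x => _) = (fun x => be x + - 1 * al x)).
    by rewrite (dopD _ p2 (partialsZ _ p1)) (dopZ _ _ p1); ring.
  by apply/funext => y; ring.
rewrite !D !dopZ//.
have r1 f : dop (rotf fr).1 f x = dop fr.2 f x - dop fr.1 f x by rewrite /dop /=; ring.
have r2 f : dop (rotf fr).2 f x = - dop fr.1 f x by rewrite /dop /=; ring.
rewrite !r1 !r2; move: k1 k2 k3; move: (dop fr.1 v x) (dop fr.2 v x) (dop fr.1 al x)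
  (dop fr.2 al x) (dop fr.1 be x) (dop fr.2 be x) => p q a1 a2 b1 b2 k1 k2 k3.
split.
- have -> : A2 x + A1 x - 2^-1 * ((q - p) * (q - p)) - (c2 x + c1 x) =
    (A1 x + A3 x - 2^-1 * (p * p) - (c1 x + c3 x)) +
    (A2 x + A3 x - 2^-1 * (q * q) - (c2 x + c3 x)) -
    2 * (A3 x - 2^-1 * (p * q) - c3 x) by field.
  by rewrite k1 k2 k3; field.
- have -> : A1 x - 2^-1 * ((q - p) * - p) - c1 x =
    (A1 x + A3 x - 2^-1 * (p * p) - (c1 x + c3 x)) -
    (A3 x - 2^-1 * (p * q) - c3 x) by field.
  by rewrite k1 k2; field.
- have -> : A3 x + A1 x - 2^-1 * (- p * - p) - (c3 x + c1 x) =
    (A1 x + A3 x - 2^-1 * (p * p) - (c1 x + c3 x)) by field.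
  by rewrite k1; field.
Qed.

End Triv.

(** * One corrugation *)

Section Step.
Context {R : realType}.
Variable r : R.
Hypothesis r0 : 0 < r.
Local Notation U := (square r).
Local Notation P2 := (R * R)%type.
Local Notation sm := (sm r).
Local Notation cls := (cls r).

Lemma eqle (x y : R) : x = y -> x <= y.
Proof. by move=> ->. Qed.

Lemma cls_ge0 M L (f : P2 -> R) : cls M L f -> 0 <= M.
Proof.
move=> h; have U0 : U (0, 0) by split; rewrite /= normr0.
exact: le_trans (cls_norm h U0).
Qed.

Lemma cls_wk M L M' L' (f : P2 -> R) : cls M L f -> M <= M' -> 0 <= L -> L <= L' ->
  cls M' L' f.
Proof. by move=> h *; apply: (cls_le _ _ _ _ h) => //; exact: cls_ge0 h. Qed.

Lemma clsM' M N K L L1 L2 (f g : P2 -> R) : cls M L1 f -> cls N L2 g ->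
  0 <= L1 -> 0 <= L2 -> L1 <= L -> L2 <= L -> 3 * M * N <= K ->
  cls K L (fun x => f x * g x).
Proof.
move=> hf hg l1 l2 h1 h2 h3; have L0 := le_trans l1 h1.
apply: (cls_wk (M := 3 * M * N) (L := L))=> //.
apply: clsM; rewrite ?(cls_ge0 hf) ?(cls_ge0 hg)//.
  by apply: (cls_wk hf).
by apply: (cls_wk hg).
Qed.

Lemma cls_dopdop (a b : R * R) H L (v : P2 -> R) : sm v ->
  `|a.1| <= 1 -> `|a.2| <= 1 -> `|b.1| <= 1 -> `|b.2| <= 1 -> 0 <= L ->
  (forall i j, cls H L (pd i (pd j v))) -> cls (4 * H) L (dop a (dop b v)).
Proof.
move=> sv a1 a2 b1 b2 L0 h.
have H0 := cls_ge0 (h true true).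
have K := clsD (clsZ b.1 (clsD (clsZ a.1 (h false false)) (clsZ a.2 (h true false))))
  (clsZ b.2 (clsD (clsZ a.1 (h false true)) (clsZ a.2 (h true true)))).
apply: (cls_eq _ (cls_wk K _ _ _))=> //.
  move=> x Ux; have p1 := sm_partials (sm_pd false sv) Ux.
  have p2 := sm_partials (sm_pd true sv) Ux.
  rewrite [RHS](_ : _ = b.1 * dop a (pd false v) x + b.2 * dop a (pd true v) x) //.
  have := dopD a (partialsZ b.1 p1) (partialsZ b.2 p2).
  by rewrite (dopZ _ _ p1) (dopZ _ _ p2).
have k1 : `|a.1| * H + `|a.2| * H <= 2 * H.
  by rewrite -mulrDl ler_wpM2r//; lra.
have k2 : 0 <= `|a.1| * H + `|a.2| * H by rewrite addr_ge0 ?mulr_ge0.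
rewrite -mulrDl; apply: (@le_trans _ _ (2 * (`|a.1| * H + `|a.2| * H))); last by lra.
by rewrite ler_wpM2r//; lra.
Qed.

(** The three coefficients fare differently. The cross term with the Hessian, of size [m], enters
    only the coefficient treated next; [e] is what two integrations by parts leave everywhere. The
    output frequency [64 * lam] is that of the second derivatives of the corrugation, a factor 8 for
    each. *)
Lemma step (fr : frame) (A1 A2 A3 v c1 c2 c3 : P2 -> R) (sg H L lam m2 m3 : R) :
  good_frame fr -> 0 < sg -> 0 < L -> 64 * L <= lam ->
  cls (sg ^+ 2) L c1 -> cls m2 L c2 -> cls m3 L c3 ->
  sm v -> (forall i j, cls H L (pd i (pd j v))) ->
  state r fr A1 A2 A3 v c1 c2 c3 ->
  exists W c1' c2' c3',
    let m := sg * H / lam in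
    let e := (10 ^+ 7) * (m + sg ^+ 2) * (L / lam) ^+ 2 in
    [/\ cls (576 * sg / lam) lam W,
        state r (rotf fr) A2 A3 A1 (fun x => v x + W x) c2' c3' c1',
        cls (m2 + (10 ^+ 5) * m + e) (64 * lam) c2',
        cls (m3 + e) (64 * lam) c3' &
        cls e (64 * lam) c1'].
Proof.
move=> gfr sg0 L0 Ll hc1 hc2 hc3 sv hv st.
have l0 : 0 < lam by lra.
have H0 := cls_ge0 (hv true true).
have Lg : 0 <= L by exact: ltW.
have lg : 0 <= lam by exact: ltW.
have L8 : 0 <= 8 * L by clear -L0; lra.
have L64 : 0 <= 8 * (8 * L) by clear -L0; lra.
have L88 : L <= 8 * L by clear -L0; lra.
have Ll1 : L <= lam by clear -L0 Ll; lra.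
have L8l : 8 * L <= 64 * lam by clear -L0 Ll; lra.
have L1l : L <= 64 * lam by clear -L0 Ll; lra.
have L64l : 8 * (8 * L) <= 64 * lam by clear -L0 Ll; lra.
have l1l : lam <= 64 * lam by clear -l0; lra.
have l2l : 2 * lam <= 64 * lam by clear -l0; lra.
have l20 : 0 <= 2 * lam by clear -l0; lra.
have l20' : 0 < 2 * lam by clear -l0; lra.
have l64 : 0 <= 64 * lam by clear -l0; lra.
have s2 : 0 < sg ^+ 2 by rewrite exprn_gt0.
(* The constant added to c1: the quotient c1 / k is at most 1/64, below the threshold 1/54 of
   [cls_rsqrt]. *)
pose k := 64 * sg ^+ 2; have k0 : 0 < k by rewrite mulr_gt0.
pose h : P2 -> R := fun x => k^-1 * c1 x.
(* This is 16 sg sqrt (1 + h), written through the reciprocal root that [cls_rsqrt] controls; 16^2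
   sg^2 = 4 k gives a^2 = 4 (c1 + k). *)
pose a : P2 -> R := fun x => (16 * sg) * ((1 + h x) * (Num.sqrt (1 + h x))^-1).
have hh : cls (64^-1) L h.
  apply: (cls_wk (clsZ k^-1 hc1)) => //.
  rewrite ger0_norm ?invr_ge0 ?(ltW k0)//; apply: eqle.
  by rewrite /k; field; rewrite gt_eqF.
have hr : cls 2 L (fun x => (Num.sqrt (1 + h x))^-1).
  by apply: cls_rsqrt hh; lra.
have h1 : cls 2 L (fun x => 1 + h x).
  have c1' : cls 1 L (fun=> 1 : R) by apply: cls_cst; rewrite ?normr1.
  by apply: (cls_wk (clsD c1' hh)) => //; lra.
have ha : cls (192 * sg) L a.
  apply: (cls_wk (clsZ (16 * sg) (clsM _ _ _ h1 hr)))=> //.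
  rewrite ger0_norm; [lra|apply: mulr_ge0; lra].
have a2 x : U x -> a x * a x = 4 * (c1 x + k).
  move=> Ux; have : 0 < 1 + h x.
    by have := cls_norm hh Ux; rewrite ler_norml => /andP[? _]; lra.
  move=> hx; have q0 : 0 < Num.sqrt (1 + h x) by rewrite sqrtr_gt0.
  have qq : Num.sqrt (1 + h x) * Num.sqrt (1 + h x) = 1 + h x.
    by rewrite -expr2 sqr_sqrtr// ltW.
  have -> : a x = 16 * sg * Num.sqrt (1 + h x).
    by rewrite /a -{1}qq; field; rewrite gt_eqF.
  rewrite [LHS](_ : _ = 256 * sg ^+ 2 * (Num.sqrt (1 + h x) * Num.sqrt (1 + h x))).
    by rewrite qq /h /k; field; rewrite gt_eqF.
  by ring.
clearbody a.
have sa := sm_cls ha.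
have T := state_step gfr l0 sv sa a2 st.
have sW := sm_corr gfr l0 sa.
clear hh hr h1 k0 a2 h k.
exists (corr fr a lam).
pose m := sg * H / lam; pose rho := L / lam.
have m0 : 0 <= m by rewrite /m divr_ge0 ?mulr_ge0 // ltW.
have rho0 : 0 <= rho by rewrite /rho divr_ge0.
have rho1 : rho <= 64^-1.
  by rewrite /rho ler_pdivrMr//; lra.
case: (frame_le1 gfr) => f1 f2 f3 f4.
have il : 0 <= lam^-1 by rewrite invr_ge0.
have ail : cls (192 * sg / lam) L (fun x => lam^-1 * a x).
  by apply: (cls_wk (clsZ lam^-1 ha)) => //; rewrite ger0_norm//; lra.
have h11 := cls_dopdop sv f1 f2 f1 f2 Lg hv.
have h12 := cls_dopdop sv f1 f2 f3 f4 Lg hv.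
have h21 := cls_dopdop sv f3 f4 f1 f2 Lg hv.
have h22 := cls_dopdop sv f3 f4 f3 f4 Lg hv.
have hmix : cls (4 * H) L (fun x => 2^-1 * (dop fr.1 (dop fr.2 v) x + dop fr.2 (dop fr.1 v) x)).
  apply: (cls_wk (clsZ 2^-1 (clsD h12 h21)))=> //.
  by rewrite ger0_norm//; lra.
have mE : (48*48) * m = 3 * (192 * sg / lam) * (4 * H) by rewrite /m; field; rewrite gt_eqF.
have hE g : cls (4 * H) L g -> cls ((48*48) * m) L (fun x => lam^-1 * (a x * g x)).
  move=> hg; apply: cls_eq (clsM' ail hg Lg Lg (lexx L) (lexx L) _).
    by move=> y _; rewrite mulrA.
  by rewrite mE.
clear mE; have hE1 := hE _ h11; have hE2 := hE _ hmix; have hE3 := hE _ h22.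
have hS := cls_S r gfr lg; have hC := cls_C r gfr lg.
have hC2 := cls_C r gfr l20.
have M0 : 0 <= (48*48) * m by clear -m0; lra.
have [hE1' hE2' hE3'] := cls_osc gfr l0 M0 Lg hE1 hE2.
have M0' : 0 <= 4 * ((48*48) * m) * rho by apply: mulr_ge0 => //; apply: mulr_ge0.
have [hE1'' hE2'' hE3''] := cls_osc gfr l0 M0' L8 hE1' hE2'.
have sg1 : 0 <= 192 * sg by clear -sg0; lra.
have hPa := cls_dop f1 f2 sg1 Lg ha; have hQa := cls_dop f3 f4 sg1 Lg ha.
have haa g : cls (2 * (192 * sg) * L) (8 * L) g ->
    cls ((96*48*48) * sg ^+ 2 * L) (8 * L) (fun x => a x * g x).
  move=> hg; apply: (clsM' ha hg)=> //.
  by apply: eqle; ring.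
have D0 : 0 <= sg ^+ 2 * rho by rewrite mulr_ge0// ltW.
have hF1 : cls ((24*48*48) * (sg ^+ 2 * rho)) (8 * L)
    (fun x => - (4 * lam)^-1 * (a x * dop fr.1 a x)).
  apply: (cls_wk (clsZ _ (haa _ hPa)))=> //.
  rewrite normrN ger0_norm ?invr_ge0 ?mulr_ge0//; apply: eqle.
  by rewrite /rho; field; rewrite gt_eqF.
have hF2 : cls ((24*48*48) * (sg ^+ 2 * rho)) (8 * L)
    (fun x => - (8 * lam)^-1 * (a x * dop fr.2 a x)).
  apply: (cls_wk (clsZ _ (haa _ hQa)))=> //.
  rewrite normrN ger0_norm ?invr_ge0 ?mulr_ge0//.
  rewrite [leLHS](_ : _ = (12*48*48) * (sg ^+ 2 * rho)); first by clear -D0; lra.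
  by rewrite /rho; field; rewrite gt_eqF.
have N0 : 0 <= (24*48*48) * (sg ^+ 2 * rho) by apply: mulr_ge0.
have [hF1' hF2' hF3'] := cls_osc gfr l20' N0 L8 hF1 hF2.
have hrem o1 o2 g1 g2 :
    cls (4 * (4 * ((48*48) * m) * rho) * (8 * L / lam)) (8 * (8 * L)) o1 ->
    cls (4 * ((24*48*48) * (sg ^+ 2 * rho)) * (8 * L / (2 * lam))) (8 * (8 * L)) o2 ->
    cls (2 * (192 * sg) * L) (8 * L) g1 -> cls (2 * (192 * sg) * L) (8 * L) g2 ->
    cls ((4 * 10 ^+ 6) * (m + sg ^+ 2) * rho ^+ 2) (64 * lam) (fun x =>
      - (o1 x * sin (lam * phase fr x)) + o2 x * cos (2 * lam * phase fr x) -
      (4 * lam ^+ 2)^-1 * ((1 - cos (2 * lam * phase fr x)) * (g1 x * g2 x))).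
  move=> ho1 ho2 hg1 hg2.
  have K1 : cls ((4*96*48*48) * (m * rho ^+ 2)) (64 * lam)
      (fun x => - (o1 x * sin (lam * phase fr x))).
    apply: clsN; apply: (clsM' ho1 hS) => //.
    apply: eqle; rewrite /rho; ring.
  have K2 : cls ((12*96*48*48) * (sg ^+ 2 * rho ^+ 2)) (64 * lam)
      (fun x => o2 x * cos (2 * lam * phase fr x)).
    apply: (clsM' ho2 hC2) => //.
    apply: eqle; rewrite /rho; field.
    by rewrite gt_eqF.
  have K3 : cls ((192*48*48) * (sg ^+ 2 * L ^+ 2)) (64 * lam) (fun x => g1 x * g2 x).
    apply: (clsM' hg1 hg2) => //.
    apply: eqle; ring.
  have K4 : cls 2 (64 * lam) (fun x => 1 - cos (2 * lam * phase fr x)).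
    have c1' : cls 1 (2 * lam) (fun=> 1 : R) by apply: cls_cst; rewrite ?normr1.
    by apply: (cls_wk (clsB c1' hC2)) => //; clear; lra.
  have K5 := clsZ (4 * lam ^+ 2)^-1 (clsM' K4 K3 l64 l64 (lexx _) (lexx _) (lexx _)).
  apply: (cls_wk (clsB (clsD K1 K2) K5)) => //.
  have mr : 0 <= m * rho ^+ 2 by rewrite mulr_ge0 ?exprn_ge0.
  have sr : 0 <= sg ^+ 2 * rho ^+ 2 by rewrite mulr_ge0 ?exprn_ge0// ltW.
  rewrite ger0_norm ?invr_ge0 ?mulr_ge0 ?exprn_ge0//.
  rewrite [X in _ + _ + X](_ : _ = (288*48*48) * (sg ^+ 2 * rho ^+ 2)).
    by clear -mr sr; lra.
  by rewrite /rho; field; rewrite gt_eqF.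
have R1 := hrem _ _ _ _ hE1'' hF1' hPa hPa.
have R2 := hrem _ _ _ _ hE2'' hF2' hPa hQa.
have R3 := hrem _ _ _ _ hE3'' hF3' hQa hQa.
have I2 : cls ((10 ^+ 5) * m) (64 * lam) (incr2 fr v a lam).
  have J1 : cls ((3*48*48) * m) (64 * lam)
      (fun x => (lam^-1 * (a x * dop fr.2 (dop fr.2 v) x)) * sin (lam * phase fr x)).
    by apply: (clsM' hE3 hS) => //; clear -m0; lra.
  have J2 := clsM' (K := (12*48*48) * (m * rho)) (L := 64 * lam) hE3' hC L8 lg.
  have mr : m * rho <= m by rewrite -[leRHS]mulr1 ler_wpM2l//; clear -rho1; lra.
  apply: (cls_wk (clsD J1 (J2 _ _ _))) => //.
    by apply: eqle; rewrite /rho; ring.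
  by clear -mr m0; lra.
have e0 : 0 <= (m + sg ^+ 2) * rho ^+ 2.
  by rewrite mulr_ge0 ?exprn_ge0// addr_ge0// ltW.
eexists; eexists; eexists; rewrite -/m -/rho; split.
- have W1 := clsM' (K := 576 * sg) ha hS Lg lg Ll1 (lexx lam).
  apply: (cls_wk (clsZ lam^-1 (W1 _))) => //; first by clear -sg0; lra.
  by rewrite ger0_norm//; apply: eqle; ring.
- exact: (state_rot (smD sv sW) T).
- have V1 := clsB (clsD (clsD (cls_wk hc2 (lexx m2) Lg L1l) I2) R3) R2.
  by apply: (cls_wk V1) => //; clear -e0; lra.
- have V1 := clsD (cls_wk hc3 (lexx m3) Lg L1l) R2.
  by apply: (cls_wk V1) => //; clear -e0; lra.
- have V1 := clsB R1 R2.
  by apply: (cls_wk V1) => //; clear -e0; lra.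
Qed.

End Step.

Lemma dependent_choice_nat (X : Type) (Inv : nat -> X -> Prop)
    (Rel : nat -> X -> X -> Prop) (x0 : X) :
  Inv 0%N x0 ->
  (forall i x, Inv i x -> exists2 y, Inv i.+1 y & Rel i x y) ->
  exists s : nat -> X, s 0%N = x0 /\
    forall i, Inv i (s i) /\ Rel i (s i) (s i.+1).
Proof.
move=> h0 h.
pose nx i x := if pselect (exists2 y, Inv i.+1 y & Rel i x y) is left p
  then projT1 (cid2 p) else x.
have nxP i x : Inv i x -> Inv i.+1 (nx i x) /\ Rel i x (nx i x).
  move=> /h hx; rewrite /nx; case: pselect => // p.
  by case: (cid2 p).
pose fix s i := if i is j.+1 then nx j (s j) else x0.
have sI i : Inv i (s i) by elim: i => //= i /nxP[].
by exists s; split => // i; split => //; case: (nxP _ _ (sI i)).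
Qed.

(** * The iteration *)

Section Iteration.
Context {R : realType}.
Variable r : R.
Hypothesis r0 : 0 < r.
Local Notation U := (square r).
Local Notation P2 := (R * R)%type.
Local Notation sm := (sm r).
Local Notation cls := (cls r).

(** A state sees each pair A_k, c_k only through its difference, so a change of A can be charged to
    the coefficients. *)
Lemma state_shift (fr : frame) (A1 A2 A3 v c1 c2 c3 A1' A2' A3' c1' c2' c3' : P2 -> R) :
  (forall x, U x -> [/\ A1' x - c1' x = A1 x - c1 x, A2' x - c2' x = A2 x - c2 x
     & A3' x - c3' x = A3 x - c3 x]) ->
  state r fr A1 A2 A3 v c1 c2 c3 -> state r fr A1' A2' A3' v c1' c2' c3'.
Proof.
move=> h; apply: triv_eq => x /h[h1 h2 h3].
have -> : A1 x = A1' x - c1' x + c1 x by rewrite h1; ring.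
have -> : A2 x = A2' x - c2' x + c2 x by rewrite h2; ring.
have -> : A3 x = A3' x - c3' x + c3 x by rewrite h3; ring.
by split; ring.
Qed.

Definition fr0 : frame (R := R) := ((1, 0), (0, 1)).

Lemma good_fr0 : good_frame fr0.
Proof.
split => /=; rewrite ?normr0 ?normr1 //; first by ring.
by rewrite sub0r subr0 normrN normr1.
Qed.

Lemma good_iter i : good_frame (iter i rotf fr0).
Proof. by elim: i => [|i IH]; [exact: good_fr0|exact: good_rotf]. Qed.

(** Here [T * tau >= 10 ^+ 4] is spent, with y = 1 / (T tau): m is at most 9216 s^2 tau^2 y^3, and e
    is of order s^2 tau^6 y^6. The powers of y absorb the constants 10^5 and 10^7 of [step]. *)
Lemma iter_bounds (s tau y L S H lam : R) : 0 < s -> 0 < tau -> tau < 1 ->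
  0 < y -> y <= (10 ^+ 4)^-1 -> S^-1 = (y * tau) ^+ 3 -> 0 < S -> 0 < L ->
  lam = S * L / 64 -> 0 <= H -> H <= 144 * s * L / tau ->
  let m := s * H / lam in
  let e := 10 ^+ 7 * (m + s ^+ 2) * (L / lam) ^+ 2 in
  10 ^+ 5 * m <= 4^-1 * (s * tau) ^+ 2 /\ e <= 8^-1 * s ^+ 2 * tau ^+ 6.
Proof.
move=> s0 t0 t1 y0 y1 SE S0 L0 lamE H0 H1 m e.
have yt3 : 0 <= (y * tau) ^+ 3 by rewrite exprn_ge0// mulr_ge0// ltW.
have rhoE : L / lam = 64 * (y * tau) ^+ 3.
  rewrite -SE lamE; field; rewrite !gt_eqF//.
have s2 : 0 <= s ^+ 2 by rewrite exprn_ge0// ltW.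
have y3 : y ^+ 3 <= ((10 ^+ 4)^-1) ^+ 3 by rewrite lerXn2r// nnegrE ltW// invr_gt0 exprn_gt0.
have y30 : 0 <= y ^+ 3 by rewrite exprn_ge0// ltW.
have t2 : 0 <= tau ^+ 2 by rewrite exprn_ge0// ltW.
have t21 : tau ^+ 2 <= 1 by rewrite exprn_ile1// ltW.
have st : 0 <= s ^+ 2 * tau ^+ 2 by rewrite mulr_ge0.
have mE : m <= 9216 * (s ^+ 2 * tau ^+ 2) * y ^+ 3.
  have -> : m = s * H * (64 * (y * tau) ^+ 3 / L).
    by rewrite /m -rhoE; field; rewrite !gt_eqF//= lamE divr_gt0// mulr_gt0.
  have -> : 9216 * (s ^+ 2 * tau ^+ 2) * y ^+ 3 =
      s * (144 * s * L / tau) * (64 * (y * tau) ^+ 3 / L).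
    by field; rewrite !gt_eqF.
  rewrite ler_wpM2r//.
    by rewrite divr_ge0 ?mulr_ge0// ltW.
  by rewrite ler_wpM2l// ltW.
have m0 : 0 <= m by rewrite /m lamE divr_ge0 ?mulr_ge0 ?divr_ge0 ?mulr_ge0// ltW.
have sty : (s ^+ 2 * tau ^+ 2) * y ^+ 3 <= (s ^+ 2 * tau ^+ 2) * ((10 ^+ 4)^-1) ^+ 3.
  by rewrite ler_wpM2l.
split.
  rewrite exprMn; clear -mE sty st; rewrite -mulrA in mE.
  move: (s ^+ 2 * tau ^+ 2) (s ^+ 2 * tau ^+ 2 * y ^+ 3) mE sty st => p q; lra.
rewrite /e rhoE.
have ms : m + s ^+ 2 <= 2 * s ^+ 2.
  have : s ^+ 2 * tau ^+ 2 <= s ^+ 2 by rewrite -[leRHS]mulr1 ler_wpM2l.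
  rewrite -mulrA in mE; clear -mE sty st s2; move: mE sty.
  move: (s ^+ 2 * tau ^+ 2) (s ^+ 2 * tau ^+ 2 * y ^+ 3) st => p q; lra.
have y6 : y ^+ 3 * y ^+ 3 <= ((10 ^+ 4)^-1) ^+ 3 * ((10 ^+ 4)^-1) ^+ 3 by rewrite ler_pM.
have t6 : 0 <= tau ^+ 6 by rewrite exprn_ge0// ltW.
apply: (@le_trans _ _ (10 ^+ 7 * (2 * s ^+ 2) * (64 * (y * tau) ^+ 3) ^+ 2)).
  by rewrite ler_wpM2r ?ler_wpM2l// exprn_ge0// mulr_ge0.
have -> : 10 ^+ 7 * (2 * s ^+ 2) * (64 * (y * tau) ^+ 3) ^+ 2 =
  (s ^+ 2 * tau ^+ 6) * (2 * 10 ^+ 7 * 64 * 64 * (y ^+ 3 * y ^+ 3)) by ring.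
rewrite [leRHS](_ : _ = (s ^+ 2 * tau ^+ 6) * 8^-1); last by ring.
apply: ler_wpM2l; first exact: mulr_ge0.
clear -y6; by move: (y ^+ 3 * y ^+ 3) y6 => p; lra.
Qed.

Lemma iteration (T tau Lam s0 : R) (A : nat -> nat -> P2 -> R)
    (v00 c10 c20 c30 : P2 -> R) :
  0 < tau -> tau < 1 -> 10 ^+ 4 <= T * tau -> 0 < Lam -> 0 < s0 ->
  (forall i k, A i k.+3 = A i k) ->
  (forall i k, cls (8^-1 * (s0 * tau ^+ i) ^+ 2 * tau ^+ 6) (Lam * (T ^+ 3) ^+ i.+1)
     (fun x => A i.+1 k x - A i k x)) ->
  sm v00 -> (forall i j, cls (144 * s0 * Lam / tau) Lam (pd i (pd j v00))) ->
  cls (s0 ^+ 2) Lam c10 -> cls (2^-1 * (s0 * tau) ^+ 2) Lam c20 ->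
  cls (4^-1 * (s0 * tau ^+ 2) ^+ 2) Lam c30 ->
  state r fr0 (A 0 0)%N (A 0 1)%N (A 0 2)%N v00 c10 c20 c30 ->
  exists v c1 c2 c3 : nat -> P2 -> R, v 0%N = v00 /\ forall i,
    let s := s0 * tau ^+ i in let L := Lam * (T ^+ 3) ^+ i in
    let lam := T ^+ 3 * L / 64 in
    [/\ sm (v i), cls (576 * s / lam) lam (fun x => v i.+1 x - v i x),
       [/\ cls (s ^+ 2) L (c1 i), cls (s ^+ 2) L (c2 i) & cls (s ^+ 2) L (c3 i)] &
       state r (iter i rotf fr0) (A i i) (A i i.+1) (A i i.+2) (v i) (c1 i) (c2 i) (c3 i)].
Proof.
move=> t0 t1 Tt Lam0 s00 Ap AB sv hv hc1 hc2 hc3 st.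
have T0 : 0 < T.
  have : 0 < T * tau by apply: lt_le_trans Tt; rewrite exprn_gt0.
  by rewrite pmulr_lgt0.
pose S := T ^+ 3; have S0 : 0 < S by rewrite exprn_gt0.
pose sg i := s0 * tau ^+ i; pose L i := Lam * S ^+ i.
have sg0 i : 0 < sg i by rewrite mulr_gt0// exprn_gt0.
have L0 i : 0 < L i by rewrite mulr_gt0// exprn_gt0.
have T4 : 10 ^+ 4 <= T.
  by apply: le_trans Tt _; rewrite -[leRHS]mulr1 ler_wpM2l// ltW.
have S4 : 64 * 64 <= S.
  have : (10 ^+ 4) ^+ 3 <= S by rewrite lerXn2r// nnegrE ltW// exprn_gt0.
  by clear; lra.
have Stau : 2 <= S * tau.
  have T2 : 1 <= T ^+ 2 by rewrite exprn_ege1//; clear -T4; lra.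
  have : T * tau <= S * tau.
    apply: ler_wpM2r; first exact: ltW.
    by rewrite /S exprSr -[leLHS]mul1r; apply: ler_wpM2r => //; exact: ltW.
  by clear -Tt; lra.
pose y := (T * tau)^-1.
have Tt0 : 0 < T * tau by rewrite mulr_gt0.
have y0 : 0 < y by rewrite invr_gt0.
have y1 : y <= (10 ^+ 4)^-1 by rewrite /y lef_pV2 ?posrE// exprn_gt0.
have SE : S^-1 = (y * tau) ^+ 3.
  by rewrite /S /y; field; rewrite !gt_eqF.
pose lam i := S * L i / 64.
have lamL i : 64 * lam i = L i.+1.
  by rewrite /lam /L exprS; field.
have Llam i : 64 * L i <= lam i.
  rewrite /lam ler_pdivlMr// mulrAC ler_wpM2r//; exact: ltW.
pose X := ((P2 -> R) * (P2 -> R) * (P2 -> R) * (P2 -> R))%type.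
(* The budgets are staggered by the waiting time of each coefficient. The factors 1/2 and 1/4 keep
   room for what the steps in between add: m, e and the increments of A. *)
pose Inv i (p : X) := let: (v, c1, c2, c3) := p in
  [/\ sm v, (forall k j, cls (144 * sg i * L i / tau) (L i) (pd k (pd j v))),
      [/\ cls (sg i ^+ 2) (L i) c1, cls (2^-1 * sg i.+1 ^+ 2) (L i) c2 &
          cls (4^-1 * sg i.+2 ^+ 2) (L i) c3] &
      state r (iter i rotf fr0) (A i i) (A i i.+1) (A i i.+2) v c1 c2 c3].
pose Rel i (p q : X) := cls (576 * sg i / lam i) (lam i)
  (fun x => q.1.1.1 x - p.1.1.1 x).
have sgS i : sg i.+1 = sg i * tau by rewrite /sg exprSr mulrA.
have [s [s00E sP]] : exists s : nat -> X, s 0%N = (v00, c10, c20, c30) /\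
    forall i, Inv i (s i) /\ Rel i (s i) (s i.+1).
  apply: dependent_choice_nat.
    rewrite /Inv /sg /L !expr0 !mulr1 expr1; split => //.
  move=> i [[[v c1] c2] c3] [sv' hv' [k1 k2 k3] st'].
  have H0 := cls_ge0 r0 (hv' true true).
  have [W [c1' [c2' [c3' [hW st1 hc2' hc3' hc1']]]]] :=
    step r0 (good_iter i) (sg0 i) (L0 i) (Llam i) k1 k2 k3 sv' hv' st'.
  have [b1 b2] := iter_bounds (sg0 i) t0 t1 y0 y1 SE S0 (L0 i) (erefl (lam i))
    H0 (lexx _).
  move: hc2' hc3' hc1' b1 b2; rewrite lamL.
  set m := sg i * _ / lam i; set e := 10 ^+ 7 * _ * _ => hc2' hc3' hc1' b1 b2.
  have lam0 : 0 < lam i by rewrite /lam divr_gt0// mulr_gt0.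
  have LL : L i <= L i.+1 by rewrite -lamL; clear -Llam L0; have := Llam i; have := L0 i; lra.
  have L1 := ltW (L0 i); have L2 := ltW (L0 i.+1).
  have sW : sm W := sm_cls hW.
  pose B k x := A i.+1 k x - A i k x.
  have hB k : cls (8^-1 * sg i ^+ 2 * tau ^+ 6) (L i.+1) (B k) by exact: AB.
  (* The coefficients are listed in the order of the rotated frame; each absorbs the increment of
     its own component of A, and by periodicity i + 3 designates the component just treated. *)
  exists (fun x => v x + W x, fun x => c2' x + B i.+1 x, fun x => c3' x + B i.+2 x,
    fun x => c1' x + B i.+3 x); last first.
    by apply: cls_eq hW => x _ /=; ring.
  have st6 : 0 <= sg i ^+ 2 * tau ^+ 6 by rewrite mulr_ge0// exprn_ge0// ltW.
  have s3 : sg i.+3 ^+ 2 = sg i ^+ 2 * tau ^+ 6 by rewrite !sgS; ring.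
  have s2 : sg i.+2 ^+ 2 = sg i ^+ 2 * tau ^+ 4 by rewrite !sgS; ring.
  have t62 : tau ^+ 6 <= tau ^+ 2.
    by rewrite ler_wiXn2l// ltW.
  have t64 : tau ^+ 6 <= tau ^+ 4.
    by rewrite ler_wiXn2l// ltW.
  have q2 : sg i ^+ 2 * tau ^+ 6 <= sg i.+1 ^+ 2.
    have -> : sg i.+1 ^+ 2 = sg i ^+ 2 * tau ^+ 2 by rewrite sgS; ring.
    by apply: ler_wpM2l => //; exact: sqr_ge0.
  have q4 : sg i ^+ 2 * tau ^+ 6 <= sg i.+2 ^+ 2.
    by rewrite s2; apply: ler_wpM2l => //; exact: sqr_ge0.
  rewrite -sgS in b1.
  split.
  - exact: smD.
  - move=> k j.
    have hW2 := cls_pd k (cls_pd j hW).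
    have K := clsD (cls_wk r0 (hv' k j) (lexx _) L1 LL)
       (cls_wk r0 hW2 (lexx _) _ _).
    apply: (cls_eq _ (cls_wk r0 (K _ _) _ L2 (lexx _))).
    + move=> x Ux; have pv := sm_partials sv'; have pW := sm_partials sW.
      rewrite (@pd_eq _ r (pd j (fun x => v x + W x)) (fun x => pd j v x + pd j W x))//.
        by case: (partialsD (sm_partials (sm_pd j sv') Ux) (sm_partials (sm_pd j sW) Ux)).
      by move=> z Uz; case: (partialsD (pv _ Uz) (pW _ Uz)).
    + by have l8 := ltW lam0; apply: mulr_ge0 => //; apply: mulr_ge0.
    + by apply: eqle; rewrite -lamL; ring.
    (* The new corrugation uses half of the Hessian budget. The old Hessian fits in the other half
       because S tau >= 2. *)
    + have -> : 576 * sg i / lam i * lam i * (8 * lam i) = 72 * sg i * L i.+1.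
        by rewrite -lamL; field; rewrite gt_eqF.
      have -> : 144 * sg i.+1 * L i.+1 / tau = 144 * sg i * L i.+1.
        by rewrite sgS; field; rewrite gt_eqF.
      have : 144 * sg i * L i / tau <= 72 * sg i * L i.+1.
        rewrite ler_pdivrMr// [L i.+1](_ : _ = L i * S); last by rewrite /L exprSr mulrA.
        rewrite [leRHS](_ : _ = 72 * sg i * L i * (S * tau)); last by ring.
        apply: (@le_trans _ _ (72 * sg i * L i * 2)); first by apply: eqle; ring.
        apply: ler_wpM2l => //; apply: mulr_ge0 => //.
        by apply: mulr_ge0 => //; exact: ltW (sg0 i).
      by clear; lra.
  - split.
    + apply: (cls_wk r0 (clsD hc2' (hB _))) => //; clear -b1 b2 q2 st6; lra.
    + apply: (cls_wk r0 (clsD hc3' (hB _))) => //; clear -b2 q4 st6; lra.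
    + apply: (cls_wk r0 (clsD hc1' (hB _))) => //; rewrite s3; clear -b2 st6; lra.
  - by rewrite iterS; apply: state_shift st1 => x _; rewrite /B !Ap; split; ring.
exists (fun i => (s i).1.1.1), (fun i => (s i).1.1.2), (fun i => (s i).1.2), (fun i => (s i).2).
split; first by rewrite s00E.
move=> i s1 L1 lam1; have [I1 R1] := sP i; move: I1 R1; rewrite /Rel.
case: (s i) => [[[v c1] c2] c3] [a1 a2 [a3 a4 a5] a6] /= R1.
have p1 : 0 <= sg i ^+ 2 by rewrite exprn_ge0// ltW.
have tt : tau ^+ 2 <= 1 by rewrite exprn_ile1// ltW.
have t4 : tau ^+ 4 <= 1 by rewrite exprn_ile1// ltW.
have p2 : sg i.+1 ^+ 2 <= sg i ^+ 2.
  have -> : sg i.+1 ^+ 2 = sg i ^+ 2 * tau ^+ 2 by rewrite sgS; ring.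
  by rewrite -[leRHS]mulr1; apply: ler_wpM2l.
have p3 : sg i.+2 ^+ 2 <= sg i.+1 ^+ 2.
  have -> : sg i.+2 ^+ 2 = sg i.+1 ^+ 2 * tau ^+ 2 by rewrite (sgS i.+1); ring.
  by rewrite -[leRHS]mulr1; apply: ler_wpM2l => //; exact: sqr_ge0.
have L1' := ltW (L0 i).
split => //; split => //.
- apply: (cls_wk r0 a4) => //; change (2^-1 * sg i.+1 ^+ 2 <= sg i ^+ 2).
  by have := sqr_ge0 (sg i.+1); move: p2; clear; lra.
- apply: (cls_wk r0 a5) => //; change (4^-1 * sg i.+2 ^+ 2 <= sg i ^+ 2).
  by have := sqr_ge0 (sg i.+2); move: p2 p3; clear; lra.
Qed.

End Iteration.

(** * Limits and Hoelder bounds *)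

Section RealLemmas.
Context {R : realType}.

Lemma is_derive_epsP (f : R -> R) (x d : R) : is_derive x 1 f d <->
  (forall e, 0 < e -> exists2 eta, 0 < eta &
    forall h, `|h| < eta -> `|f (x + h) - f x - d * h| <= e * `|h|).
Proof.
pose q h := h^-1 *: ((f \o shift x) (h *: 1) - f x).
have qE h : h != 0 -> `|d - q h| * `|h| = `|f (x + h) - f x - d * h|.
  move=> h0; rewrite -normrM distrC; congr (`|_|).
  by rewrite /q /= /GRing.scale /= mulr1 [h + x]addrC; field.
split.
  move=> hd e e0.
  have H : q @ 0^' --> d.
    have [h1 h2] := hd; rewrite -h2; exact: h1.
  move/cvgrPdist_le : H => /(_ e e0) /=.
  rewrite /dnbhs /within /= => /nbhs_ballP[eta /= eta0 H]; exists eta => // h hh.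
  have [->|h0] := eqVneq h 0.
    by rewrite addr0 subrr mulr0 subr0 normr0 mulr0.
  rewrite -qE// ler_wpM2r//; apply: H => //.
  by rewrite /ball /= sub0r normrN.
move=> H.
have cq : q @ 0^' --> d.
  apply/cvgrPdist_le => e e0; have [eta eta0 K] := H e e0.
  rewrite /dnbhs /within /=; apply/nbhs_ballP; exists eta => //= h.
  rewrite /ball /= sub0r normrN => he h0.
  have h0' : 0 < `|h| by rewrite normr_gt0.
  by rewrite -(ler_pM2r h0') qE// K.
apply: DeriveDef; first by apply/cvg_ex; exists d.
exact: cvg_lim cq.
Qed.

Lemma half_small (A : R) : forall e, 0 < e -> exists n, A / 2 ^+ n < e.
Proof.
move=> e e0; pose n := Num.bound `|A / e|; exists n.
have p0 : 0 < 2 ^+ n :> R by rewrite exprn_gt0.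
rewrite ltr_pdivrMr// mulrC -ltr_pdivrMr//.
have h : A / e < n%:R by exact: le_lt_trans (ler_norm _) (archi_boundP (normr_ge0 _)).
by apply: lt_le_trans h _; rewrite -natrX ler_nat ltnW// ltn_expl.
Qed.

Lemma half_uniq (u : nat -> R) (l l' A B : R) :
  (forall i, `|u i - l| <= A / 2 ^+ i) -> (forall i, `|u i - l'| <= B / 2 ^+ i) ->
  l = l'.
Proof.
move=> h1 h2; apply/eqP; rewrite -subr_eq0 -normr_le0; apply/ler_addgt0Pl => e e0.
have [n hn] := half_small (A + B) e0; rewrite addr0.
rewrite (_ : l - l' = (u n - l') - (u n - l)); last by ring.
apply: (le_trans (ler_normB _ _)); apply: le_trans (ltW hn).
by rewrite mulrDl addrC lerD.
Qed.

(* The limit of a sequence whose i-th increment is at most C / 2 ^+ i. *)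
Definition glim (C : R) (u : nat -> R) : R := sup (range (fun i => u i - 2 * C / 2 ^+ i)).

(** The sequence u_i - 2C/2^i increases and u_i + 2C/2^i decreases, and every term of the first lies
    below every term of the second; the supremum of the first therefore separates them. *)
Lemma glimP (C : R) (u : nat -> R) :
  (forall i, `|u i.+1 - u i| <= C / 2 ^+ i) ->
  forall i, `|u i - glim C u| <= 2 * C / 2 ^+ i.
Proof.
move=> h.
have hS i : 2 * C / 2 ^+ i.+1 = C / 2 ^+ i :> R by rewrite exprS; field; rewrite expf_neq0.
have lo i : u i - 2 * C / 2 ^+ i <= u i.+1 - 2 * C / 2 ^+ i.+1.
  have := h i; rewrite ler_norml => /andP[h1 _]; rewrite hS.
  have -> : 2 * C / 2 ^+ i = C / 2 ^+ i + C / 2 ^+ i by ring.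
  lra.
have up i : u i.+1 + 2 * C / 2 ^+ i.+1 <= u i + 2 * C / 2 ^+ i.
  have := h i; rewrite ler_norml => /andP[_ h1]; rewrite hS.
  have -> : 2 * C / 2 ^+ i = C / 2 ^+ i + C / 2 ^+ i by ring.
  lra.
have C0 : 0 <= C by have := le_trans (normr_ge0 _) (h 0%N); rewrite expr0 divr1.
have lo' i k : u i - 2 * C / 2 ^+ i <= u (i + k)%N - 2 * C / 2 ^+ (i + k).
  by elim: k => [|k IH]; rewrite ?addn0// addnS; exact: le_trans IH (lo _).
have up' i k : u (i + k)%N + 2 * C / 2 ^+ (i + k) <= u i + 2 * C / 2 ^+ i.
  by elim: k => [|k IH]; rewrite ?addn0// addnS; exact: le_trans (up _) IH.
have LU i j : u i - 2 * C / 2 ^+ i <= u j + 2 * C / 2 ^+ j.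
  apply: le_trans (lo' i j) _; apply: le_trans _ (up' j i).
  have : 0 <= 2 * C / 2 ^+ (i + j) by rewrite !mulr_ge0// invr_ge0 exprn_ge0.
  rewrite [(j + i)%N]addnC; lra.
move=> i; rewrite ler_norml; apply/andP; split.
  rewrite lerBrDr -lerBrDl opprK addrC.
  apply: ge_sup; first by exists (u 0%N - 2 * C / 2 ^+ 0), 0%N.
  by move=> _ [j _ <-]; rewrite addrC.
rewrite lerBlDr -lerBlDl; apply: ub_le_sup; last by exists i.
by exists (u 0%N + 2 * C / 2 ^+ 0) => _ [j _ <-].
Qed.

Lemma lipschitz1 (g dg : R -> R) (M a b : R) :
  (forall t, Num.min a b <= t <= Num.max a b -> is_derive t 1 g (dg t)) ->
  (forall t, Num.min a b <= t <= Num.max a b -> `|dg t| <= M) ->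
  `|g b - g a| <= M * `|b - a|.
Proof.
wlog ab : a b / a <= b.
  move=> H h1 h2; have [ab|ba] := leP a b; first exact: H.
  rewrite distrC [X in _ * X]distrC.
  by apply: H; rewrite 1?minC 1?maxC// ?ltW.
rewrite min_l// max_r// => h1 h2.
have [c cab ->] : exists2 c, c \in `[a, b]%R & g b - g a = dg c * (b - a).
  apply: MVT_segment => //.
    move=> t; rewrite in_itv /= => /andP[t1 t2]; apply: h1.
    by rewrite !ltW.
  apply: derivable_within_continuous => t; rewrite in_itv /= => /h1 [h _]; exact: h.
by rewrite normrM ler_wpM2r// h2// -in_itv.
Qed.

(** The inequality min (d, 1) <= d^th. *)
Lemma hoelder_min (th M d D : R) : 0 < th -> th < 1 -> 0 <= M -> 0 <= d ->
  D <= M * d -> D <= M -> D <= M * d `^ th.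
Proof.
move=> th0 th1 M0 d0 h1 h2; have [d1|d1] := leP d 1.
  have [dE|dn] := eqVneq d 0.
    by move: h1; rewrite dE powR0 ?gt_eqF// !mulr0.
  apply: le_trans h1 _; rewrite ler_wpM2l// ger1_powR//; last exact: ltW.
  by rewrite d1 lt_neqAle eq_sym dn d0.
apply: le_trans h2 _; rewrite -[leLHS]mulr1 ler_wpM2l//.
apply: (@le_trans _ _ (1 `^ th)); first by rewrite powR1.
by apply: ge0_ler_powR; rewrite ?nnegrE ?(ltW d1) ?(ltW th0).
Qed.

End RealLemmas.

Section Limit.
Context {R : realType}.
Variable r : R.
Hypothesis r0 : 0 < r.
Local Notation U := (square r).
Local Notation P2 := (R * R)%type.
Local Notation sm := (sm r).
Local Notation cls := (cls r).
Implicit Types (f : P2 -> R) (x y : P2).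

Lemma square_convex1 (a b t : R) : `|a| < r -> `|b| < r ->
  Num.min a b <= t <= Num.max a b -> `|t| < r.
Proof.
rewrite !ltr_norml => /andP[a1 a2] /andP[b1 b2] /andP[].
rewrite ge_min le_max => /orP[] h1 /orP[] h2; apply/andP; split; lra.
Qed.

Lemma lipschitz_square f (M : R) : (forall x, U x -> has_partials f x) ->
  (forall i x, U x -> `|pd i f x| <= M) ->
  forall x y, U x -> U y -> `|f x - f y| <= M * (`|x.1 - y.1| + `|x.2 - y.2|).
Proof.
move=> hp hM x y [x1 x2] [y1 y2].
have h1 : `|f x - f (y.1, x.2)| <= M * `|x.1 - y.1|.
  have := @lipschitz1 _ (fun t => f (t, x.2)) (fun t => pd false f (t, x.2)) M y.1 x.1.
  rewrite -surjective_pairing; apply => t ht.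
    have Ut : U (t, x.2) by split => //=; exact: square_convex1 ht.
    exact: (partials_is_derive false (hp _ Ut)).
  by apply: hM; split => //=; exact: square_convex1 ht.
have h2 : `|f (y.1, x.2) - f y| <= M * `|x.2 - y.2|.
  have := @lipschitz1 _ (fun t => f (y.1, t)) (fun t => pd true f (y.1, t)) M y.2 x.2.
  rewrite -surjective_pairing; apply => t ht.
    have Ut : U (y.1, t) by split => //=; exact: square_convex1 ht.
    exact: (partials_is_derive true (hp _ Ut)).
  by apply: hM; split => //=; exact: square_convex1 ht.
rewrite -(subrKA (f (y.1, x.2))) mulrDr; apply: le_trans (ler_normD _ _) _.
by rewrite lerD.
Qed.

Lemma dist2_ge x y : `|x.1 - y.1| + `|x.2 - y.2| <= 2 * dist2 x y.
Proof.
have H (a b : R) : `|a| <= Num.sqrt (a ^+ 2 + b ^+ 2).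
  by rewrite -sqrtr_sqr ler_sqrt ?addr_ge0 ?sqr_ge0// lerDl sqr_ge0.
have h1 : `|x.1 - y.1| <= dist2 x y by exact: H.
have h2 : `|x.2 - y.2| <= dist2 x y.
  by rewrite /dist2 [X in Num.sqrt X]addrC; exact: H.
by rewrite mulrDl !mul1r lerD.
Qed.

(** Interpolation between the sup bound and the Lipschitz bound: amplitude [G0] at frequency [G1]
    costs G0 G1^th. It is [hoelder_min] at the rescaled distance G1 dist2. *)
Lemma hoelder_square f (G0 G1 th : R) x y : 0 < th -> th < 1 ->
  0 <= G0 -> 0 <= G1 ->
  (forall z, U z -> `|f z| <= G0) ->
  (forall z, U z -> has_partials f z) ->
  (forall i z, U z -> `|pd i f z| <= G0 * G1) -> U x -> U y ->
  `|f x - f y| <= (2 * G0) * ((G1 `^ th) * (dist2 x y `^ th)).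
Proof.
move=> th0 th1 g0 g1 h0 hp h1 Ux Uy.
have d0 : 0 <= dist2 x y by exact: sqrtr_ge0.
rewrite -powRM//; apply: hoelder_min => //; rewrite ?mulr_ge0//.
  apply: le_trans (lipschitz_square hp h1 Ux Uy) _.
  rewrite [leRHS](_ : _ = G0 * G1 * (2 * dist2 x y)); last by ring.
  by rewrite ler_wpM2l ?dist2_ge// mulr_ge0.
by rewrite mulrDl !mul1r (le_trans (ler_normB _ _))// lerD ?h0.
Qed.

End Limit.

Section HoelderLimit.
Context {R : realType}.
Variable r : R.
Hypothesis r0 : 0 < r.
Local Notation U := (square r).
Local Notation P2 := (R * R)%type.
Local Notation sm := (sm r).
Local Notation cls := (cls r).

Lemma partialsB (f g : P2 -> R) x : has_partials f x -> has_partials g x ->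
  has_partials (fun y => f y - g y) x /\
  forall i, pd i (fun y => f y - g y) x = pd i f x - pd i g x.
Proof.
move=> hf hg; have [c1 c2] := partials_cst (-1 : R) x.
have [m1 m2] := partialsM c1 hg; have [d1 d2] := partialsD hf m1.
have E : (fun y => f y - g y) = (fun y => f y + -1 * g y).
  by apply/funext => t; rewrite mulN1r.
by rewrite E; split => // i; rewrite d2 m2 c2; ring.
Qed.

(** Telescoping the mean value estimate shows that v_n - V is Lipschitz with constant O(2^-n)
    ([LipV]). Difference quotients of V and of v_n are then uniformly close, which gives the
    derivatives of V. *)
Lemma uniform_limit_partials (v : nat -> P2 -> R) (A0 A1 : R) :
  (forall i x, U x -> has_partials (v i) x) ->
  (forall i x, U x -> `|v i.+1 x - v i x| <= A0 / 2 ^+ i) ->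
  (forall k i x, U x -> `|pd k (v i.+1) x - pd k (v i) x| <= A1 / 2 ^+ i) ->
  exists V : P2 -> R,
  [/\ forall i x, U x -> `|v i x - V x| <= 2 * A0 / 2 ^+ i,
      forall x, U x -> has_partials V x &
      forall k i x, U x -> `|pd k (v i) x - pd k V x| <= 2 * A1 / 2 ^+ i].
Proof.
move=> hp h0 h1; pose V x := glim A0 (v ^~ x).
pose g k x := glim A1 (fun i => pd k (v i) x).
have hV i x : U x -> `|v i x - V x| <= 2 * A0 / 2 ^+ i.
  by move=> Ux; apply: (glimP (u := v ^~ x)) => j; exact: h0.
have hg k i x : U x -> `|pd k (v i) x - g k x| <= 2 * A1 / 2 ^+ i.
  by move=> Ux; apply: (glimP (u := fun i => pd k (v i) x)) => j; exact: h1.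
have A10 : 0 <= A1.
  have U0 : U (0, 0) by split; rewrite /= normr0.
  by have := le_trans (normr_ge0 _) (h1 true 0%N _ U0); rewrite expr0 divr1.
have Lip i x y : U x -> U y -> `|(v i.+1 x - v i x) - (v i.+1 y - v i y)| <=
    A1 / 2 ^+ i * (`|x.1 - y.1| + `|x.2 - y.2|).
  move=> Ux Uy.
  have K z : U z -> has_partials (fun z => v i.+1 z - v i z) z /\
      forall k, pd k (fun z => v i.+1 z - v i z) z = pd k (v i.+1) z - pd k (v i) z.
    by move=> Uz; exact: (partialsB (hp i.+1 _ Uz) (hp i _ Uz)).
  apply: (lipschitz_square (f := fun z => v i.+1 z - v i z) _ _ Ux Uy).
    by move=> z /K[].
  by move=> k z Uz; rewrite (K _ Uz).2; exact: h1.
have LipV n x y : U x -> U y -> `|(v n x - V x) - (v n y - V y)| <=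
    2 * A1 / 2 ^+ n * (`|x.1 - y.1| + `|x.2 - y.2|).
  move=> Ux Uy; set D := `|_| + _.
  have D0 : 0 <= D by rewrite addr_ge0.
  pose u i := v i x - v i y.
  have hu i : `|u i.+1 - u i| <= A1 * D / 2 ^+ i.
    have := Lip i x y Ux Uy; rewrite -/D mulrAC.
    by rewrite (_ : _ - _ - _ = u i.+1 - u i) // /u; ring.
  have hl := glimP hu.
  have E : glim (A1 * D) u = V x - V y.
    apply: (half_uniq (u := u) (A := 2 * (A1 * D)) (B := 2 * A0 + 2 * A0)) => //.
    move=> i; rewrite (_ : _ - _ = (v i x - V x) - (v i y - V y)); last by rewrite /u; ring.
    by rewrite mulrDl (le_trans (ler_normB _ _))// lerD ?hV.
  have := hl n; rewrite E (_ : u n - _ = v n x - V x - (v n y - V y)); last by rewrite /u; ring.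
  by rewrite (_ : 2 * A1 / 2 ^+ n * D = 2 * (A1 * D) / 2 ^+ n)//; ring.
have dV x k : U x -> is_derive (coord_of k x) 1 (slice k V x) (g k x).
  move=> Ux; apply/is_derive_epsP => e e0.
  have e4 : 0 < e / 4 by rewrite divr_gt0.
  have [n hn] := half_small (2 * A1) e4.
  have /is_derive_epsP/(_ _ e4)[eta eta0 He] := partials_is_derive k (hp n x Ux).
  have /nbhs_ballP[eta' /= eta'0 HU] := square_near k Ux.
  exists (Num.min eta eta'); first by rewrite lt_min eta0 eta'0.
  move=> h; rewrite lt_min => /andP[h1' h2'].
  pose xh := if k then (x.1, coord_of k x + h) else (coord_of k x + h, x.2).
  have Uxh : U xh.
    by have := HU (coord_of k x + h); rewrite /xh; apply; rewrite /ball /= opprD addNKr normrN.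
  have sE f : slice k f x (coord_of k x + h) = f xh by rewrite /xh; case: (k).
  rewrite sE slice_coord.
  have L1 := LipV n xh x Uxh Ux.
  have dxh : `|xh.1 - x.1| + `|xh.2 - x.2| = `|h|.
    rewrite /xh /coord_of; case: (k) => /=; first by rewrite subrr normr0 add0r addrAC subrr add0r.
    by rewrite subrr normr0 addr0 addrAC subrr add0r.
  rewrite dxh in L1.
  have L2 := He h h1'; rewrite sE slice_coord in L2.
  have L3 := hg k n x Ux.
  (* Three errors of at most e/4 each: differentiability of v_n, [LipV], and the distance between pd
     v_n and its limit. *)
  rewrite (_ : _ - _ - _ = (v n xh - v n x - pd k (v n) x * h) - (v n xh - V xh - (v n x - V x))
     + (pd k (v n) x - g k x) * h); last by ring.
  apply: (le_trans (ler_normD _ _)); rewrite normrM.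
  apply: (@le_trans _ _ (e / 4 * `|h| + e / 4 * `|h| + e / 4 * `|h|)).
    apply: lerD.
      apply: (le_trans (ler_normB _ _)); apply: lerD => //.
      by apply: le_trans L1 _; rewrite ler_wpM2r// ltW.
    by rewrite ler_wpM2r// (le_trans L3)// ltW.
  rewrite -!mulrDl ler_wpM2r//; lra.
have PV x : U x -> has_partials V x /\ forall k, pd k V x = g k x.
  by move=> Ux; apply: is_derive_partials => k; exact: dV.
exists V; split => //; first by move=> x /PV[].
by move=> k i x Ux; rewrite (PV _ Ux).2; exact: hg.
Qed.

(** The i-th gradient increment has size tau^i and frequency S^i, so by [hoelder_square] its Hoelder
    seminorm is of order (tau S^th)^i, which is summable. The seminorm of the limit is that of the
    start plus the sum of this series. *)
Lemma limit_hoelder (v : nat -> P2 -> R) (kk s0 tau lam0 S th : R) :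
  0 <= kk -> 0 < s0 -> 0 < lam0 -> 1 <= S -> 0 < tau -> tau <= 2^-1 ->
  tau * S `^ th <= 2^-1 -> 0 < th -> th < 1 -> (forall i, sm (v i)) ->
  (forall i, cls (kk * (s0 * tau ^+ i) / (lam0 * S ^+ i)) (lam0 * S ^+ i)
     (fun x => v i.+1 x - v i x)) ->
  exists V : P2 -> R,
  [/\ forall i x, U x -> `|v i x - V x| <= 2 * (kk * s0 / lam0) / 2 ^+ i,
      forall x, U x -> has_partials V x,
      forall k i x, U x -> `|pd k (v i) x - pd k V x| <= 2 * (kk * s0) / 2 ^+ i &
      exists C : R, forall x y, U x -> U y ->
        [/\ `|V x| <= C, (forall k, `|pd k V x| <= C),
          `|V x - V y| <= C * dist2 x y `^ th &
          forall k, `|pd k V x - pd k V y| <= C * dist2 x y `^ th]].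
Proof.
move=> kk0 s00 l0 S1 t0 t2 tS th0 th1 sv hW.
have S0 : 0 < S by apply: lt_le_trans S1.
have ti i : tau ^+ i <= 1 / 2 ^+ i.
  by rewrite div1r -exprVn lerXn2r// ?nnegrE ?invr_ge0// (ltW t0).
have Si i : 1 <= S ^+ i by rewrite exprn_ege1.
have Si0 i : 0 < S ^+ i by rewrite exprn_gt0.
have ti0 i : 0 < tau ^+ i by rewrite exprn_gt0.
have li0 i : 0 < lam0 * S ^+ i by rewrite mulr_gt0.
have a1 : 0 <= kk * s0 by apply: mulr_ge0 => //; exact: ltW.
have a0 : 0 <= kk * s0 / lam0 by apply: divr_ge0 => //; exact: ltW.
have ti0' i : 0 <= tau ^+ i by exact: ltW.
have tth : 0 <= S `^ th by exact: powR_ge0.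
have tau0 : 0 <= tau by exact: ltW.
have li0' i : 0 <= lam0 * S ^+ i by exact: ltW.
pose W i x := v i.+1 x - v i x.
have hp : forall (i : nat) (x : P2), U x -> has_partials (v i) x.
  move=> i x Ux; have Q := sm_partials (sv i); exact: (Q x Ux).
have pW k i x : U x -> pd k (W i) x = pd k (v i.+1) x - pd k (v i) x.
  by move=> Ux; exact: (partialsB (hp i.+1 _ Ux) (hp i _ Ux)).2.
have E0 i x : U x -> `|v i.+1 x - v i x| <= kk * s0 / lam0 / 2 ^+ i.
  move=> Ux; apply: le_trans (cls_norm (hW i) Ux) _.
  have -> : kk * (s0 * tau ^+ i) / (lam0 * S ^+ i) =
    kk * s0 / lam0 * (tau ^+ i * (S ^+ i)^-1) by field; rewrite !gt_eqF.
  apply: ler_wpM2l => //.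
  apply: (@le_trans _ _ (tau ^+ i * 1)); last by rewrite mulr1 -[leRHS]div1r.
  by apply: ler_wpM2l => //; rewrite invf_le1.
have E1 k i x : U x -> `|pd k (v i.+1) x - pd k (v i) x| <= kk * s0 * tau ^+ i.
  move=> Ux; rewrite -pW//; apply: le_trans (cls_norm (cls_pd k (hW i)) Ux) _.
  by apply: eqle; field; rewrite !gt_eqF.
have E1' k i x : U x -> `|pd k (v i.+1) x - pd k (v i) x| <= kk * s0 / 2 ^+ i.
  move=> Ux; apply: le_trans (E1 k i x Ux) _; apply: ler_wpM2l => //.
  by rewrite -[leRHS]div1r.
have [V [V0 V1 V2]] := uniform_limit_partials hp E0 E1'.
exists V; split => //.
have [G hG] := sv 0%N.
have U0 : U (0, 0) by split; rewrite /= normr0.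
have [g0 [g1 g2]] : 0 <= G 0%N /\ 0 <= G 1%N /\ 0 <= G 2%N.
  by split; [|split]; apply: (bnd_ge0 U0 (hG 2%N)).
(* The factor 8 in the frequency is the price of the derivative already taken. *)
pose K := 2 * (kk * s0) * (8 * lam0) `^ th.
have K0 : 0 <= K by apply: mulr_ge0; [exact: mulr_ge0|exact: powR_ge0].
have bV x : U x -> `|V x| <= G 0%N + 2 * (kk * s0 / lam0).
  move=> Ux; have := V0 0%N x Ux; rewrite expr0 divr1 => h.
  rewrite -[V x](subKr (v 0%N x)) (le_trans (ler_normB _ _))// lerD//.
  exact: (bnd_norm (hG 0%N) Ux).
have bpV k x : U x -> `|pd k V x| <= G 1%N + 2 * (kk * s0).
  move=> Ux; have := V2 k 0%N x Ux; rewrite expr0 divr1 => h.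
  rewrite -[pd k V x](subKr (pd k (v 0%N) x)) (le_trans (ler_normB _ _))// lerD//.
  by have [_ [_ /(_ k) [hk _]]] := hG 1%N; exact: hk.
pose C0 := G 0%N + 2 * (kk * s0 / lam0) + (G 1%N + 2 * (kk * s0)).
exists (2 * C0 + 2 * (G 1%N + G 2%N) + 2 * K) => x y Ux Uy.
have C00 : 0 <= C0 by rewrite /C0; clear -g0 g1 a0 a1; lra.
have dth : 0 <= dist2 x y `^ th by rewrite powR_ge0.
split.
- apply: le_trans (bV _ Ux) _; rewrite /C0; lra.
- move=> k; apply: le_trans (bpV k _ Ux) _; rewrite /C0; lra.
- apply: (@le_trans _ _ (2 * C0 * (1 `^ th * (dist2 x y `^ th)))).
    apply: (hoelder_square (r := r)) => //.
      by move=> z Uz; apply: le_trans (bV _ Uz) _; rewrite /C0; lra.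
    by move=> i z Uz; rewrite mulr1; apply: le_trans (bpV i _ Uz) _; rewrite /C0; lra.
  rewrite powR1 mul1r ler_wpM2r//; lra.
- move=> k; pose u i := pd k (v i) x - pd k (v i) y; set d := dist2 x y `^ th.
  have hu i : `|u i.+1 - u i| <= K * d / 2 ^+ i.
    rewrite (_ : u i.+1 - u i = pd k (W i) x - pd k (W i) y); last by rewrite !pW// /u; ring.
    have c1 := cls_pd k (hW i).
    have c2 j := cls_pd j c1.
    have := @hoelder_square _ r (pd k (W i)) (kk * s0 * tau ^+ i) (8 * (lam0 * S ^+ i)) th x y th0 th1.
    have q1 : 0 <= kk * s0 * tau ^+ i by exact: mulr_ge0.
    have q2 : 0 <= 8 * (lam0 * S ^+ i) by exact: mulr_ge0.
    move=> /(_ q1 q2) H.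
    apply: le_trans (H _ _ _ Ux Uy) _.
    + by move=> z Uz; rewrite pW//; exact: E1.
    + by move=> z Uz; exact: cls_partials c1 _ Uz.
    + move=> j z Uz; apply: le_trans (cls_norm (c2 j) Uz) _.
      by apply: eqle; field; rewrite !gt_eqF.
    have l08 : 0 <= 8 * lam0 by apply: mulr_ge0 => //; exact: ltW.
    rewrite [8 * _]mulrA (powRM th l08 (ltW (Si0 i))).
    rewrite -/d.
    have -> : (S ^+ i) `^ th = (S `^ th) ^+ i.
      by rewrite -powR_mulrn ?(ltW S0)// -powRrM mulrC powRrM powR_mulrn.
    have -> : 2 * (kk * s0 * tau ^+ i) * ((8 * lam0) `^ th * (S `^ th) ^+ i * d) =
       K * d * (tau * S `^ th) ^+ i by rewrite exprMn /K; ring.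
    apply: ler_wpM2l; first exact: mulr_ge0.
    by rewrite -exprVn lerXn2r// nnegrE ?invr_ge0// mulr_ge0.
  have E : glim (K * d) u = pd k V x - pd k V y.
    apply: (half_uniq (u := u) (A := 2 * (K * d)) (B := 2 * (kk * s0) + 2 * (kk * s0))).
      exact: glimP.
    move=> i; rewrite (_ : _ - _ = (pd k (v i) x - pd k V x) - (pd k (v i) y - pd k V y)); last by rewrite /u; ring.
    by rewrite mulrDl (le_trans (ler_normB _ _))// lerD ?V2.
  have := glimP hu 0%N; rewrite E expr0 divr1 => h.
  rewrite -[X in `|X|](subKr (u 0%N)) (le_trans (ler_normB _ _))//.
  have h0 : `|u 0%N| <= 2 * (G 1%N + G 2%N) * d.
    have := @hoelder_square _ r (pd k (v 0%N)) (G 1%N + G 2%N) 1 th x y th0 th1.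
    rewrite powR1 mul1r; apply => //; rewrite ?addr_ge0//.
    + move=> z Uz; have [_ [_ /(_ k) [hk _]]] := hG 1%N.
      by apply: le_trans (hk _ Uz) _; rewrite lerDl.
    + by move=> z Uz; apply: sm_partials Uz; exact: sm_pd.
    + move=> j z Uz; have [_ [_ /(_ k) [_ [_ /(_ j) [hk _]]]]] := hG 2%N.
      by rewrite mulr1; apply: le_trans (hk _ Uz) _; rewrite lerDr.
  rewrite !mulrDl; have := mulr_ge0 C00 dth; rewrite -/d.
  rewrite -!mulrA in h h0 *; lra.
Qed.

End HoelderLimit.

(** * Integration over the plane *)

Section Plane.
Variable R : realType.
Local Notation P2 := (R * R)%type.
Local Notation T2 := (measurableTypeR R * measurableTypeR R)%type.
Local Notation mu := (@lebesgue_measure R).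

Lemma leb2_sigma_finite : sigma_finite setT (@leb2 R).
Proof.
exists (fun n => `]-n%:R, n%:R[%classic `*` `]-n%:R, n%:R[%classic).
  apply/seteqP; split => // x _; pose n := Num.bound (`|x.1| + `|x.2|).
  have h : `|x.1| + `|x.2| < n%:R by apply: archi_boundP; rewrite addr_ge0.
  exists n => //; split => /=; rewrite in_itv /= -ltr_norml (le_lt_trans _ h)//.
    by rewrite lerDl.
  by rewrite lerDr.
move=> n; split; first by apply: measurableX; exact: measurable_itv.
rewrite /leb2 product_measure1E//.
set I := `]_, _[%classic; apply: (@le_lt_trans _ _ (mu I * mu I)%E) => //.
by rewrite !lebesgue_measure_itv /=; case: ifP => _; rewrite ?mule0// -EFinB -EFinM ltry.
Qed.

(** [leb2] is a constant of its own; the measure structure and the sigma-finiteness of the product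
    are attached to it for integration and Fubini. *)
HB.instance Definition _ := Measure.copy (@leb2 R) (mu \x mu)%E.
HB.instance Definition _ :=
  @Measure_isSigmaFinite.Build _ T2 R (@leb2 R) leb2_sigma_finite.

Lemma rat_near (x e : R) : 0 < e -> exists q : rat, `|x - ratr q| < e.
Proof.
move=> e0; have [|q] := @rat_in_itvoo _ (x - e) (x + e).
  by rewrite ltrD2l (lt_trans _ e0)// oppr_lt0.
rewrite in_itv /= => /andP[h1 h2]; exists q; rewrite ltr_norml; lra.
Qed.

(** Second countability: an open set is the union of the boxes with rational centre and side 2/(n+1)
    that it contains. This links the topology of the plane to the product sigma-algebra. *)
Lemma open_measurable2 (O : set P2) : open O -> measurable (O : set T2).
Proof.
move=> oO.
pose B (q : rat * rat * nat) : set T2 :=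
  [set t | `|t - ratr q.1.1| < (q.2.+1%:R)^-1] `*` [set t | `|t - ratr q.1.2| < (q.2.+1%:R)^-1].
pose F (q : rat * rat * nat) : set T2 := if pselect (B q `<=` O) then B q else set0.
have mI (c e : R) : measurable ([set t | `|t - c| < e] : set (measurableTypeR R)).
  rewrite (_ : [set t | _] = `](c - e), (c + e)[%classic); first exact: measurable_itv.
  apply/seteqP; split => t /=; rewrite in_itv /= ltr_norml => /andP[h1 h2]; apply/andP; split; lra.
rewrite (_ : (O : set T2) = \bigcup_q F q).
  apply: countable_bigcupT_measurable => //.
  move=> q; rewrite /F; case: pselect => hh; last exact: measurable0.
  by apply: measurableX; exact: mI.
apply/seteqP; split => [x Ox|x [q _]]; last first.
  by rewrite /F; case: pselect => // h; exact: h.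
have /nbhs_ballP[e /= e0 He] : nbhs x O by exact: open_nbhs_nbhs.
pose n := Num.bound (2 / e).
have n0 : 0 < n.+1%:R :> R by rewrite ltr0n.
have n1 : 2 * (n.+1%:R)^-1 < e.
  rewrite ltr_pdivrMr// mulrC -ltr_pdivrMr//.
  have : 2 / e < n%:R by apply: archi_boundP; rewrite divr_ge0 ?ltW.
  by move=> h; apply: lt_trans h _; rewrite ltr_nat.
have i0 : 0 < (n.+1%:R)^-1 :> R by rewrite invr_gt0.
have [q1 hq1] := rat_near x.1 i0; have [q2 hq2] := rat_near x.2 i0.
have sub : B (q1, q2, n) `<=` O.
  move=> y [/= y1 y2]; apply: He; split; rewrite /ball /=.
    rewrite -(subrKA (ratr q1)) (le_lt_trans (ler_normD _ _))//.
    by rewrite [`|_ - y.1|]distrC (lt_trans _ n1)// mulrDl !mul1r ltrD.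
  rewrite -(subrKA (ratr q2)) (le_lt_trans (ler_normD _ _))//.
  by rewrite [`|_ - y.2|]distrC (lt_trans _ n1)// mulrDl !mul1r ltrD.
exists (q1, q2, n) => //; rewrite /F; by case: pselect.
Qed.

Lemma continuous_measurable2 (O : set P2) (g : P2 -> R) : open O ->
  (forall x, O x -> {for x, continuous g}) ->
  measurable_fun (O : set T2) (g : T2 -> measurableTypeR R).
Proof.
move=> oO cg; apply: (measurability _ (measurable_realfun.RGenOpens.measurableE R)).
move=> _ [_ [a [b ->] <-]]; apply: open_measurable2.
rewrite openE => x [Ox gx]; apply: filterI; first exact: open_nbhs_nbhs.
apply: (cg x Ox); apply: open_nbhs_nbhs; split => //.
Qed.

Lemma leb2_square (r : R) : (@leb2 R (square r : set T2) < +oo)%E.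
Proof.
have -> : (square r : set T2) = `]-r, r[%classic `*` `]-r, r[%classic.
  by apply/seteqP; split => x [] /=; rewrite !in_itv /= -!ltr_norml.
rewrite /leb2 product_measure1E//.
set I := `]_, _[%classic; apply: (@le_lt_trans _ _ (mu I * mu I)%E) => //.
by rewrite !lebesgue_measure_itv /=; case: ifP => _; rewrite ?mule0// -EFinB -EFinM ltry.
Qed.

Lemma square_open (r : R) : open (square r).
Proof.
rewrite openE => x [h1 h2].
have H (u : R) : `|u| < r -> \forall t \near u, `|t| < r.
  move=> ur; apply/nbhs_ballP; exists (r - `|u|); first by rewrite /= subr_gt0.
  move=> t; rewrite /ball /= ltrBrDr distrC; apply: le_lt_trans.
  by rewrite -{1}(subrK u t) ler_normD.
exists ([set t | `|t| < r], [set t | `|t| < r]); first by split; exact: H.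
by move=> y [].
Qed.

Lemma leb2_bounded (Om : set P2) (r : R) : open Om -> Om `<=` square r ->
  (@leb2 R (Om : set T2) < +oo)%E.
Proof.
move=> oO sub; apply: le_lt_trans (leb2_square r).
apply: le_measure => //; rewrite inE; first exact: open_measurable2.
exact: open_measurable2 (@square_open r).
Qed.

Lemma integrable_bounded2 (Om : set P2) (r : R) (g : P2 -> R) (M : R) :
  open Om -> Om `<=` square r ->
  (forall x, Om x -> {for x, continuous g}) -> (forall x, Om x -> `|g x| <= M) ->
  (@leb2 R).-integrable (Om : set T2) (EFin \o (g : T2 -> R)).
Proof.
move=> oO sub cg gM; apply: measurable_bounded_integrable.
- exact: open_measurable2.
- exact: leb2_bounded sub.
- exact: continuous_measurable2.
- by exists M; split; rewrite ?num_real// => M' MM' x Ox; exact: le_trans (gM _ Ox) (ltW MM').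
Qed.

End Plane.

(** * Symmetry of second derivatives, and derivatives with zero integral *)

Section Calculus.
Variable R : realType.
Local Notation P2 := (R * R)%type.
Local Notation T2 := (measurableTypeR R * measurableTypeR R)%type.
Local Notation mu := (@lebesgue_measure R).

Lemma mvt1 (g dg : R -> R) (a h : R) : 0 < h -> (forall t : R, is_derive t 1 g (dg t)) ->
  exists t, [/\ a <= t, t <= a + h & g (a + h) - g a = dg t * h].
Proof.
move=> h0 hg; have ah : a <= a + h by rewrite lerDl ltW.
have [|c] := @MVT_segment R g dg a (a + h) ah (fun x _ => hg x).
  apply: derivable_within_continuous => t ht.
  exact: (@ex_derive _ _ _ _ _ _ _ (hg t)).
rewrite in_itv /= => /andP[c1 c2] ->; exists c; split => //.
by congr (_ * _); ring.
Qed.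

Lemma continuous_eps (f : P2 -> R) (x : P2) : {for x, continuous f} ->
  forall e, 0 < e -> exists2 d, 0 < d & forall y, `|x.1 - y.1| < d -> `|x.2 - y.2| < d ->
    `|f x - f y| < e.
Proof.
move=> cf e e0; have /cvgrPdist_lt/(_ e e0)/nbhs_ballP[d /= d0 H] := cf.
by exists d => // y h1 h2; apply: H; split.
Qed.

(** The second difference [D] over a square of side h equals h^2 times either mixed derivative at
    some point of the square, by two mean value steps in either order; continuity lets h be
    small. *)
Lemma schwarz (f : P2 -> R) : (forall x, has_partials f x) ->
  (forall i x, has_partials (pd i f) x) ->
  continuous (pd1 (pd2 f)) -> continuous (pd2 (pd1 f)) ->
  forall x, pd1 (pd2 f) x = pd2 (pd1 f) x.
Proof.
move=> hf hpf c12 c21 x; apply/eqP; rewrite -subr_eq0 -normr_le0.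
apply/ler_addgt0Pl => e e0; rewrite addr0.
have e2 : 0 < e / 2 by rewrite divr_gt0.
have [d1 d10 H1] := continuous_eps (c12 x) e2.
have [d2 d20 H2] := continuous_eps (c21 x) e2.
pose h := Num.min d1 d2 / 2.
have m0 : 0 < Num.min d1 d2 by rewrite lt_min d10 d20.
have h0 : 0 < h by rewrite divr_gt0.
have hd1 : h < d1.
  by apply: (@lt_le_trans _ _ (Num.min d1 d2)); rewrite ?ge_min ?lexx// /h; lra.
have hd2 : h < d2.
  by apply: (@lt_le_trans _ _ (Num.min d1 d2)); rewrite ?ge_min ?lexx ?orbT// /h; lra.
have near d a t : h < d -> a <= t -> t <= a + h -> `|a - t| < d.
  by move=> hd t1 t2; rewrite ltr_norml; apply/andP; split; lra.
pose D := f (x.1 + h, x.2 + h) - f (x.1 + h, x.2) - (f (x.1, x.2 + h) - f (x.1, x.2)).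
have [s [s1 s2 E1]] : exists s, [/\ x.1 <= s, s <= x.1 + h &
    D = (pd1 f (s, x.2 + h) - pd1 f (s, x.2)) * h].
  have [s [s1 s2 E]] := @mvt1 (fun t => f (t, x.2 + h) - f (t, x.2))
    (fun t => pd1 f (t, x.2 + h) - pd1 f (t, x.2)) x.1 h h0
    (fun t => is_deriveB (partials_is_derive false (hf (t, x.2 + h)))
                (partials_is_derive false (hf (t, x.2)))).
  by exists s; split => //; rewrite -E /D.
have [t [t1 t2 E2]] := 
  @mvt1 (fun t => pd1 f (s, t)) (fun t => pd2 (pd1 f) (s, t)) x.2 h h0
    (fun t => partials_is_derive true (hpf false (s, t))).
have [s' [s1' s2' E3]] : exists s, [/\ x.2 <= s, s <= x.2 + h &
    D = (pd2 f (x.1 + h, s) - pd2 f (x.1, s)) * h].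
  have [u [u1 u2 E]] := @mvt1 (fun t => f (x.1 + h, t) - f (x.1, t))
    (fun t => pd2 f (x.1 + h, t) - pd2 f (x.1, t)) x.2 h h0
    (fun t => is_deriveB (partials_is_derive true (hf (x.1 + h, t)))
                (partials_is_derive true (hf (x.1, t)))).
  by exists u; split => //; rewrite -E /D; ring.
have [t' [t1' t2' E4]] := 
  @mvt1 (fun t => pd2 f (t, s')) (fun t => pd1 (pd2 f) (t, s')) x.1 h h0
    (fun t => partials_is_derive false (hpf true (t, s'))).
have E : pd2 (pd1 f) (s, t) = pd1 (pd2 f) (t', s').
  apply: (mulIf (lt0r_neq0 h0)); apply: (mulIf (lt0r_neq0 h0)).
  by rewrite E2 in E1; rewrite E4 in E3; exact: etrans (esym E1) E3.
have K1 := H1 (t', s') (near _ _ _ hd1 t1' t2') (near _ _ _ hd1 s1' s2').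
have K2 := H2 (s, t) (near _ _ _ hd2 s1 s2) (near _ _ _ hd2 t1 t2).
move: K1 K2; rewrite E; clear.
move: (pd1 (pd2 f) (t', s')) (pd1 (pd2 f) x) (pd2 (pd1 f) x) => p q w.
rewrite !ltr_norml ler_norml => /andP[? ?] /andP[? ?].
by apply/andP; split; lra.
Qed.

Lemma integral_derive_compact (g h : R -> R) (r : R) : 0 < r ->
  (forall t : R, is_derive t 1 g (h t)) -> continuous h ->
  (forall t, r <= `|t| -> g t = 0 /\ h t = 0) ->
  (\int[mu]_t (h t)%:E = 0)%E.
Proof.
move=> r0 hg ch hz.
have ab : - r < r by rewrite gtrN.
rewrite (_ : (fun t => (h t)%:E) = ((fun t => (h t)%:E) \_ `[(- r), r])); last first.
  apply/funext => t; rewrite patchE; case: ifPn => // /negP ht.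
  have [_ -> //] : g t = 0 /\ h t = 0.
  apply: hz; rewrite leNgt; apply/negP => tr; apply: ht.
  by rewrite inE /= in_itv /= -ler_norml ltW.
rewrite -integral_mkcond.
have cg t : {for t, continuous g}.
  by apply: differentiable_continuous; apply/derivable1_diffP; exact: (@ex_derive _ _ _ _ _ _ _ (hg t)).
rewrite (@continuous_FTC2 R h g (- r) r ab).
- have [-> _] : g r = 0 /\ h r = 0 by apply: hz; rewrite gtr0_norm.
  have [-> _] : g (- r) = 0 /\ h (- r) = 0 by apply: hz; rewrite normrN gtr0_norm.
  by rewrite subee.
- exact: continuous_subspaceT.
- split.
  + by move=> t _; exact: (@ex_derive _ _ _ _ _ _ _ (hg t)).
  + by apply: cvg_at_right_filter; exact: cg.
  + by apply: cvg_at_left_filter; exact: cg.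
- by move=> t _; rewrite derive1E; exact: (@derive_val _ _ _ _ _ _ _ (hg t)).
Qed.

Lemma continuous_slice i (f : P2 -> R) (x : P2) : continuous f -> continuous (slice i f x).
Proof.
move=> cf; case: i => t.
  apply: (@continuous_comp _ _ _ (fun s => (x.1, s)) f t); last exact: cf.
  exact: (@cvg_pair R R R (nbhs t) (nbhs x.1) (nbhs t) _ _ _ (fun=> x.1) id (@cvg_cst _ _ _ _ _) cvg_id).
apply: (@continuous_comp _ _ _ (fun s => (s, x.2)) f t); last exact: cf.
exact: (@cvg_pair R R R (nbhs t) (nbhs t) (nbhs x.2) _ _ _ id (fun=> x.2) cvg_id (@cvg_cst _ _ _ _ _)).
Qed.

Lemma integral_pd_compact (k : bool) (G : P2 -> R) (r M : R) : 0 < r ->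
  (forall x, has_partials G x) -> continuous (pd k G) ->
  (forall x, `|pd k G x| <= M) ->
  (forall x, ~ square r x -> G x = 0 /\ pd k G x = 0) ->
  (\int[@leb2 R]_x (pd k G x)%:E = 0)%E.
Proof.
move=> r0 hG cG bG hz.
pose f : T2 -> \bar R := EFin \o (pd k G : T2 -> R).
have fE : f = f \_ (square r : set T2).
  apply/funext => x; rewrite patchE; case: ifPn => // /negP hx.
  by rewrite /f /= (hz x _).2// => Ux; apply: hx; rewrite inE.
have imf : (@leb2 R).-integrable [set: T2] f.
  have mS := open_measurable2 (@square_open R r).
  rewrite fE; apply/(integrable_mkcond _ mS).
  apply: (@integrable_bounded2 R (square r) r (pd k G) M) => //; first exact: square_open.
  by move=> x _; exact: cG.
have hz2 (x y : R) : (r <= `|x|) || (r <= `|y|) -> G (x, y) = 0 /\ pd k G (x, y) = 0.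
  by move=> h; apply: hz => -[/= h1 h2]; move: h; rewrite !leNgt h1 h2.
have -> : (\int[@leb2 R]_x (pd k G x)%:E = \int[mu \x mu]_z f z)%E by [].
(* The inner integral is taken along the axis of the derivative, where it vanishes by the
   fundamental theorem of calculus. *)
case: k @f cG bG hz imf fE hz2 => f cG bG hz imf fE hz2.
  rewrite -(@integral12_prod_meas1 _ _ _ _ R mu mu f imf).
  rewrite integral0_eq// => x _; rewrite /fubini_F /f /=.
  apply: (@integral_derive_compact (fun t => G (x, t)) (fun t => pd2 G (x, t)) r r0).
  - by move=> t; exact: (partials_is_derive true (hG (x, t))).
  - by have K := @continuous_slice true (pd true G) (x : R, 0 : R) cG; exact: K.
  - by move=> t ht; apply: hz2; rewrite ht orbT.
rewrite -(@integral21_prod_meas1 _ _ _ _ R mu mu f imf).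
rewrite integral0_eq// => x _; rewrite /fubini_G /f /=.
apply: (@integral_derive_compact (fun t => G (t, x)) (fun t => pd1 G (t, x)) r r0).
- by move=> t; exact: (partials_is_derive false (hG (t, x))).
- by have K := @continuous_slice false (pd false G) (0 : R, x : R) cG; exact: K.
- by move=> t ht; apply: hz2; rewrite ht.
Qed.

End Calculus.

(** * Integration by parts against test functions *)

Section Ibp.
Variable R : realType.
Local Notation P2 := (R * R)%type.
Local Notation T2 := (measurableTypeR R * measurableTypeR R)%type.

Lemma open_slice_near (N : set P2) (i : bool) (x : P2) : open N -> N x ->
  \forall t \near coord_of i x, N (if i then (x.1, t) else (t, x.2)).
Proof.
move=> oN Nx; have /nbhs_ballP[e /= e0 He] : nbhs x N by exact: open_nbhs_nbhs.
apply/nbhs_ballP; exists e => // t; case: i => /= ht; apply: He; split => //=.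
  exact: ballxx.
exact: ballxx.
Qed.

Lemma partials_local0 (N : set P2) (f : P2 -> R) (x : P2) : open N -> N x ->
  (forall y, N y -> f y = 0) -> has_partials f x /\ forall i, pd i f x = 0.
Proof.
move=> oN Nx f0; apply: is_derive_partials => i.
apply: (@near_eq_is_derive _ _ _ (fun=> 0) (slice i f x) _ _ _ _ (is_derive_cst _ _ _)).
have := open_slice_near i oN Nx; apply: filterS => t.
by case: i => /= /f0 ->.
Qed.

Lemma continuous_local0 (N : set P2) (f : P2 -> R) (x : P2) : open N -> N x ->
  (forall y, N y -> f y = 0) -> {for x, continuous f}.
Proof.
move=> oN Nx f0.
have h : nbhs x N by exact: open_nbhs_nbhs.
apply/cvgrPdist_lt => e e0; apply: filterS h => y Ny.
by rewrite !f0// subrr normr0.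
Qed.

Lemma for_continuousDM (T : topologicalType) (f g h k : T -> R) (x : T) :
  {for x, continuous f} -> {for x, continuous g} ->
  {for x, continuous h} -> {for x, continuous k} ->
  {for x, continuous (fun x => f x * g x + h x * k x)}.
Proof.
move=> cf cg ch ck.
exact: (continuousD (continuousM cf cg) (continuousM ch ck)).
Qed.

Section Square.
Variable r : R.
Hypothesis r0 : 0 < r.
Local Notation U := (square r).

Lemma lipschitz_continuous (f : P2 -> R) (M : R) (x : P2) : U x ->
  (forall x y, U x -> U y -> `|f x - f y| <= M * (`|x.1 - y.1| + `|x.2 - y.2|)) ->
  {for x, continuous f}.
Proof.
move=> Ux h; apply/cvgrPdist_lt => e e0.
pose d := e / (2 * (`|M| + 1)).
have M0 : 0 < `|M| + 1 by rewrite ltr_wpDl.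
have d0 : 0 < d by rewrite divr_gt0// mulr_gt0.
have hU : nbhs x U by apply: open_nbhs_nbhs; split => //; exact: square_open.
have hb : nbhs x (ball x d) by exact: nbhsx_ballx.
apply: filterS2 hU hb => y Uy [/= y1 y2].
apply: le_lt_trans (h _ _ Ux Uy) _.
have -> : e = (`|M| + 1) * (d + d) by rewrite /d; field; rewrite gt_eqF.
have s0 : 0 <= `|x.1 - y.1| + `|x.2 - y.2| by rewrite addr_ge0.
apply: (@le_lt_trans _ _ ((`|M| + 1) * (`|x.1 - y.1| + `|x.2 - y.2|))).
  by rewrite ler_wpM2r// (le_trans (ler_norm M))// lerDl.
by rewrite ltr_pM2l// ltrD.
Qed.

Lemma sm_continuous (f : P2 -> R) (x : P2) : sm r f -> U x -> {for x, continuous f}.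
Proof.
move=> [G /(_ 1%N) [_ [hp hb]]] Ux; apply: (@lipschitz_continuous f (G 1%N)) => // y z Uy Uz.
by apply: (lipschitz_square hp _ Uy Uz) => i w Uw; exact: (hb i).1.
Qed.

Variable Om : set P2.
Hypotheses (oO : open Om) (OU : Om `<=` U).

(** Integrability is carried along so that such statements can be added. *)
Definition zint (g : P2 -> R) :=
  (@leb2 R).-integrable (Om : set T2) (EFin \o (g : T2 -> R)) /\
  (\int[@leb2 R]_(x in Om) (g x)%:E = 0)%E.

Lemma zint_eq (f g : P2 -> R) : (forall x, Om x -> f x = g x) -> zint f -> zint g.
Proof.
move=> fg [h1 h2]; split.
  apply: eq_integrable h1; first exact: open_measurable2.
  by move=> x; rewrite inE => Ox; rewrite /= fg.
rewrite -[RHS]h2; apply: eq_integral => x; rewrite inE => Ox.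
by rewrite fg.
Qed.

Lemma zintD (f g : P2 -> R) : zint f -> zint g -> zint (fun x => f x + g x).
Proof.
have mO := open_measurable2 oO.
move=> [f1 f2] [g1 g2]; split; first exact: integrableD f1 g1.
under eq_integral do rewrite EFinD.
by rewrite (integralD mO f1 g1) f2 g2 adde0.
Qed.

Lemma zintN (f : P2 -> R) : zint f -> zint (fun x => - f x).
Proof.
have mO := open_measurable2 oO.
move=> [f1 f2]; split; first exact: integrableN f1.
under eq_integral do rewrite EFinN.
by rewrite integralN ?f2 ?oppe0//; exact: integrable_add_def.
Qed.

(** Only the behaviour of [g] on the square is known, but g psi vanishes off K. It is treated
    separately at points of K and on the open complement of K, which makes it a C^1 function on the
    whole plane. *)
Lemma ibp (k : bool) (g psi : P2 -> R) (K : set P2) (M : R) :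
  sm r g -> compact K -> K `<=` Om ->
  (forall x, has_partials psi x) -> continuous psi -> continuous (pd k psi) ->
  (forall x, ~ K x -> psi x = 0) -> (forall x, `|psi x| <= M) ->
  (forall x, `|pd k psi x| <= M) ->
  zint (fun x => pd k g x * psi x + g x * pd k psi x).
Proof.
move=> sg cK KO hp cpsi cdpsi psi0 bpsi bdpsi.
have clK : closed K by apply: compact_closed => //; exact: norm_hausdorff.
have oK : open (~` K) by exact: closed_openC.
have KU x : K x -> U x by move=> /KO/OU.
have dpsi0 x : ~ K x -> pd k psi x = 0.
  by move=> nK; case: (partials_local0 oK nK psi0).
pose H x := pd k g x * psi x + g x * pd k psi x.
pose G x := g x * psi x.
have G0 x : ~ K x -> G x = 0 by move=> nK; rewrite /G psi0// mulr0.
have H0 x : ~ K x -> H x = 0 by move=> nK; rewrite /H psi0// dpsi0// !mulr0 addr0.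
have PG x : has_partials G x /\ pd k G x = H x.
  have [Kx|nK] := pselect (K x).
    by have [h1 h2] := partialsM (sm_partials sg (KU _ Kx)) (hp x); rewrite h2.
  by have [h1 h2] := partials_local0 oK nK G0; rewrite h2 H0.
have HE : pd k G = H by apply/funext => x; case: (PG x).
have cH : continuous (pd k G).
  rewrite HE => x; have [Kx|nK] := pselect (K x); last exact: continuous_local0 oK nK H0.
  have Ux := KU _ Kx.
  have c1 := sm_continuous (sm_pd k sg) Ux; have c2 := sm_continuous sg Ux.
  by have := for_continuousDM c1 (cpsi x) c2 (cdpsi x).
have [A hA] := sg.
have U0 : U (0, 0) by split; rewrite /= normr0.
have M0 : 0 <= M by exact: le_trans (normr_ge0 _) (bpsi (0, 0)).
have A0 : 0 <= A 0%N by exact: (bnd_ge0 U0 (hA 1%N)).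
have A1 : 0 <= A 1%N by exact: (bnd_ge0 U0 (hA 1%N)).
have bH x : `|pd k G x| <= A 1%N * M + A 0%N * M.
  rewrite HE; have [Kx|nK] := pselect (K x); last first.
    by rewrite H0// normr0 addr_ge0// mulr_ge0.
  have Ux := KU _ Kx; rewrite (le_trans (ler_normD _ _))// !normrM lerD// ler_pM//.
    by have [_ [_ /(_ k) [h _]]] := hA 1%N; exact: h.
  exact: (bnd_norm (hA 1%N) Ux).
have := @integral_pd_compact R k G r (A 1%N * M + A 0%N * M) r0
  (fun x => (PG x).1) cH bH _.
rewrite HE => Z; split.
  apply: (@integrable_bounded2 R Om r H (A 1%N * M + A 0%N * M)) => //.
    by move=> x _; rewrite -HE; exact: cH.
  by move=> x _; rewrite -HE.
rewrite integral_mkcond -[RHS]Z.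
  apply: eq_integral => x _; rewrite patchE; case: ifPn => // /negP nO.
  by rewrite H0// => Kx; apply: nO; rewrite inE; exact: KO.
by move=> x nU; split; [apply: G0|apply: H0] => /KU.
Qed.

Lemma test_deriv (phi : P2 -> R) : test_function Om phi ->
  exists2 K : set P2, compact K /\ K `<=` Om & forall s,
  [/\ forall x, has_partials (foldr (@pd R) phi s) x, continuous (foldr (@pd R) phi s),
      forall x, ~ K x -> foldr (@pd R) phi s x = 0 &
      exists M : R, forall x, `|foldr (@pd R) phi s x| <= M].
Proof.
move=> [sphi [K [cK KO phi0]]]; exists K => // s.
have clK : closed K by apply: compact_closed => //; exact: norm_hausdorff.
have oK : open (~` K) by exact: closed_openC.
have z0 : forall x, ~ K x -> foldr (@pd R) phi s x = 0.
  elim: s => [|i s IH] x nK; first exact: phi0.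
  by have [_ h] := partials_local0 oK nK IH; exact: (h i).
have [c h] := sphi s; split => //.
have [M [_ HM]] : bounded_set (foldr (@pd R) phi s @` K).
  apply: compact_bounded; apply: continuous_compact => //.
  exact: continuous_subspaceT.
exists (`|M| + 1) => x; have [Kx|nK] := pselect (K x); last by rewrite z0// normr0 addr_ge0.
apply: HM; last by exists x.
by rewrite (le_lt_trans (ler_norm M))// ltrDl.
Qed.

Lemma ibp_test (phi g : P2 -> R) (k : bool) (s : seq bool) : test_function Om phi -> sm r g ->
  zint (fun x => pd k g x * foldr (@pd R) phi s x + g x * pd k (foldr (@pd R) phi s) x).
Proof.
move=> /test_deriv[K [cK KO] hphi] sg.
have [h1 h2 h3 [M h4]] := hphi s; have [k1 k2 k3 [M' k4]] := hphi (k :: s).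
apply: (@ibp k g _ K (Num.max M M')) => // x; rewrite le_max.
  by rewrite h4.
by rewrite k4 orbT.
Qed.

Lemma triv_alg (a1 a2 b1 b2 p q s m1 m2 n1 n2 a b : R) : m1 = m2 -> n1 = n2 ->
  a1 * p + a * m1 - (a2 * q + a * m2) + (- (b1 * q + b * n1) + (b2 * s + b * n2)) =
  a1 * p - 2 * (2^-1 * (a2 + b1)) * q + b2 * s.
Proof. by move=> -> ->; field. Qed.

(** The weak form of curl curl annihilating symmetrised gradients. Four integrations by parts, two
    for each potential; the third derivatives of phi cancel in pairs by [schwarz]. *)
Lemma triv_zint (phi E1 E2 E3 : P2 -> R) : test_function Om phi ->
  triv r (fr0 (R := R)) E1 E2 E3 ->
  zint (fun x => E1 x * pd2 (pd2 phi) x - 2 * E2 x * pd2 (pd1 phi) x +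
                 E3 x * pd1 (pd1 phi) x).
Proof.
move=> hphi0 [al [be [sal sbe hE]]].
have [K [cK KO] hphi] := test_deriv hphi0.
have I k g s (sg : sm r g) := ibp_test k s hphi0 sg.
have S s x : pd1 (pd2 (foldr (@pd R) phi s)) x = pd2 (pd1 (foldr (@pd R) phi s)) x.
  apply: schwarz.
  - by case: (hphi s).
  - by move=> i y; case: (hphi (i :: s)).
  - by case: (hphi [:: false, true & s]).
  - by case: (hphi [:: true, false & s]).
have J := zintD (zintD (I false al [:: true; true] sal) (zintN (I true al [:: true; false] sal)))
   (zintD (zintN (I false be [:: true; false] sbe)) (I true be [:: false; false] sbe)).
apply: zint_eq J => x Ox /=; have [-> -> ->] := hE _ (OU Ox).
have E : pd1 (pd2 phi) = pd2 (pd1 phi) by apply/funext => y; exact: (S [::] y).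
have e1 : pd1 (pd2 (pd2 phi)) x = pd2 (pd2 (pd1 phi)) x.
  by rewrite -E; exact: (S [:: true]).
have e2 : pd1 (pd2 (pd1 phi)) x = pd2 (pd1 (pd1 phi)) x by exact: (S [:: false]).
have D1 g : dop (R := R) fr0.1 g x = pd1 g x by rewrite /dop mul1r mul0r addr0.
have D2 g : dop (R := R) fr0.2 g x = pd2 g x by rewrite /dop mul1r mul0r add0r.
rewrite !D1 !D2; exact: triv_alg e1 e2.
Qed.

End Square.
End Ibp.

(** * Convolution kernels *)

Section Kernel1.
Variable R : realType.
Local Notation P2 := (R * R)%type.

Definition along (k : bool) (g : R -> R) : P2 -> R := fun x => g (coord_of k x).

Lemma along_partials (k : bool) (g : R -> R) (x : P2) (d : R) :
  is_derive (coord_of k x) 1 g d ->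
  has_partials (along k g) x /\ forall i, pd i (along k g) x = if i == k then d else 0.
Proof.
move=> h; apply: is_derive_partials => i.
case: i k h => -[] /= h; try exact: h.
  exact: (is_derive_cst (g x.1) x.2 1).
exact: (is_derive_cst (g x.2) x.1 1).
Qed.

Section WeightedBounds.
Variable r : R.
Local Notation U := (square r).
Local Notation w M L := (fun k : nat => M * L ^+ k * wt k).

Lemma bnd_along n (M L : R) (k : bool) (g dg : R -> R) : 0 <= M -> 0 <= L ->
  (forall x, U x -> `|along k g x| <= M) ->
  (forall z : R, is_derive z 1 g (dg z)) ->
  bnd r n (w (M * L) L) (along k dg) -> bnd r n.+1 (w M L) (along k g).
Proof.
move=> M0 L0 gM hg hd.
have P x := along_partials (hg (coord_of k x)).
split; first by move=> x Ux; rewrite expr0 !mulr1; exact: gM.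
split; first by move=> x _; case: (P x).
move=> i; apply: (@bnd_le _ _ _ (w (M * L) L)).
  move=> j /=; rewrite exprS -!mulrA; do 3 (apply: ler_wpM2l => //).
    exact: exprn_ge0.
  by rewrite -[leLHS]mul1r ler_wpM2r ?wt_ge0// exprn_ege1// ler1n.
have [ik|ik] := eqVneq i k.
  by apply: bnd_eq hd => y _; have [_ ->] := P y; rewrite ik eqxx.
apply: (@bnd_eq _ _ _ _ (fun=> 0)).
  by move=> y _; have [_ ->] := P y; rewrite (negbTE ik).
apply: bnd_cst => [|j]; first by rewrite normr0 !mulr_ge0 ?exprn_ge0 ?wt_ge0.
by rewrite !mulr_ge0 ?exprn_ge0 ?wt_ge0.
Qed.

End WeightedBounds.

(* ee l z = sqrt (l^-2 + z^2) smooths |z| at scale 1/l; pp and rr are its first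
   derivative and the reciprocal of l * ee. *)
Definition ee (l z : R) : R := Num.sqrt (1 + (l * z) ^+ 2) / l.
Definition rr (l z : R) : R := (l * ee l z)^-1.
Definition pp (l z : R) : R := z / ee l z.
(** The bounded factor left in [ee m - ee l] once the decay [rr l] is taken out, see [ee_diff]. *)
Definition hh (l m z : R) : R := ee l z / (ee l z + ee m z).

Lemma ee_gt0 l z : 0 < l -> 0 < ee l z.
Proof.
move=> l0; rewrite divr_gt0// sqrtr_gt0 (lt_le_trans ltr01)// lerDl sqr_ge0//.
Qed.

Lemma ee_sqr l z : 0 < l -> ee l z ^+ 2 = l ^- 2 + z ^+ 2.
Proof.
move=> l0; rewrite /ee expr_div_n sqr_sqrtr; last by rewrite addr_ge0// sqr_ge0.
by field; rewrite gt_eqF.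
Qed.

Lemma ee_derive (l z : R) : 0 < l -> is_derive z 1 (ee l) (pp l z).
Proof.
move=> l0; have s0 : 0 < 1 + (l * z) ^+ 2 by rewrite (lt_le_trans ltr01)// lerDl sqr_ge0.
have hq : is_derive z 1 (fun t => 1 + (l * t) ^+ 2) (2 * l ^+ 2 * z).
  have h1 := is_deriveZ l (is_derive_id z (1 : R)).
  have := is_deriveD (is_derive_cst (1 : R) z 1) (is_deriveX 2 h1).
  move=> h; apply: is_derive_eq h _.
  by rewrite /GRing.scale /= expr1 /GRing.scale /=; ring.
have := @is_derive1_comp _ Num.sqrt (fun t => 1 + (l * t) ^+ 2) z _ _ (is_derive1_sqrt s0) hq.
move=> h; have := is_deriveZ (l^-1) h.
rewrite (_ : l^-1 \*: _ = ee l); last by apply/funext => t; rewrite /= /GRing.scale /= mulrC.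
move=> k; apply: is_derive_eq k _; rewrite /pp /ee /GRing.scale /=.
have : Num.sqrt (1 + (l * z) ^+ 2) != 0 by rewrite gt_eqF// sqrtr_gt0.
by move=> ?; field; rewrite gt_eqF//=.
Qed.

(** The derivatives of [rr], [pp] and [hh] are polynomials in these same bounded functions times the
    frequency. This closed algebra is what makes the inductions of [bnd_rr_pp] and [cls_hh] work. *)
Lemma rr_derive (l z : R) : 0 < l ->
  is_derive z 1 (rr l) (- l * (pp l z * (rr l z * rr l z))).
Proof.
move=> l0; have e0 := ee_gt0 z l0.
have ne : l * ee l z != 0 by rewrite gt_eqF// mulr_gt0.
have := @is_deriveV R (fun t => l * ee l t) z _ _ ne (is_deriveZ l (ee_derive z l0)).
move=> h; apply: is_derive_eq h _; rewrite /rr /pp /GRing.scale /=.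
by field; rewrite !gt_eqF.
Qed.

Lemma pp_derive (l z : R) : 0 < l ->
  is_derive z 1 (pp l) (l * (rr l z * (rr l z * rr l z))).
Proof.
move=> l0; have e0 := ee_gt0 z l0.
have ne : ee l z != 0 by rewrite gt_eqF.
have := is_deriveM (is_derive_id z (1 : R)) (@is_deriveV R (ee l) z _ _ ne (ee_derive z l0)).
move=> h; apply: is_derive_eq h _; rewrite /rr /pp /GRing.scale /=.
have E := ee_sqr z l0.
have E2 : z ^+ 2 = ee l z ^+ 2 - l ^- 2 by rewrite E; ring.
rewrite (_ : z * _ + _ = (ee l z ^+ 2 - z ^+ 2) / ee l z ^+ 3); last by field.
by rewrite E2; field; rewrite !gt_eqF.
Qed.

Lemma hh_derive (l m z : R) : 0 < l -> 0 < m ->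
  is_derive z 1 (hh l m)
   (l * (rr l z * hh l m z * (pp l z * (1 - hh l m z) - hh l m z * pp m z))).
Proof.
move=> l0 m0; have e0 := ee_gt0 z l0; have f0 := ee_gt0 z m0.
have ne : ee l z + ee m z != 0 by rewrite gt_eqF// addr_gt0.
have := is_deriveM (ee_derive z l0)
  (@is_deriveV R (fun t => ee l t + ee m t) z _ _ ne (is_deriveD (ee_derive z l0) (ee_derive z m0))).
move=> h; apply: is_derive_eq h _; rewrite /rr /hh /GRing.scale /=.
by field; rewrite !gt_eqF// addr_gt0.
Qed.

Lemma rr_bnd l z : 0 < l -> 0 < rr l z <= 1.
Proof.
move=> l0; have e0 := ee_gt0 z l0; have h : 0 < l * ee l z by rewrite mulr_gt0.
rewrite /rr invr_gt0 h /= invf_le1// /ee mulrCA divff ?gt_eqF// mulr1.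
by rewrite -{1}sqrtr1 ler_sqrt ?lerDl ?sqr_ge0// addr_ge0// sqr_ge0.
Qed.

Lemma rr_norm l z : 0 < l -> `|rr l z| <= 1.
Proof. by move=> /(rr_bnd z)/andP[h1 h2]; rewrite gtr0_norm. Qed.

Lemma ee_norm l z : 0 < l -> `|z| <= ee l z.
Proof.
move=> l0; have h := ltW (ee_gt0 z l0).
rewrite -(@ler_pXn2r _ 2) ?nnegrE// ee_sqr// real_normK ?num_real// lerDr.
by rewrite invr_ge0 exprn_ge0// ltW.
Qed.

Lemma pp_norm l z : 0 < l -> `|pp l z| <= 1.
Proof.
move=> l0; rewrite /pp normrM normfV ler_pdivrMr ?normr_gt0 ?gt_eqF ?ee_gt0//.
by rewrite mul1r (gtr0_norm (ee_gt0 _ l0)) ee_norm.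
Qed.

Lemma hh_bnd l m z : 0 < l -> 0 < m -> 0 <= hh l m z <= 1.
Proof.
move=> l0 m0; have e0 := ee_gt0 z l0; have f0 := ee_gt0 z m0.
rewrite /hh ler_pdivrMr ?addr_gt0// mul1r lerDl (ltW f0) andbT.
by rewrite ltW// divr_gt0// addr_gt0.
Qed.

(** The squares of the two roots differ by a constant, so the difference of the roots decays like
    the reciprocal of their sum: subtracting two smoothed absolute values gains the decay that [ker]
    requires. *)
Lemma ee_diff l m z : 0 < l -> 0 < m ->
  ee m z - ee l z = (m ^- 2 - l ^- 2) * l * (rr l z * hh l m z).
Proof.
move=> l0 m0; have e0 := ee_gt0 z l0; have f0 := ee_gt0 z m0.
have -> : m ^- 2 - l ^- 2 = (ee m z + ee l z) * (ee m z - ee l z).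
  rewrite [X in X - _](_ : _ = ee m z ^+ 2 - z ^+ 2); last by rewrite ee_sqr//; ring.
  rewrite [X in _ - X](_ : _ = ee l z ^+ 2 - z ^+ 2); last by rewrite (ee_sqr _ l0); ring.
  ring.
by rewrite /rr /hh; field; rewrite !gt_eqF// addr_gt0.
Qed.

End Kernel1.

Section Kernel2.
Variable R : realType.
Local Notation P2 := (R * R)%type.
Variable r : R.
Local Notation U := (square r).
Local Notation w M L := (fun k : nat => M * L ^+ k * wt k).

(** Each derivative involves two products, each costing 3: this is the 9 in [9 * l]. The 81 of
    [cls_hh] arises in the same way from [hh_derive], as 3 (3) (6 + 3). *)
Lemma bnd_rr_pp n (l L : R) (k : bool) : 0 < l -> 9 * l <= L ->
  bnd r n (w 1 L) (along k (rr l)) /\ bnd r n (w 1 L) (along k (pp l)).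
Proof.
move=> l0 lL; have L0 : 0 <= L by apply: le_trans lL; rewrite mulr_ge0// ltW.
have R0 x : U x -> `|along k (rr l) x| <= 1 by move=> _; exact: rr_norm.
have P0 x : U x -> `|along k (pp l) x| <= 1 by move=> _; exact: pp_norm.
elim: n => [|n [IH1 IH2]].
  by split; split => // x Ux; rewrite expr0 !mulr1; [exact: R0|exact: P0].
have RR := bnd_clsM ler01 ler01 L0 IH1 IH1.
have c3 : 0 <= 3 * 1 * 1 :> R by rewrite !mulr_ge0.
have PRR := bnd_clsZ (- l) (bnd_clsM ler01 c3 L0 IH2 RR).
have RRR := bnd_clsZ l (bnd_clsM ler01 c3 L0 IH1 RR).
have E : `|l| * (3 * 1 * (3 * 1 * 1)) <= 1 * L by rewrite (gtr0_norm l0); lra.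
have E0 : 0 <= `|l| * (3 * 1 * (3 * 1 * 1)) by rewrite mulr_ge0// !mulr_ge0.
split.
  apply: (bnd_along ler01 L0 R0 (fun z => rr_derive z l0)).
  by apply: bnd_cls_le PRR => //; rewrite normrN.
apply: (bnd_along ler01 L0 P0 (fun z => pp_derive z l0)).
exact: bnd_cls_le RRR.
Qed.

Lemma cls_rr (l L : R) k : 0 < l -> 9 * l <= L -> cls r 1 L (along k (rr l)).
Proof. by move=> l0 lL n; case: (bnd_rr_pp n k l0 lL). Qed.

Lemma cls_pp (l L : R) k : 0 < l -> 9 * l <= L -> cls r 1 L (along k (pp l)).
Proof. by move=> l0 lL n; case: (bnd_rr_pp n k l0 lL). Qed.

Lemma cls_hh (l m L : R) k : 0 < l -> 0 < m -> 81 * l <= L -> 9 * m <= L ->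
  cls r 1 L (along k (hh l m)).
Proof.
move=> l0 m0 lL mL n.
have L0 : 0 <= L by apply: le_trans mL; rewrite mulr_ge0// ltW.
have lL9 : 9 * l <= L by lra.
have H0 x : U x -> `|along k (hh l m) x| <= 1.
  by move=> _; have /andP[h1 h2] := hh_bnd (coord_of k x) l0 m0; rewrite ger0_norm.
elim: n => [|n IH]; first by split => // x Ux; rewrite expr0 !mulr1; exact: H0.
have [hr hp] := bnd_rr_pp n k l0 lL9.
have [_ hq] := bnd_rr_pp n k m0 mL.
have c1 : bnd r n (w 1 L) (fun=> 1).
  apply: bnd_cst => [|j]; first by rewrite expr0 !mulr1 normr1.
  by rewrite !mulr_ge0 ?exprn_ge0 ?wt_ge0.
have h1 := bnd_clsD c1 (bnd_clsZ (-1) IH).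
rewrite normrN1 mul1r in h1.
have n2 : 0 <= 1 + 1 :> R by [].
have h2 := bnd_clsM ler01 n2 L0 hp h1.
have h3 := bnd_clsZ (-1) (bnd_clsM ler01 ler01 L0 IH hq).
have h4 := bnd_clsD h2 h3.
have h5 := bnd_clsM ler01 ler01 L0 hr IH.
have n3 : 0 <= 3 * 1 * 1 :> R by rewrite !mulr_ge0.
have n4 : 0 <= 3 * 1 * (1 + 1) + `|-1| * (3 * 1 * 1) :> R by rewrite normrN1; lra.
have h6 := bnd_clsZ l (bnd_clsM n3 n4 L0 h5 h4).
apply: (bnd_along ler01 L0 H0 (fun z => hh_derive z l0 m0)).
have h7 : 0 <= `|l| * (3 * (3 * 1 * 1) * (3 * 1 * (1 + 1) + `|-1| * (3 * 1 * 1))).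
  by apply: mulr_ge0 => //; apply: mulr_ge0 => //; apply: mulr_ge0.
apply: bnd_eq (bnd_cls_le h7 _ _ _ h6) => //.
- by move=> y _; rewrite /along; ring.
- by rewrite normrN1 (gtr0_norm l0); lra.
Qed.

(** The common decaying factor of all kernels. It decays like 1/(a |z1|) times 1/(b |z2|), so its
    cube is integrable on the plane, and 3 is the exponent dual to 3/2. *)
Definition ker (a b : R) : P2 -> R := fun z => along false (rr a) z * along true (rr b) z.

(* The derivative of ker * g is ker * kernext g, so that the decay of ker is
   kept by all derivatives. *)
Definition kernext (a b : R) (i : bool) (g : P2 -> R) : P2 -> R := fun x =>
  pd i g x - (if i then b else a) *
   (along i (pp (if i then b else a)) x * (along i (rr (if i then b else a)) x * g x)).

Lemma pd_ker (a b M L : R) (i : bool) (g : P2 -> R) (x : P2) : 0 < a -> 0 < b ->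
  cls r M L g -> U x ->
  has_partials (fun y => ker a b y * g y) x /\
  pd i (fun y => ker a b y * g y) x = ker a b x * kernext a b i g x.
Proof.
move=> a0 b0 hg Ux.
have [p1 d1] := along_partials (k := false) (rr_derive (coord_of false x) a0).
have [p2 d2] := along_partials (k := true) (rr_derive (coord_of true x) b0).
have [p3 d3] := partialsM p1 p2.
have [p4 d4] := partialsM p3 (cls_partials hg Ux).
split; first exact: p4.
rewrite d4 d3 d1 d2 /ker /kernext /along.
by case: i => /=; ring.
Qed.

Lemma cls_kernext (a b M L : R) (i : bool) (g : P2 -> R) : 0 < a -> 0 < b -> 0 <= M ->
  9 * a <= L -> 9 * b <= L -> cls r M L g -> cls r (2 * (M * L)) (8 * L) (kernext a b i g).
Proof.
move=> a0 b0 M0 aL bL hg.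
pose c := if i then b else a.
have c0 : 0 < c by rewrite /c; case: (i).
have cL : 9 * c <= L by rewrite /c; case: (i).
have L0 : 0 <= L by apply: le_trans bL; rewrite mulr_ge0// ltW.
have L8 : L <= 8 * L by lra.
have n1 : 0 <= 3 * 1 * M by rewrite !mulr_ge0.
have h := clsZ c (clsM ler01 n1 L0 (cls_pp i c0 cL) (clsM ler01 M0 L0 (cls_rr i c0 cL) hg)).
have n2 : 0 <= `|c| * (3 * 1 * (3 * 1 * M)) by rewrite mulr_ge0// mulr_ge0// mulr1.
have le : `|c| * (3 * 1 * (3 * 1 * M)) <= M * L.
  rewrite (gtr0_norm c0) (_ : c * _ = M * (9 * c)); last by ring.
  by rewrite ler_wpM2l.
have := clsB (cls_pd i hg) (cls_le n2 le L0 L8 h).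
by rewrite (_ : M * L + M * L = 2 * (M * L))//; ring.
Qed.

End Kernel2.

(** * Convolution of the right-hand side with a weighted kernel *)

Section Convolution.
Variable R : realType.
Local Notation P2 := (R * R)%type.
Local Notation T2 := (measurableTypeR R * measurableTypeR R)%type.
Variables (r : R) (Om : set P2) (f : P2 -> R).
Hypotheses (r0 : 0 < r) (oO : open Om) (OU : Om `<=` square r).
Hypothesis fint : (@leb2 R).-integrable (Om : set T2) (EFin \o (f : T2 -> R)).
Local Notation U := (square r).
Local Notation V := (square (2 * r)).

Definition sub2 (x y : P2) : P2 := (x.1 - y.1, x.2 - y.2).

(** For x in the square and y in [Om] the argument x - y stays in the square of twice the size, so
    that is where kernels have to be smooth. *)
Definition convol (K : P2 -> R) (x : P2) : R :=
  \int[@leb2 R]_(y in (Om : set T2)) (f y * K (sub2 x y)).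

Lemma sub2_square x y : U x -> Om y -> V (sub2 x y).
Proof.
move=> [h1 h2] /OU[h3 h4]; split; rewrite /=; apply: le_lt_trans (ler_normB _ _) _; lra.
Qed.

Lemma sub2_continuous x : continuous (sub2 x).
Proof.
move=> y; apply: (@cvg_pair P2 R R (nbhs y) (nbhs (x.1 - y.1)) (nbhs (x.2 - y.2)) _ _ _
  (fun y => x.1 - y.1) (fun y => x.2 - y.2)).
  exact: (cvgB (@cvg_cst _ _ _ _ _) (@cvg_fst _ _ _ _ _)).
exact: (cvgB (@cvg_cst _ _ _ _ _) (@cvg_snd _ _ _ _ _)).
Qed.

Lemma convol_integrable K x : sm (2 * r) K -> U x ->
  (@leb2 R).-integrable (Om : set T2) (fun y : T2 => (f y * K (sub2 x y))%:E).
Proof.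
move=> sK Ux; have r20 : 0 < 2 * r by rewrite mulr_gt0.
have cK y : Om y -> {for y, continuous (K \o sub2 x)}.
  move=> Oy; apply: continuous_comp; first exact: sub2_continuous.
  exact: (sm_continuous sK (sub2_square Ux Oy)).
have [G hG] := sK.
have bK y : Om y -> `|K (sub2 x y)| <= G 0%N.
  by move=> Oy; exact: (bnd_norm (hG 0%N) (sub2_square Ux Oy)).
apply: (@integrableMl _ T2 R (@leb2 R) (Om : set T2) (open_measurable2 oO)
  (EFin \o (f : T2 -> R)) (K \o sub2 x : T2 -> R)).
- exact: fint.
- exact: (continuous_measurable2 oO cK).
exists (G 0%N); split; first exact: num_real.
by move=> M GM y Oy; apply: le_trans (bK _ Oy) (ltW GM).
Qed.

Lemma convol_eq K K' x : (forall z, V z -> K z = K' z) -> U x -> convol K x = convol K' x.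
Proof.
move=> h Ux; apply: eq_Rintegral => y; rewrite inE => Oy.
by rewrite h//; exact: sub2_square.
Qed.

Lemma convolD K K' x : sm (2 * r) K -> sm (2 * r) K' -> U x ->
  convol (fun z => K z + K' z) x = convol K x + convol K' x.
Proof.
move=> sK sK' Ux; rewrite /convol -RintegralD.
- by apply: eq_Rintegral => y _; rewrite mulrDr.
- exact: open_measurable2.
- exact: (convol_integrable sK Ux).
- exact: (convol_integrable sK' Ux).
Qed.

(** Differentiation under the integral, dominated by a multiple of |f|. *)
Lemma convol_pd K x : sm (2 * r) K -> U x ->
  has_partials (convol K) x /\ forall i, pd i (convol K) x = convol (pd i K) x.
Proof.
move=> sK Ux; have mO := open_measurable2 oO.
have [G hG] := sK.
have fi : (@leb2 R).-integrable (Om : set T2) (fun y : T2 => (G 1%N * `|f y|)%:E).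
  have h := @integrableZl _ _ _ (@leb2 R) (Om : set T2) mO (G 1%N) (fun y : T2 => (`|f y|)%:E).
  by apply: h; exact: (integrable_norm fint).
pose xt i t : P2 := if i then (x.1, t) else (t, x.2).
have Ut i t : t \in `]-r, r[%R -> U (xt i t).
  rewrite in_itv /= -ltr_norml => tr; case: Ux => u1 u2.
  by rewrite /xt; case: i; split.
have V0 : V (0, 0) by split; rewrite /= normr0 mulr_gt0.
have G1 : 0 <= G 1%N by exact: (bnd_ge0 V0 (hG 1%N)).
have D i t y : t \in `]-r, r[%R -> Om y ->
    is_derive t 1 (fun t => f y * K (sub2 (xt i t) y)) (f y * pd i K (sub2 (xt i t) y)).
  move=> /(Ut i) Uxt Oy; have hp := sm_partials sK (sub2_square Uxt Oy).
  have hd := partials_is_derive i hp.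
  have hs : is_derive t 1 (fun t => t - coord_of i y) 1.
    have := is_deriveB (is_derive_id t (1 : R)) (is_derive_cst (coord_of i y) t 1).
    by rewrite subr0.
  have E : coord_of i (sub2 (xt i t) y) = t - coord_of i y by case: (i).
  rewrite E in hd.
  have := is_deriveZ (f y) (@is_derive1_comp _ (slice i K (sub2 (xt i t) y)) (fun t => t - coord_of i y) t _ _ hd hs).
  rewrite /GRing.scale /= mulr1.
  rewrite (_ : f y \*: _ = (fun t => f y * K (sub2 (xt i t) y)))//.
  by apply/funext => s; rewrite /= /GRing.scale /=; case: (i).
have cx i : coord_of i x \in `]-r, r[%R.
  by rewrite in_itv /= -ltr_norml; case: Ux => u1 u2; case: (i).
have slE i : slice i (convol K) x = (fun t => \int[@leb2 R]_(y in (Om : set T2)) (f y * K (sub2 (xt i t) y))).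
  by case: (i).
have dE i t y : t \in `]-r, r[%R -> Om y ->
    partial1of2 (fun t y => f y * K (sub2 (xt i t) y)) t y = f y * pd i K (sub2 (xt i t) y).
  move=> ht Oy; rewrite partial1of2E.
  exact: (@derive_val _ _ _ _ _ _ _ (D i t y ht Oy)).
have bd i t y : t \in `]-r, r[%R -> Om y ->
   `|partial1of2 (fun t y => f y * K (sub2 (xt i t) y)) t y| <= G 1%N * `|f y|.
  move=> ht Oy; rewrite dE// normrM mulrC ler_wpM2r//.
  have [_ [_ /(_ i) [h _]]] := hG 1%N.
  by apply: h; exact: sub2_square (Ut i t ht) Oy.
have xtx i : xt i (coord_of i x) = x by rewrite /xt; case: (i) (x) => -[].
apply: is_derive_partials => i; rewrite slE.
apply: DeriveDef.
  apply: (@derivable_under_integral _ _ _ (@leb2 R) (fun t y => f y * K (sub2 (xt i t) y))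
     (Om : set T2) mO (coord_of i x) (- r) r _ _ _ (fun y => G 1%N * `|f y|)) => //.
  - exact: cx.
  - by move=> t ht; exact: (convol_integrable sK (Ut i t ht)).
  - by move=> t y ht Oy; exact: (@ex_derive _ _ _ _ _ _ _ (D i t y ht Oy)).
  - by move=> y; rewrite mulr_ge0.
  - by move=> t y ht Oy; exact: bd.
rewrite -derive1E.
rewrite (@differentiation_under_integral _ _ _ (@leb2 R) (fun t y => f y * K (sub2 (xt i t) y))
     (Om : set T2) mO (coord_of i x) (- r) r _ _ _ (fun y => G 1%N * `|f y|)) => //.
- by apply: eq_Rintegral => y; rewrite inE => Oy; rewrite dE// xtx.
- exact: cx.
- by move=> t ht; exact: (convol_integrable sK (Ut i t ht)).
- by move=> t y ht Oy; exact: (@ex_derive _ _ _ _ _ _ _ (D i t y ht Oy)).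
- by move=> y; rewrite mulr_ge0.
- by move=> t y ht Oy; exact: bd.
Qed.

Lemma convol_norm (rho g : P2 -> R) x M : sm (2 * r) rho -> sm (2 * r) g -> U x -> 0 <= M ->
  (forall z, V z -> 0 <= rho z) -> (forall z, V z -> `|g z| <= M) ->
  `|convol (fun z => rho z * g z) x| <=
    M * \int[@leb2 R]_(y in (Om : set T2)) (`|f y| * rho (sub2 x y)).
Proof.
move=> srho sg Ux M0 rho0 gM; have mO := open_measurable2 oO.
have iK := convol_integrable (smM srho sg) Ux; have ir := convol_integrable srho Ux.
have ia : (@leb2 R).-integrable (Om : set T2) (fun y : T2 => (`|f y| * rho (sub2 x y))%:E).
  have h := @integrable_norm _ _ _ (@leb2 R) (Om : set T2) _ ir.
  apply: eq_integrable h; first exact: mO.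
  move=> y; rewrite inE => Oy /=.
  by rewrite normrM (ger0_norm (rho0 _ _))//; exact: sub2_square.
rewrite -(RintegralZl _ mO ia).
apply: le_trans (le_normr_Rintegral mO iK) _.
apply: le_Rintegral => //; first exact: (@integrable_norm _ _ _ (@leb2 R) (Om : set T2) _ iK).
  by have h := @integrableZl _ _ _ (@leb2 R) (Om : set T2) mO M _ ia; exact: h.
move=> y Oy; have Vxy := sub2_square Ux Oy.
rewrite !normrM (ger0_norm (rho0 _ Vxy)) [leRHS]mulrCA ler_wpM2l//.
by rewrite mulrC ler_wpM2r// ?rho0// gM.
Qed.

(** Differentiating replaces the cofactor g by [kernext] and keeps the weight [ker] in front, so the
    mass I is paid once at every order. The class of [kernext] has amplitude 2 M L and frequency 8
    L; the 4 in [4 * L] absorbs this 2. *)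
Lemma bnd_convol n (a b I M L : R) (g : P2 -> R) : 0 < a -> 0 < b -> 0 <= M -> 0 <= I ->
  9 * a <= L -> 9 * b <= L ->
  (forall x, U x -> \int[@leb2 R]_(y in (Om : set T2)) (`|f y| * ker a b (sub2 x y)) <= I) ->
  cls (2 * r) M L g ->
  bnd r n (fun k => I * M * (4 * L) ^+ k * wt k) (convol (fun z => ker a b z * g z)).
Proof.
move=> a0 b0 + I0 + + hI; have h9 : 0 <= 9 * a by rewrite mulr_ge0// ltW.
elim: n M L g => [|n IH] M L g M0 aL bL hg.
all: have L0 : 0 <= L by exact: le_trans aL.
all: have sk : sm (2 * r) (ker a b) by
   exact: (smM (sm_cls (cls_rr _ false a0 aL)) (sm_cls (cls_rr _ true b0 bL))).
all: have sg := sm_cls hg.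
all: have k0 z : V z -> 0 <= ker a b z by
  move=> _; have /andP[h1 _] := rr_bnd (coord_of false z) a0;
  have /andP[h2 _] := rr_bnd (coord_of true z) b0; apply: mulr_ge0; exact: ltW.
all: have N x : U x -> `|convol (fun z => ker a b z * g z) x| <= I * M by
  move=> Ux; apply: le_trans (convol_norm sk sg Ux M0 k0 (cls_norm hg)) _;
  rewrite mulrC; apply: ler_wpM2r => //; exact: hI.
  by split => // x Ux; rewrite expr0 !mulr1; exact: N.
split; first by move=> x Ux; rewrite expr0 !mulr1; exact: N.
have P x : U x -> has_partials (convol (fun z => ker a b z * g z)) x /\
    forall i, pd i (convol (fun z => ker a b z * g z)) x =
       convol (fun z => ker a b z * kernext a b i g z) x.
  move=> Ux; have [h1 h2] := convol_pd (smM sk sg) Ux; split=> // i.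
  by rewrite h2; apply: convol_eq => // z Vz; case: (pd_ker i a0 b0 hg Vz).
split; first by move=> x /P[].
move=> i; apply: (@bnd_eq _ _ _ _ (convol (fun z => ker a b z * kernext a b i g z))).
  by move=> y /P[_ ->].
have M2 : 0 <= 2 * (M * L) by rewrite mulr_ge0// mulr_ge0.
have aL8 : 9 * a <= 8 * L by lra.
have bL8 : 9 * b <= 8 * L by lra.
apply: bnd_le (IH _ _ _ M2 aL8 bL8 (cls_kernext i a0 b0 M0 aL bL hg)) => k.
rewrite /= exprS (_ : 4 * (8 * L) = 8 * (4 * L)); last by ring.
rewrite exprMn [leLHS](_ : _ = 2 * (I * M * L * ((4 * L) ^+ k * (8 ^+ k * wt k)))); last by ring.
rewrite [leRHS](_ : _ = 4 * (I * M * L * ((4 * L) ^+ k * (8 ^+ k * wt k)))); last by ring.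
apply: ler_wpM2r; last by rewrite ler_nat.
have w0 := @wt_ge0 R k; have e1 : 0 <= (4 * L) ^+ k by rewrite exprn_ge0// mulr_ge0.
have e2 : 0 <= 8 ^+ k :> R by rewrite exprn_ge0.
by do !apply: mulr_ge0.
Qed.

Lemma cls_convol (a b I M L : R) (g : P2 -> R) : 0 < a -> 0 < b -> 0 <= M -> 0 <= I ->
  9 * a <= L -> 9 * b <= L ->
  (forall x, U x -> \int[@leb2 R]_(y in (Om : set T2)) (`|f y| * ker a b (sub2 x y)) <= I) ->
  cls (2 * r) M L g -> cls r (I * M) (4 * L) (convol (fun z => ker a b z * g z)).
Proof. by move=> ? ? ? ? ? ? ? ? n; exact: bnd_convol. Qed.

End Convolution.

(** * Integrals of products over a square, and the mass of the kernels *)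

Section ProductIntegral.
Variable R : realType.
Local Notation P2 := (R * R)%type.
Local Notation T2 := (measurableTypeR R * measurableTypeR R)%type.
Local Notation mu := (@lebesgue_measure R).

Lemma integral_ftc (g G : R -> R) (r : R) : 0 < r -> continuous g ->
  (forall t : R, is_derive t 1 G (g t)) ->
  (\int[mu]_(t in `[(- r)%R, r]) (g t)%:E = (G r - G (- r))%:E)%E.
Proof.
move=> r0 cg hG; have ab : - r < r by rewrite gtrN.
have cG t : {for t, continuous G}.
  by apply: differentiable_continuous; apply/derivable1_diffP; exact: (@ex_derive _ _ _ _ _ _ _ (hG t)).
rewrite (@continuous_FTC2 R g G (- r) r ab)//.
- exact: continuous_subspaceT.
- split.
  + by move=> t _; exact: (@ex_derive _ _ _ _ _ _ _ (hG t)).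
  + by apply: cvg_at_right_filter; exact: cG.
  + by apply: cvg_at_left_filter; exact: cG.
- by move=> t _; rewrite derive1E; exact: (@derive_val _ _ _ _ _ _ _ (hG t)).
Qed.

(** The closed square: its sides are the segments on which the fundamental theorem of calculus gives
    exact values. *)
Definition csq (r : R) : set T2 := `[(- r), r]%classic `*` `[(- r), r]%classic.

Lemma measurable_csq r : measurable (csq r).
Proof. exact: measurableX. Qed.

Lemma square_csq r : (square r : set T2) `<=` csq r.
Proof.
by move=> x [h1 h2]; split; rewrite /= in_itv /= -ler_norml ltW.
Qed.

Lemma integral_csq (g h G H : R -> R) (r : R) : 0 < r -> continuous g -> continuous h ->
  (forall t, 0 <= g t) -> (forall t, 0 <= h t) ->
  (forall t : R, is_derive t 1 G (g t)) -> (forall t : R, is_derive t 1 H (h t)) ->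
  (\int[@leb2 R]_(y in csq r) (g y.1 * h y.2)%:E =
   ((G r - G (- r)) * (H r - H (- r)))%:E)%E.
Proof.
move=> r0 cg ch g0 h0 hG hH.
pose I : set (measurableTypeR R) := `[(- r), r]%classic.
pose pt (k : R -> R) : measurableTypeR R -> \bar R := (EFin \o k) \_ I.
pose g1 := pt g; pose h1 := pt h.
pose F : T2 -> \bar R := fun x => (g1 x.1 * h1 x.2)%E.
have -> : (\int[@leb2 R]_(y in csq r) (g y.1 * h y.2)%:E = \int[mu \x mu]_x F x)%E.
  rewrite integral_mkcond; apply: eq_integral => x _.
  rewrite /F /g1 /h1 /pt !patchE /csq in_setX -/I.
  by case: (x.1 \in I); case: (x.2 \in I); rewrite /= ?mule0 ?mul0e.
have m1 (k : R -> R) : continuous k -> measurable_fun [set: measurableTypeR R] (pt k).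
  move=> ck; apply/(measurable_restrictT _ _).1 => //.
    exact: measurable_itv.
  by apply: measurable_funTS; apply/measurable_EFinP; exact: continuous_measurable_fun.
have mg : measurable_fun setT g1 by exact: m1.
have mh : measurable_fun setT h1 by exact: m1.
have g10 t : (0 <= g1 t)%E by rewrite /g1 /pt patchE; case: ifP => _ //=; rewrite lee_fin.
have h10 t : (0 <= h1 t)%E by rewrite /h1 /pt patchE; case: ifP => _ //=; rewrite lee_fin.
have mF : measurable_fun setT F.
  by apply: emeasurable_funM; [exact: (measurableT_comp mg)|exact: (measurableT_comp mh)].
have F0 x : (0 <= F x)%E by exact: mule_ge0.
have iH : (\int[mu]_t h1 t = (H r - H (- r))%:E)%E.
  by rewrite /h1 /pt -integral_mkcond (integral_ftc r0 ch hH).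
have iG : (\int[mu]_t g1 t = (G r - G (- r))%:E)%E.
  by rewrite /g1 /pt -integral_mkcond (integral_ftc r0 cg hG).
rewrite (@fubini_tonelli1 _ _ _ _ R mu mu F mF F0) EFinM -iG -iH -ge0_integralZr//; last exact: integral_ge0.
by apply: eq_integral => x _; rewrite /fubini_F /F /= ge0_integralZl.
Qed.

End ProductIntegral.

Section KernelMass.
Variable R : realType.
Local Notation P2 := (R * R)%type.
Local Notation T2 := (measurableTypeR R * measurableTypeR R)%type.
Local Notation mu := (@lebesgue_measure R).

(** Either b <= t sqrt u, and the first term on the right dominates, or u <= (b / t)^2, and the
    second does. *)
Lemma young32 (u b t : R) : 0 <= u -> 0 <= b -> 0 < t ->
  u * b <= t * (u * Num.sqrt u) + t ^- 2 * b ^+ 3.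
Proof.
move=> u0 b0 t0; set s := Num.sqrt u; have s0 : 0 <= s by exact: sqrtr_ge0.
have -> : u = s ^+ 2 by rewrite sqr_sqrtr.
have ti : 0 <= t ^- 2 by rewrite invr_ge0 exprn_ge0// ltW.
have b3 : 0 <= b ^+ 3 by exact: exprn_ge0.
have s2 : 0 <= s ^+ 2 by exact: exprn_ge0.
have [h|h] := leP b (t * s).
  rewrite -[leLHS]addr0 lerD//; last by exact: mulr_ge0.
  by rewrite [leRHS](_ : _ = s ^+ 2 * (t * s)); [exact: ler_wpM2l|ring].
rewrite -[leLHS]add0r lerD//.
  by apply: mulr_ge0; [exact: ltW|exact: mulr_ge0].
rewrite [leRHS](_ : _ = (t^-1 * b) ^+ 2 * b); last by field; rewrite gt_eqF.
apply: ler_wpM2r => //; apply: lerXn2r; rewrite ?nnegrE//.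
  by apply: mulr_ge0 => //; rewrite invr_ge0 ltW.
by rewrite mulrC ler_pdivlMr// mulrC ltW.
Qed.

Lemma derive_reflect (g dg : R -> R) (x t : R) : (forall z : R, is_derive z 1 g (dg z)) ->
  is_derive t 1 (fun t => g (x - t)) (- dg (x - t)).
Proof.
move=> hg.
have hs : is_derive t 1 (fun t : R => x - t) (-1).
  have := is_deriveB (is_derive_cst x t (1 : R)) (is_derive_id t (1 : R)).
  by rewrite sub0r.
have := @is_derive1_comp _ g (fun t => x - t) t _ _ (hg (x - t)) hs.
by move=> h; apply: is_derive_eq h _; rewrite mulrN1.
Qed.

Lemma derive_continuous (g dg : R -> R) : (forall z : R, is_derive z 1 g (dg z)) -> continuous g.
Proof.
by move=> hg t; apply: differentiable_continuous; apply/derivable1_diffP; exact: (@ex_derive _ _ _ _ _ _ _ (hg t)).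
Qed.

Lemma rr_reflect_continuous (a x : R) : 0 < a -> continuous (fun t => rr a (x - t)).
Proof.
by move=> a0; apply: derive_continuous => t; exact: (derive_reflect x t (fun z => rr_derive z a0)).
Qed.

Lemma rr3_reflect_continuous (a x : R) : 0 < a ->
  continuous (fun t => rr a (x - t) * (rr a (x - t) * rr a (x - t))).
Proof.
move=> a0 t; have c := @rr_reflect_continuous a x a0 t.
exact: (continuousM c (continuousM c c)).
Qed.

Lemma rr3_ge0 (a z : R) : 0 < a -> 0 <= rr a z * (rr a z * rr a z).
Proof.
move=> a0; have /andP[h _] := rr_bnd z a0; have h' := ltW h.
by apply: mulr_ge0 => //; exact: mulr_ge0.
Qed.

Lemma rr3_primitive (a x t : R) : 0 < a ->
  is_derive t 1 (fun t => - a^-1 * pp a (x - t)) (rr a (x - t) * (rr a (x - t) * rr a (x - t))).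
Proof.
move=> a0; have := is_deriveZ (- a^-1) (derive_reflect x t (fun z => pp_derive z a0)).
move=> h; apply: is_derive_eq h _; rewrite /GRing.scale /=; field.
by rewrite gt_eqF.
Qed.

Lemma ker3E (a b : R) (z : P2) : ker a b z ^+ 3 =
  (rr a z.1 * (rr a z.1 * rr a z.1)) * (rr b z.2 * (rr b z.2 * rr b z.2)).
Proof. by rewrite /ker /along /=; ring. Qed.

(** The cube of [rr a] has the explicit primitive pp a / a, so the mass is computed exactly; as |pp|
    <= 1, it is at most 4 / (a b). *)
Lemma ker3_mass (a b r : R) (x : P2) : 0 < a -> 0 < b -> 0 < r ->
  (\int[@leb2 R]_(y in csq r) (ker a b (sub2 x y) ^+ 3)%:E =
  ((a * b)^-1 * (pp a (x.1 + r) - pp a (x.1 - r)) * (pp b (x.2 + r) - pp b (x.2 - r)))%:E)%E.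
Proof.
move=> a0 b0 r0.
under eq_integral do rewrite ker3E /=.
apply: etrans (integral_csq r0 (@rr3_reflect_continuous a x.1 a0)
  (@rr3_reflect_continuous b x.2 b0) (fun t => rr3_ge0 _ a0) (fun t => rr3_ge0 _ b0)
  (fun t => rr3_primitive x.1 t a0) (fun t => rr3_primitive x.2 t b0)) _.
by congr (_%:E); rewrite !opprK; field; rewrite !gt_eqF.
Qed.

Lemma ker_bnd (a b : R) (z : P2) : 0 < a -> 0 < b -> 0 <= ker a b z <= 1.
Proof.
move=> a0 b0; have /andP[h1 h2] := rr_bnd (coord_of false z) a0.
have /andP[h3 h4] := rr_bnd (coord_of true z) b0.
apply/andP; split; first by apply: mulr_ge0; exact: ltW.
by rewrite -[leRHS]mulr1; apply: ler_pM => //; exact: ltW.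
Qed.

Lemma ker_sm (a b s : R) : 0 < a -> 0 < b -> sm s (ker a b).
Proof.
move=> a0 b0; apply: smM.
  exact: (sm_cls (@cls_rr R s a (9 * a) false a0 (lexx _))).
exact: (sm_cls (@cls_rr R s b (9 * b) true b0 (lexx _))).
Qed.

Lemma ker3_continuous (a b : R) (x : P2) : 0 < a -> 0 < b ->
  continuous (fun y => ker a b (sub2 x y) ^+ 3).
Proof.
move=> a0 b0 y; set z := sub2 x y; pose s := `|z.1| + `|z.2| + 1.
have Uz : square s z.
  by split; rewrite /s -addrA; [rewrite ltrDl|rewrite addrCA ltrDl]; rewrite ltr_wpDl.
have c : {for y, continuous (ker a b \o sub2 x)}.
  apply: continuous_comp; first exact: sub2_continuous.
  exact: (sm_continuous (ker_sm s a0 b0) Uz).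
exact: (continuousM c (continuousM c c)).
Qed.

Variables (r : R) (Om : set P2) (f : P2 -> R).
Hypotheses (r0 : 0 < r) (oO : open Om) (OU : Om `<=` square r).
Hypothesis fint : (@leb2 R).-integrable (Om : set T2) (EFin \o (f : T2 -> R)).
Hypothesis f32 : (@leb2 R).-integrable (Om : set T2) (fun y : T2 => (`|f y| * Num.sqrt `|f y|)%:E).
Local Notation U := (square r).

(* Young's inequality |f| b <= t |f|^(3/2) + t^-2 b^3 with b the kernel: this is
   where f in L^(3/2) is used. *)
Lemma young_ker (a b t : R) (x : P2) : 0 < a -> 0 < b -> 0 < t -> U x ->
  \int[@leb2 R]_(y in (Om : set T2)) (`|f y| * ker a b (sub2 x y)) <=
  t * \int[@leb2 R]_(y in (Om : set T2)) (`|f y| * Num.sqrt `|f y|) + t ^- 2 * (4 / (a * b)).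
Proof.
move=> a0 b0 t0 Ux; have mO := open_measurable2 oO.
have sk := ker_sm (2 * r) a0 b0.
have i1 : (@leb2 R).-integrable (Om : set T2) (fun y : T2 => (`|f y| * ker a b (sub2 x y))%:E).
  have h := @integrable_norm _ _ _ (@leb2 R) (Om : set T2) _ (convol_integrable r0 oO OU fint sk Ux).
  apply: eq_integrable h; first exact: mO.
  move=> y _ /=; rewrite normrM; congr (_ * _)%:E.
  by rewrite ger0_norm//; case/andP: (ker_bnd (sub2 x y) a0 b0).
have i2 : (@leb2 R).-integrable (Om : set T2) (fun y : T2 => (ker a b (sub2 x y) ^+ 3)%:E).
  apply: (@integrable_bounded2 R Om r (fun y => ker a b (sub2 x y) ^+ 3) 1 oO OU).
    by move=> y _; exact: ker3_continuous.
  move=> y _; have /andP[h1 h2] := ker_bnd (sub2 x y) a0 b0.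
  by rewrite normrX (ger0_norm h1) exprn_ile1.
have i3 := @integrableZl _ _ _ (@leb2 R) (Om : set T2) mO t _ f32.
have i4 := @integrableZl _ _ _ (@leb2 R) (Om : set T2) mO (t ^- 2) _ i2.
have le1 : \int[@leb2 R]_(y in (Om : set T2)) (ker a b (sub2 x y) ^+ 3) <= 4 / (a * b).
  rewrite -lee_fin /Rintegral fineK; last exact: integrable_fin_num.
  have c : ((a * b)^-1 * (pp a (x.1 + r) - pp a (x.1 - r)) * (pp b (x.2 + r) - pp b (x.2 - r)) <= 4 / (a * b)).
    rewrite -mulrA [leRHS]mulrC; apply: ler_wpM2l.
      by rewrite invr_ge0; apply: mulr_ge0; exact: ltW.
    have n2 z w c : 0 < c -> `|pp c z - pp c w| <= 2.
      move=> c0; apply: le_trans (ler_normB _ _) _.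
      by have := pp_norm z c0; have := pp_norm w c0; lra.
    apply: le_trans (ler_norm _) _; rewrite normrM (_ : 4 = 2 * 2); last by ring.
    by apply: ler_pM => //; exact: n2.
  have := ker3_mass x a0 b0 r0 => e.
  apply: (@le_trans _ _ (\int[@leb2 R]_(y in csq r) (ker a b (sub2 x y) ^+ 3)%:E)%E).
    apply: ge0_subset_integral => //.
    - exact: measurable_csq.
    - apply/measurable_EFinP; apply: measurable_funTS.
      by apply: continuous_measurable2; [exact: openT|move=> y _; exact: ker3_continuous].
    - by move=> y _; rewrite lee_fin exprn_ge0//; case/andP: (ker_bnd (sub2 x y) a0 b0).
    - by move=> y /OU; exact: square_csq.
  by rewrite e lee_fin.
apply: (@le_trans _ _ (\int[@leb2 R]_(y in (Om : set T2))
   (t * (`|f y| * Num.sqrt `|f y|) + t ^- 2 * ker a b (sub2 x y) ^+ 3))).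
  apply: le_Rintegral => //; first exact: (integrableD mO i3 i4).
  by move=> y _; apply: young32 => //; case/andP: (ker_bnd (sub2 x y) a0 b0).
rewrite RintegralD// (RintegralZl _ mO f32) (RintegralZl _ mO i2) lerD2l.
by apply: ler_wpM2l => //; rewrite invr_ge0 exprn_ge0// ltW.
Qed.

End KernelMass.

(** * Tensor kernels *)

Section Tensor.
Variable R : realType.
Local Notation P2 := (R * R)%type.
Local Notation T2 := (measurableTypeR R * measurableTypeR R)%type.

(** Arranged so that [pd i] acts on the second factor only. *)
Definition tens (i : bool) (g h : R -> R) : P2 -> R := fun z => along (~~ i) g z * along i h z.

Lemma pd_tens (i : bool) (g dg h dh : R -> R) : (forall t : R, is_derive t 1 g (dg t)) ->
  (forall t : R, is_derive t 1 h (dh t)) ->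
  forall z, pd i (tens i g h) z = tens i g dh z.
Proof.
move=> hg hh z; have [p1 d1] := along_partials (k := ~~ i) (hg (coord_of (~~ i) z)).
have [p2 d2] := along_partials (k := i) (hh (coord_of i z)).
have [_ ->] := partialsM p1 p2.
rewrite d1 d2 eqxx; have -> : (i == ~~ i) = false by case: (i).
by rewrite mul0r add0r.
Qed.

(* phi l is an approximate identity on the line: it is the second derivative of
   ee l / 2 and has integral 1. *)
Definition phi (l z : R) : R := 2^-1 * l * (rr l z * (rr l z * rr l z)).
Definition dE (l m z : R) : R := 2^-1 * (ee m z - ee l z).
Definition dP (l m z : R) : R := 2^-1 * (pp m z - pp l z).

Lemma dE_derive l m (z : R) : 0 < l -> 0 < m -> is_derive z 1 (dE l m) (dP l m z).
Proof.
move=> l0 m0.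
exact: (is_deriveZ (2^-1) (is_deriveB (ee_derive z m0) (ee_derive z l0))).
Qed.

Lemma dP_derive l m (z : R) : 0 < l -> 0 < m -> is_derive z 1 (dP l m) (phi m z - phi l z).
Proof.
move=> l0 m0.
have h := is_deriveZ (2^-1) (is_deriveB (pp_derive z m0) (pp_derive z l0)).
by apply: is_derive_eq h _; rewrite /GRing.scale /= /phi; ring.
Qed.

Lemma rr3_derive l (z : R) : 0 < l -> is_derive z 1 (phi l)
  (- (3 / 2) * l ^+ 2 * pp l z * (rr l z * (rr l z * (rr l z * rr l z)))).
Proof.
move=> l0; have h := rr_derive z l0.
have := is_deriveZ (2^-1 * l) (is_deriveM h (is_deriveM h h)).
have -> : (rr l * rr l) z = rr l z * rr l z by [].
by move=> k; apply: is_derive_eq k _; rewrite /GRing.scale /=; field.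
Qed.

Lemma sm_rr (s : R) k (l : R) : 0 < l -> sm s (along k (rr l)).
Proof. by move=> l0; exact: (sm_cls (@cls_rr R s l (9 * l) k l0 (lexx _))). Qed.

Lemma sm_phi (s : R) k (l : R) : 0 < l -> sm s (along k (phi l)).
Proof.
move=> l0; have h := sm_rr s k l0.
exact: (smZ (2^-1 * l) (smM h (smM h h))).
Qed.

Lemma cls_ee (s : R) k (l : R) : 0 < s -> 0 < l ->
  cls s (l^-1 + s + 1) (9 * l + 1) (along k (ee l)).
Proof.
move=> s0 l0; have li : 0 < l^-1 by rewrite invr_gt0.
have M0 : 0 <= l^-1 + s + 1 by lra.
have L0 : 0 <= 9 * l + 1 by lra.
have b x : square s x -> `|along k (ee l) x| <= l^-1 + s + 1.
  move=> Ux; have zs : `|coord_of k x| <= s by case: Ux => u1 u2; case: (k); exact: ltW.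
  have e0 := ltW (ee_gt0 (coord_of k x) l0); rewrite /along ger0_norm//.
  have z0 := normr_ge0 (coord_of k x).
  apply: (@le_trans _ _ (l^-1 + `|coord_of k x|)); last by lra.
  rewrite -(@ler_pXn2r _ 2) ?nnegrE//; last by lra.
  rewrite ee_sqr// -(real_normK (num_real (coord_of k x))) sqrrD exprVn.
  rewrite -addrA lerD2l lerDr mulrn_wge0//.
  by apply: mulr_ge0 => //; exact: ltW.
case=> [|n]; first by split => // x Ux; rewrite expr0 !mulr1; exact: b.
apply: (bnd_along M0 L0 b (fun z => ee_derive z l0)).
have ll : 9 * l <= 9 * l + 1 by lra.
have := @cls_pp R s l (9 * l + 1) k l0 ll.
move/(_ n); apply: bnd_cls_le => //.
rewrite -[leLHS]mulr1; apply: ler_pM => //; lra.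
Qed.

Lemma sm_dE (s : R) k (l m : R) : 0 < s -> 0 < l -> 0 < m -> sm s (along k (dE l m)).
Proof.
move=> s0 l0 m0.
exact: (smZ (2^-1) (smB (sm_cls (cls_ee k s0 m0)) (sm_cls (cls_ee k s0 l0)))).
Qed.

Lemma sm_tens (s : R) i (g h : R -> R) : (forall k, sm s (along k g)) -> (forall k, sm s (along k h)) ->
  sm s (tens i g h).
Proof. by move=> hg hh; exact: (smM (hg _) (hh _)). Qed.

(** [gA] and [gB] are the cofactors in the factorisations [tensA] and [tensB]: one [rr] of the cube
    in [phi] and the [rr] of [ee_diff] go into [ker], the rest stays here. *)
Definition gA (l m : R) : P2 -> R := fun z =>
  (4^-1 * (l ^+ 2 * (m ^- 2 - l ^- 2))) * ((along false (rr l) z * along false (rr l) z) * along true (hh l m) z).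
Definition gB (l m : R) : P2 -> R := fun z =>
  (4^-1 * (l * m * (m ^- 2 - l ^- 2))) * (along false (hh l m) z * (along true (rr m) z * along true (rr m) z)).

Lemma tensA l m z : 0 < l -> 0 < m -> tens true (phi l) (dE l m) z = ker l l z * gA l m z.
Proof.
move=> l0 m0; rewrite /tens /ker /gA /along /phi /dE /= ee_diff//; field.
by rewrite !gt_eqF.
Qed.

Lemma tensB l m z : 0 < l -> 0 < m -> tens false (phi m) (dE l m) z = ker l m z * gB l m z.
Proof.
move=> l0 m0; rewrite /tens /ker /gB /along /phi /dE /= ee_diff//; field.
by rewrite !gt_eqF.
Qed.

Lemma cls_gA (s l m : R) : 0 < l -> l <= m -> cls s (9 / 4) (81 * m) (gA l m).
Proof.
move=> l0 lm; have m0 := lt_le_trans l0 lm.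
have L0 : 0 <= 81 * m by lra.
have h1 : 9 * l <= 81 * m by lra.
have h2 : 81 * l <= 81 * m by lra.
have h3 : 9 * m <= 81 * m by lra.
have c1 := @cls_rr R s l (81 * m) false l0 h1.
have c2 := @cls_hh R s l m (81 * m) true l0 m0 h2 h3.
have n3 : 0 <= 3 * 1 * 1 :> R by lra.
have h := clsZ (4^-1 * (l ^+ 2 * (m ^- 2 - l ^- 2))) (clsM n3 ler01 L0 (clsM ler01 ler01 L0 c1 c1) c2).
apply: cls_le h => //.
rewrite (_ : 9 / 4 = 4^-1 * (3 * (3 * 1 * 1) * 1)); last by field.
apply: ler_wpM2r; first by lra.
rewrite (_ : l ^+ 2 * _ = - (1 - (l / m) ^+ 2)); last by field; rewrite !gt_eqF.
have q0 : 0 <= l / m by apply: ltW; rewrite divr_gt0.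
have q1 : l / m <= 1 by rewrite ler_pdivrMr// mul1r.
have q2 : (l / m) ^+ 2 <= 1 by exact: exprn_ile1.
have q3 : 0 <= (l / m) ^+ 2 by exact: exprn_ge0.
by rewrite ler_norml; apply/andP; split; lra.
Qed.

(** The factor m / l is a true loss against [gA], but a harmless one: consecutive scales have the
    fixed ratio S, which is put into [CA]. *)
Lemma cls_gB (s l m : R) : 0 < l -> l <= m -> cls s (9 / 4 * (m / l)) (81 * m) (gB l m).
Proof.
move=> l0 lm; have m0 := lt_le_trans l0 lm.
have L0 : 0 <= 81 * m by lra.
have h2 : 81 * l <= 81 * m by lra.
have h3 : 9 * m <= 81 * m by lra.
have c1 := @cls_rr R s m (81 * m) true m0 h3.
have c2 := @cls_hh R s l m (81 * m) false l0 m0 h2 h3.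
have n3 : 0 <= 3 * 1 * 1 :> R by lra.
have h := clsZ (4^-1 * (l * m * (m ^- 2 - l ^- 2))) (clsM ler01 n3 L0 c2 (clsM ler01 ler01 L0 c1 c1)).
apply: cls_le h => //.
rewrite (_ : 9 / 4 * _ = 4^-1 * (m / l) * (3 * 1 * (3 * 1 * 1))); last by field; rewrite gt_eqF.
apply: ler_wpM2r; first by lra.
rewrite (_ : l * m * _ = - ((m / l) * (1 - (l / m) ^+ 2))); last by field; rewrite !gt_eqF.
have q0 : 0 <= l / m by apply: ltW; rewrite divr_gt0.
have q1 : l / m <= 1 by rewrite ler_pdivrMr// mul1r.
have q2 : (l / m) ^+ 2 <= 1 by exact: exprn_ile1.
have q3 : 0 <= (l / m) ^+ 2 by exact: exprn_ge0.
have ml : 0 <= m / l by apply: ltW; rewrite divr_gt0.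
rewrite normrM (ger0_norm (_ : 0 <= 4^-1))//; apply: ler_wpM2l => //.
rewrite normrN normrM (ger0_norm ml) -[leRHS]mulr1; apply: ler_wpM2l => //.
by rewrite ler_norml; apply/andP; split; lra.
Qed.

End Tensor.

(** * Primitives of the right-hand side *)

Section Primitives.
Variable R : realType.
Local Notation P2 := (R * R)%type.
Local Notation T2 := (measurableTypeR R * measurableTypeR R)%type.
Variables (r : R) (Om : set P2) (f : P2 -> R).
Hypotheses (r0 : 0 < r) (oO : open Om) (OU : Om `<=` square r).
Hypothesis fint : (@leb2 R).-integrable (Om : set T2) (EFin \o (f : T2 -> R)).
Hypothesis f32 : (@leb2 R).-integrable (Om : set T2) (fun y : T2 => (`|f y| * Num.sqrt `|f y|)%:E).
Local Notation U := (square r).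
Local Notation V := (square (2 * r)).
Local Notation conv := (convol Om f).

Lemma convol_pd2 (i : bool) (g dg h h1 h2 : R -> R) (x : P2) : sm (2 * r) (tens i g h) ->
  (forall t : R, is_derive t 1 g (dg t)) ->
  (forall t : R, is_derive t 1 h (h1 t)) -> (forall t : R, is_derive t 1 h1 (h2 t)) -> U x ->
  pd i (pd i (conv (tens i g h))) x = conv (tens i g h2) x.
Proof.
move=> sK hg hh hh1 Ux.
have E y : U y -> pd i (conv (tens i g h)) y = conv (tens i g h1) y.
  move=> Uy; have [_ ->] := convol_pd r0 oO OU fint sK Uy.
  by apply: convol_eq Uy => // z _; exact: pd_tens hg hh z.
have sK1 : sm (2 * r) (tens i g h1).
  by apply: sm_eq (sm_pd i sK) => z _; exact: pd_tens hg hh z.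
rewrite (pd_eq E i Ux); have [_ ->] := convol_pd r0 oO OU fint sK1 Ux.
by apply: convol_eq Ux => // z _; exact: pd_tens hg hh1 z.
Qed.

Lemma pd2_sub (i : bool) (g h : P2 -> R) (x : P2) : sm r g -> sm r h -> U x ->
  pd i (pd i (fun y => g y - h y)) x = pd i (pd i g) x - pd i (pd i h) x.
Proof.
move=> sg sh Ux.
have E y : U y -> pd i (fun y => g y - h y) y = pd i g y - pd i h y.
  by move=> Uy; have [_ ->] := partialsB (sm_partials sg Uy) (sm_partials sh Uy).
rewrite (pd_eq E i Ux).
by have [_ ->] := partialsB (sm_partials (sm_pd i sg) Ux) (sm_partials (sm_pd i sh) Ux).
Qed.

Variable T : R.
Hypothesis T2le : 2 <= T.
Local Notation S := (T ^+ 3).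

Let T0 : 0 < T. Proof. by apply: lt_le_trans T2le. Qed.
Let T1 : 1 <= T. Proof. by apply: le_trans T2le; rewrite ler1n. Qed.
Let S0 j : 0 < S ^+ j. Proof. by rewrite exprn_gt0// exprn_gt0. Qed.
Let SS j : S ^+ j <= S ^+ j.+1.
Proof.
rewrite [leRHS]exprS -[leLHS]mul1r; apply: ler_wpM2r; first by exact: ltW.
by do 2?apply: exprn_ege1; exact: T1.
Qed.

(* With phi_l for phi l, phi_m(x1) phi_m(x2) - phi_l(x1) phi_l(x2) is
   phi_l(x1) (phi_m - phi_l)(x2) + (phi_m - phi_l)(x1) phi_m(x2), and phi_m - phi_l is
   the second derivative of dE l m: the first term is d_22 of the kernel of incA, the
   second d_11 of that of incB. *)
Definition incA (j : nat) : P2 -> R := conv (tens true (phi (S ^+ j)) (dE (S ^+ j) (S ^+ j.+1))).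
Definition incB (j : nat) : P2 -> R := conv (tens false (phi (S ^+ j.+1)) (dE (S ^+ j) (S ^+ j.+1))).
(** Start of the telescoping at scale 1. No difference of [ee] is taken here, so the kernel grows
    linearly in one variable, which is harmless on a bounded square. *)
Definition base : P2 -> R := conv (tens false (phi 1) (fun z => 2^-1 * ee 1 z)).

(** The signs of [aa] and [bb] are such that d22 aa + d11 bb, which is curl curl of diag (aa, bb),
    is minus the mollified f; see [curl_aa_bb]. *)
Fixpoint aa (j : nat) : P2 -> R := if j is i.+1 then fun x => aa i x - incA i x else fun=> 0.
Fixpoint bb (j : nat) : P2 -> R := if j is i.+1 then fun x => bb i x - incB i x else fun x => - base x.

Definition mass32 : R := \int[@leb2 R]_(y in (Om : set T2)) (`|f y| * Num.sqrt `|f y|).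

Lemma mass32_ge0 : 0 <= mass32.
Proof. by apply: Rintegral_ge0 => y _; apply: mulr_ge0 => //; exact: sqrtr_ge0. Qed.

(** The choice t = T^(-2j), which is l^(-2/3), balances the two terms of [young_ker]: t^-2 times 4
    l^-2 is again 4 T^(-2j). *)
Lemma young_ker_scale j (m : R) (x : P2) : S ^+ j <= m -> U x ->
  \int[@leb2 R]_(y in (Om : set T2)) (`|f y| * ker (S ^+ j) m (sub2 x y)) <=
  (T ^- 2) ^+ j * (mass32 + 4).
Proof.
move=> lm Ux; have m0 := lt_le_trans (S0 j) lm.
have q0 : 0 < T ^+ j by rewrite exprn_gt0.
have tE : (T ^- 2) ^+ j = (T ^+ j) ^- 2 by rewrite exprVn -!exprM mulnC.
have lE : S ^+ j = (T ^+ j) ^+ 3 by rewrite -!exprM mulnC.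
have t0 : 0 < (T ^- 2) ^+ j by rewrite tE invr_gt0 exprn_gt0.
apply: le_trans (young_ker r0 oO OU fint f32 (S0 j) m0 t0 Ux) _.
rewrite mulrDr lerD2l.
apply: (@le_trans _ _ ((T ^- 2) ^+ j ^- 2 * (4 / (S ^+ j * S ^+ j)))).
  apply: ler_wpM2l; first by rewrite invr_ge0 exprn_ge0// ltW.
  apply: ler_wpM2l => //; rewrite lef_pV2 ?posrE; last 2 first.
  - exact: mulr_gt0.
  - exact: mulr_gt0.
  by apply: ler_wpM2l => //; exact: ltW.
by rewrite tE lE le_eqVlt; apply/orP; left; apply/eqP; field; rewrite gt_eqF.
Qed.

Definition CA : R := (mass32 + 4) * (9 / 4 * S).

Lemma CA_ge0 : 0 <= CA.
Proof.
have h := mass32_ge0; apply: mulr_ge0; first by lra.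
by apply: mulr_ge0 => //; rewrite exprn_ge0// ltW.
Qed.

Lemma cls_incA j : cls r (CA * (T ^- 2) ^+ j) (324 * S ^+ j.+1) (incA j).
Proof.
have h := mass32_ge0.
have t0 : 0 <= (T ^- 2) ^+ j by rewrite exprn_ge0// invr_ge0 exprn_ge0// ltW.
have I0 : 0 <= (T ^- 2) ^+ j * (mass32 + 4) by apply: mulr_ge0 => //; lra.
have s0 := S0 j; have ss := SS j.
have aL : 9 * S ^+ j <= 81 * S ^+ j.+1 by lra.
have n9 : 0 <= 9 / 4 :> R by lra.
have := cls_convol r0 oO OU fint s0 s0 n9 I0 aL aL
  (fun x Ux => young_ker_scale (lexx _) Ux) (cls_gA _ s0 ss).
have -> : 4 * (81 * S ^+ j.+1) = 324 * S ^+ j.+1 by ring.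
move=> k; apply: cls_eq (cls_le _ _ _ (lexx _) k).
- move=> y Uy; apply: convol_eq Uy => // z _.
  by rewrite -tensA//; exact: S0.
- exact: mulr_ge0.
- rewrite /CA [leRHS](_ : _ = (T ^- 2) ^+ j * (mass32 + 4) * (9 / 4 * S)); last by ring.
  apply: ler_wpM2l => //; rewrite -[leLHS]mulr1; apply: ler_wpM2l => //.
  by do 2?apply: exprn_ege1; exact: T1.
- lra.
Qed.

Lemma cls_incB j : cls r (CA * (T ^- 2) ^+ j) (324 * S ^+ j.+1) (incB j).
Proof.
have h := mass32_ge0.
have t0 : 0 <= (T ^- 2) ^+ j by rewrite exprn_ge0// invr_ge0 exprn_ge0// ltW.
have I0 : 0 <= (T ^- 2) ^+ j * (mass32 + 4) by apply: mulr_ge0 => //; lra.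
have s0 := S0 j; have ss := SS j; have s1 := S0 j.+1.
have aL : 9 * S ^+ j <= 81 * S ^+ j.+1 by lra.
have bL : 9 * S ^+ j.+1 <= 81 * S ^+ j.+1 by lra.
have n9 : 0 <= 9 / 4 * (S ^+ j.+1 / S ^+ j) :> R.
  by apply: mulr_ge0 => //; apply: divr_ge0; exact: ltW.
have := cls_convol r0 oO OU fint s0 s1 n9 I0 aL bL
  (fun x Ux => young_ker_scale ss Ux) (cls_gB _ s0 ss).
have -> : 4 * (81 * S ^+ j.+1) = 324 * S ^+ j.+1 by ring.
move=> k; apply: cls_eq (cls_le _ _ _ (lexx _) k).
- move=> y Uy; apply: convol_eq Uy => // z _.
  by rewrite -tensB//; exact: S0.
- exact: mulr_ge0.
- rewrite /CA [leRHS](_ : _ = (T ^- 2) ^+ j * (mass32 + 4) * (9 / 4 * S)); last by ring.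
  by rewrite (exprS S j) mulfK// gt_eqF.
- lra.
Qed.

Lemma cls_base : exists2 M : R, 0 <= M & cls r M 324 base.
Proof.
have h := mass32_ge0.
have I0 : 0 <= (T ^- 2) ^+ 0 * (mass32 + 4) by rewrite expr0 mul1r; lra.
have r20 : 0 < 2 * r by apply: mulr_gt0.
have n1 : 0 <= 1^-1 + 2 * r + 1 :> R by rewrite invr1; lra.
have L0 : 0 <= 81 :> R by [].
have L9 : 9 * 1 <= 81 :> R by rewrite mulr1 ler_nat.
have L1 : 9 * 1 + 1 <= 81 :> R by lra.
have c1 := cls_le n1 (lexx _) (_ : 0 <= 9 * 1 + 1) L1 (cls_ee false r20 ltr01).
have {}c1 := c1 ltac:(lra).
have c2 := @cls_rr R (2 * r) 1 81 true ltr01 L9.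
set M1 := _ + _ in c1 n1.
have n3 : 0 <= 3 * M1 * M1 by do 2 apply: mulr_ge0 => //.
have n4 : 0 <= 3 * 1 * 1 :> R by lra.
(* At scale 1 one has ee = rr ee^2, so this kernel too is [ker 1 1] times a cofactor. *)
have c := clsZ (4^-1) (clsM n3 n4 L0 (clsM n1 n1 L0 c1 c1) (clsM ler01 ler01 L0 c2 c2)).
set g := fun x => _ in c; set M2 := `|_| * _ in c.
have M20 : 0 <= M2 by apply: mulr_ge0 => //; apply: mulr_ge0 => //; apply: mulr_ge0.
have s0 : 0 < S ^+ 0 :> R by rewrite expr0.
have := @cls_convol R r Om f r0 oO OU fint 1 1 _ M2 81 g ltr01 ltr01 M20 I0 L9 L9
  (fun x Ux => @young_ker_scale 0 1 x (lexx _) Ux) c.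
have -> : 4 * 81 = 324 :> R by ring.
move=> k; exists ((T ^- 2) ^+ 0 * (mass32 + 4) * M2); first exact: mulr_ge0.
apply: cls_eq k => y Uy; apply: convol_eq Uy => // z _.
rewrite /g /tens /ker /along /phi /rr /=; field.
by rewrite !gt_eqF ?ee_gt0.
Qed.

End Primitives.

Section PrimitiveBounds.
Variable R : realType.
Local Notation P2 := (R * R)%type.
Local Notation T2 := (measurableTypeR R * measurableTypeR R)%type.

(** A geometric series of ratio at most 1/2; the partial sum bound 2 - 2 x^j is the form that is
    stable under the induction. *)
Lemma cls_telescope (r M C x L s : R) (u w : nat -> P2 -> R) :
  0 <= M -> 0 <= C -> 0 <= x -> x <= 2^-1 -> 0 <= L -> 1 <= s ->
  (forall j y, u j.+1 y = u j y - w j y) -> cls r M L (u 0%N) ->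
  (forall j, cls r (C * x ^+ j) (L * s ^+ j.+1) (w j)) ->
  forall j, cls r (M + 2 * C) (L * s ^+ j) (u j).
Proof.
move=> M0 C0 x0 x1 L0 s1 hu h0 hw.
have s0 : 0 <= s by lra.
have X j : 0 <= x ^+ j <= 1 by rewrite exprn_ge0//= exprn_ile1//; lra.
have Lj j : 0 <= L * s ^+ j by rewrite mulr_ge0// exprn_ge0.
have A j : 0 <= M + C * (2 - 2 * x ^+ j).
  by have /andP[h1 h2] := X j; apply: addr_ge0 => //; apply: mulr_ge0 => //; lra.
have H j : cls r (M + C * (2 - 2 * x ^+ j)) (L * s ^+ j) (u j).
  elim: j => [|j IH]; first by rewrite !expr0 !mulr1 subrr mulr0 addr0.
  have le : L * s ^+ j <= L * s ^+ j.+1.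
    by apply: ler_wpM2l => //; rewrite exprS ler_peMl// exprn_ge0.
  have k := clsB (cls_le (A j) (lexx _) (Lj j) le IH) (hw j).
  apply: cls_eq (cls_le _ _ _ (lexx _) k) => //.
  - by apply: addr_ge0 => //; apply: mulr_ge0 => //; case/andP: (X j).
  - rewrite -addrA lerD2l -mulrDr; apply: ler_wpM2l => //.
    have /andP[h1 _] := X j; have : x * x ^+ j <= 2^-1 * x ^+ j by exact: ler_wpM2r.
    by rewrite exprS; lra.
move=> j; apply: cls_le (H j) => //.
have /andP[h1 h2] := X j; rewrite lerD2l [leRHS]mulrC; apply: ler_wpM2l => //; lra.
Qed.

Variables (r : R) (Om : set P2) (f : P2 -> R).
Hypotheses (r0 : 0 < r) (oO : open Om) (OU : Om `<=` square r).
Hypothesis fint : (@leb2 R).-integrable (Om : set T2) (EFin \o (f : T2 -> R)).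
Hypothesis f32 : (@leb2 R).-integrable (Om : set T2) (fun y : T2 => (`|f y| * Num.sqrt `|f y|)%:E).
Local Notation U := (square r).
Variable T : R.
Hypothesis T2le : 2 <= T.
Local Notation S := (T ^+ 3).
Local Notation CA := (CA Om f T).
Local Notation aa := (aa Om f T).
Local Notation bb := (bb Om f T).

Let T0 : 0 < T. Proof. by apply: lt_le_trans T2le. Qed.
Let T1 : 1 <= T. Proof. by apply: le_trans T2le; rewrite ler1n. Qed.
Let S0 j : 0 < S ^+ j. Proof. by rewrite exprn_gt0// exprn_gt0. Qed.

Lemma cls_aa_bb : exists2 M, 0 <= M & forall j,
  cls r M (324 * S ^+ j) (aa j) /\ cls r M (324 * S ^+ j) (bb j).
Proof.
have [M M0 hM] := cls_base r0 oO OU fint f32 T2le.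
have C0 := CA_ge0 Om f T2le.
have S1 : 1 <= S by exact: exprn_ege1.
have x0 : 0 <= T ^- 2 by rewrite invr_ge0 exprn_ge0// ltW.
have x1 : T ^- 2 <= 2^-1.
  rewrite lef_pV2 ?posrE ?exprn_gt0// (le_trans T2le)// expr2 ler_peMl//; exact: ltW.
have L0 : 0 <= 324 :> R by exact: ler0n.
exists (M + 2 * CA); first by apply: addr_ge0 => //; apply: mulr_ge0.
move=> j; split.
  apply: (cls_telescope M0 C0 x0 x1 L0 S1 (u := aa) (w := incA Om f T)) => //.
    by apply: cls_cst => //; rewrite normr0.
  by move=> i; exact: cls_incA.
apply: (cls_telescope M0 C0 x0 x1 L0 S1 (u := bb) (w := incB Om f T)) => //.
  exact: clsN.
by move=> i; exact: cls_incB.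
Qed.

Lemma cls_aa_bb_inc j : cls r (CA * (T ^- 2) ^+ j) (324 * S ^+ j.+1) (fun y => aa j.+1 y - aa j y) /\
  cls r (CA * (T ^- 2) ^+ j) (324 * S ^+ j.+1) (fun y => bb j.+1 y - bb j y).
Proof.
split.
  by apply: cls_eq (clsN (cls_incA r0 oO OU fint f32 T2le j)) => y _ /=; ring.
by apply: cls_eq (clsN (cls_incB r0 oO OU fint f32 T2le j)) => y _ /=; ring.
Qed.

Local Notation conv := (convol Om f).
Local Notation kap j := (tens true (phi (S ^+ j)) (phi (S ^+ j))).

Lemma curl_aa_bb j (x : P2) : U x ->
  pd true (pd true (aa j)) x + pd false (pd false (bb j)) x = - conv (kap j) x.
Proof.
have [M _ hM] := cls_aa_bb; have r20 : 0 < 2 * r by exact: mulr_gt0.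
have D0 (z : R) : is_derive z 1 (fun z : R => 2^-1 * ee 1 z) (2^-1 * pp 1 z).
  exact: (is_deriveZ (2^-1) (ee_derive z ltr01)).
have D1 (z : R) : is_derive z 1 (fun z : R => 2^-1 * pp 1 z) (phi 1 z).
  have h := is_deriveZ (2^-1) (pp_derive z (@ltr01 R)).
  by apply: is_derive_eq h _; rewrite /GRing.scale /= /phi; ring.
have sP l k : 0 < l -> sm (2 * r) (along k (phi l)) by exact: sm_phi.
have S1 : 0 < S ^+ 0 by rewrite expr0.
have sb : sm r (base Om f).
  by have [M' _ h] := cls_base r0 oO OU fint f32 T2le; exact: sm_cls h.
elim: j x => [|j IH] x Ux.
  have E0 (y : P2) : pd true (fun=> 0 : R) y = 0 by have [_ ->] := partials_cst (0 : R) y.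
  have -> : pd true (pd true (aa 0)) x = 0.
    rewrite [X in pd true X](_ : _ = fun=> 0); first exact: E0.
    by apply/funext => y; exact: E0.
  have -> : pd false (pd false (bb 0)) x = - pd false (pd false (base Om f)) x.
    have E (y : P2) : pd false (fun=> 0 : R) y = 0 by have [_ ->] := partials_cst (0 : R) y.
    have h := pd2_sub false (sm_cst r 0) sb Ux.
    have e1 : pd false (pd false (fun=> 0 : R)) x = 0.
      rewrite [X in pd false X](_ : _ = fun=> 0); first exact: E.
      by apply/funext => y; exact: E.
    rewrite e1 sub0r in h; rewrite -h; congr (pd false (pd false _) x).
    by apply/funext => y /=; rewrite sub0r.
  rewrite add0r; congr (- _).
  have st : sm (2 * r) (tens false (phi 1) (fun z => 2^-1 * ee 1 z)).
    apply: sm_tens => k; first exact: sP ltr01.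
    exact: (smZ (2^-1) (sm_cls (cls_ee k r20 ltr01))).
  rewrite /base (convol_pd2 r0 oO OU fint st (fun t => rr3_derive t ltr01) D0 D1 Ux).
  by apply: convol_eq Ux => // z _; rewrite expr0 /tens mulrC.
have [j0 j1] := (S0 j, S0 j.+1).
have sE k : sm (2 * r) (along k (dE (S ^+ j) (S ^+ j.+1))) by exact: sm_dE.
have tA : sm (2 * r) (tens true (phi (S ^+ j)) (dE (S ^+ j) (S ^+ j.+1))).
  by apply: sm_tens => k //; exact: sP.
have tB : sm (2 * r) (tens false (phi (S ^+ j.+1)) (dE (S ^+ j) (S ^+ j.+1))).
  by apply: sm_tens => k //; exact: sP.
have sA := sm_cls (cls_incA r0 oO OU fint f32 T2le j).
have sB := sm_cls (cls_incB r0 oO OU fint f32 T2le j).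
have [hA hB] := hM j.
have eA := pd2_sub true (sm_cls hA) sA Ux.
have eB := pd2_sub false (sm_cls hB) sB Ux.
apply: etrans (congr2 +%R eA eB) _.
rewrite addrACA IH// -opprD -opprD; congr (- _).
have dd z := dE_derive z j0 j1; have ddd z := dP_derive z j0 j1.
rewrite /incA /incB (convol_pd2 r0 oO OU fint tA (fun t => rr3_derive t j0) dd ddd Ux).
rewrite (convol_pd2 r0 oO OU fint tB (fun t => rr3_derive t j1) dd ddd Ux).
pose d z := phi (S ^+ j.+1) z - phi (S ^+ j) z.
have sd k : sm (2 * r) (along k d) by exact: smB (sP _ k j1) (sP _ k j0).
have k1 : sm (2 * r) (tens true (phi (S ^+ j)) d) by apply: sm_tens => // k; exact: sP.
have k2 : sm (2 * r) (tens false (phi (S ^+ j.+1)) d) by apply: sm_tens => // k; exact: sP.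
have k3 : sm (2 * r) (kap j) by apply: sm_tens => k; exact: sP.
rewrite -(convolD r0 oO OU fint k1 k2 Ux) -(convolD r0 oO OU fint k3 (smD k1 k2) Ux).
by apply: convol_eq Ux => // z _; rewrite /tens /d /along /=; ring.
Qed.

End PrimitiveBounds.

(** * Approximate identity and weak convergence *)

Section ApproximateIdentity.
Variable R : realType.
Local Notation P2 := (R * R)%type.
Local Notation T2 := (measurableTypeR R * measurableTypeR R)%type.
Local Notation mu := (@lebesgue_measure R).

Lemma integrable_csq (r M : R) (g : P2 -> R) : continuous g -> (forall x, csq r x -> `|g x| <= M) ->
  (@leb2 R).-integrable (csq r) (EFin \o (g : T2 -> R)).
Proof.
move=> cg gM; apply: measurable_bounded_integrable.
- exact: measurable_csq.
- apply: le_lt_trans (leb2_square (r + 1)).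
  apply: le_measure; rewrite ?inE; first exact: measurable_csq.
    exact: (open_measurable2 (@square_open R (r + 1))).
  move=> x [/=]; rewrite !in_itv /= -!ler_norml => h1 h2.
  by split; [apply: le_lt_trans h1 _|apply: le_lt_trans h2 _]; rewrite ltrDl.
- apply: measurable_funTS; apply: continuous_measurable2; first exact: openT.
  by move=> x _; exact: cg.
- by exists M; split; rewrite ?num_real// => M' MM' x Ox; exact: le_trans (gM _ Ox) (ltW MM').
Qed.

Lemma derive_shift (g dg : R -> R) (c t : R) : (forall z : R, is_derive z 1 g (dg z)) ->
  is_derive t 1 (fun t => g (t - c)) (dg (t - c)).
Proof.
move=> hg.
have hs : is_derive t 1 (fun t : R => t - c) 1.
  have := is_deriveB (is_derive_id t (1 : R)) (is_derive_cst c t (1 : R)).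
  by rewrite subr0.
have := @is_derive1_comp _ g (fun t => t - c) t _ _ (hg (t - c)) hs.
by move=> h; apply: is_derive_eq h _; rewrite mulr1.
Qed.

(** The bound is that of [approximate_identity]. First [e1] makes the term 2 Q e1 at most e/2; then
    a large l makes the remaining terms, all of order 1/l, at most e/2. *)
Lemma mollification_scale (r Q B e : R) : 0 < r -> 0 <= Q -> 0 <= B -> 0 < e ->
  exists e1 m, [/\ 0 < e1, 0 < m & forall l, m <= l ->
    2 <= l * r /\ Q * (2 * e1 + 2 * r / (l * e1)) + B * (4 / (l * r)) <= e].
Proof.
move=> r0 Q0 B0 e0.
pose e1 := e / (4 * (Q + 1)).
have Q10 : 0 < Q + 1 by rewrite ltr_wpDl.
have W4 : 0 < 4 * (Q + 1) by apply: mulr_gt0.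
have e10 : 0 < e1 by exact: divr_gt0.
pose C := Q * (2 * r / e1) + 4 * B / r.
have C0 : 0 <= C.
  apply: addr_ge0; last by apply: divr_ge0; [exact: mulr_ge0|exact: ltW].
  by apply: mulr_ge0 => //; apply: divr_ge0; [apply: mulr_ge0 => //|]; exact: ltW.
have C1 : 0 <= 2 * C / e by apply: divr_ge0; [exact: mulr_ge0|exact: ltW].
have C2 : 0 < 2 / r by exact: divr_gt0.
exists e1, (2 * C / e + 2 / r); split => //; first exact: ltr_wpDl.
move=> l hl; have l0 : 0 < l by apply: lt_le_trans hl; exact: ltr_wpDl.
split; first by rewrite -ler_pdivrMr//; apply: le_trans hl; rewrite lerDr.
have -> : Q * (2 * e1 + 2 * r / (l * e1)) + B * (4 / (l * r)) = Q * 2 * e1 + C / l.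
  by rewrite /C; field; rewrite !gt_eqF.
have p1 : Q * 2 * e1 <= e / 2.
  have -> : e / 2 = (Q + 1) * 2 * e1 by rewrite /e1; field; rewrite gt_eqF.
  apply: ler_wpM2r; first exact: ltW.
  by apply: ler_wpM2r => //; rewrite lerDl.
have p2 : C / l <= e / 2.
  rewrite ler_pdivrMr// mulrC -ler_pdivrMr; last by rewrite divr_gt0.
  apply: le_trans hl; rewrite (_ : C / (e / 2) = 2 * C / e); first by rewrite lerDl ltW.
  by field; rewrite gt_eqF.
by rewrite [leRHS](splitr e); exact: lerD.
Qed.

Section Fixed.
Variables (l r : R) (l0 : 0 < l) (r0 : 0 < r).

Lemma phi_ge0 z : 0 <= phi l z.
Proof. by apply: mulr_ge0; [apply: mulr_ge0 => //; exact: ltW|exact: rr3_ge0]. Qed.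

Lemma phi_le z : phi l z <= 2^-1 * l.
Proof.
have /andP[h1 h2] := rr_bnd z l0; have h3 := ltW h1.
rewrite /phi -[leRHS]mulr1; apply: ler_wpM2l; first by apply: mulr_ge0 => //; exact: ltW.
by apply: mulr_ile1 => //; [exact: mulr_ge0|exact: mulr_ile1].
Qed.

(** [phi l] decays only like the cube of 1/|z| and has no finite second moment on the line. This
    pointwise bound, integrated over a bounded square, replaces the moment. *)
Lemma sqr_phi_le z : z ^+ 2 * phi l z <= (2 * l)^-1.
Proof.
have /andP[h1 h2] := rr_bnd z l0; have h3 := ltW h1.
have e0 := ee_gt0 z l0.
have z2 : z ^+ 2 <= ee l z ^+ 2.
  by rewrite ee_sqr// lerDr invr_ge0 exprn_ge0// ltW.
apply: (@le_trans _ _ (ee l z ^+ 2 * phi l z)).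
  by apply: ler_wpM2r => //; exact: phi_ge0.
rewrite /phi [leLHS](_ : _ = (2 * l)^-1 * rr l z); last first.
  by rewrite /rr; field; rewrite !gt_eqF.
rewrite -[leRHS]mulr1; apply: ler_wpM2l => //.
by rewrite invr_ge0; apply: mulr_ge0 => //; exact: ltW.
Qed.

Lemma phi_primitive c (t : R) : is_derive t 1 (fun t => 2^-1 * pp l (t - c)) (phi l (t - c)).
Proof.
have := is_deriveZ (2^-1) (derive_shift c t (fun z => pp_derive z l0)).
by move=> h; apply: is_derive_eq h _; rewrite /GRing.scale /= /phi; ring.
Qed.

Lemma phi_shift_continuous c : continuous (fun t => phi l (t - c)).
Proof.
have h t := derive_shift c t (fun z => rr3_derive z l0).
exact: (derive_continuous h).
Qed.

(** The mass on [-r, r] of [phi l] centred at c, through its primitive. *)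
Definition pmass (c : R) : R := 2^-1 * pp l (r - c) - 2^-1 * pp l (- r - c).

Lemma pmass_le1 c : pmass c <= 1.
Proof.
rewrite /pmass; have := pp_norm (r - c) l0; have := pp_norm (- r - c) l0.
by rewrite !ler_norml => /andP[? ?] /andP[? ?]; lra.
Qed.

Lemma pp_ge d : 0 < d -> 1 - (l * d)^-1 <= pp l d.
Proof.
move=> d0; have e0 := ee_gt0 d l0; rewrite /pp ler_pdivlMr//.
have li : 0 < l^-1 by rewrite invr_gt0.
have e1 : ee l d <= d + l^-1.
  rewrite -(@ler_pXn2r _ 2) ?nnegrE//; [|exact: ltW|by lra].
  rewrite ee_sqr// sqrrD exprVn addrC -addrA lerD2l lerDr mulrn_wge0//.
  by apply: mulr_ge0; exact: ltW.
have e2 : d <= ee l d by apply: le_trans (ee_norm d l0); exact: ler_norm.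
rewrite mulrBl mul1r lerBlDr.
have : l^-1 <= (l * d)^-1 * ee l d.
  by rewrite invfM -mulrA -[leLHS]mulr1; apply: ler_wpM2l; [exact: ltW|rewrite mulrC ler_pdivlMr// mul1r].
lra.
Qed.

Lemma pp_odd z : pp l (- z) = - pp l z.
Proof. by rewrite /pp /ee mulrN sqrrN mulNr. Qed.

(** A centre in the inner half is at distance at least r/2 from both ends, so little mass is lost.
    This is why [Om] is placed in [square (r / 2)]. *)
Lemma pmass_ge c : `|c| < r / 2 -> 1 - 2 / (l * r) <= pmass c.
Proof.
rewrite ltr_norml => /andP[c1 c2]; rewrite /pmass.
have -> : - r - c = - (r + c) by ring.
rewrite pp_odd.
have d1 : r / 2 <= r - c by lra.
have d2 : r / 2 <= r + c by lra.
have r20 : 0 < r / 2 by lra.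
have H d : r / 2 <= d -> 1 - 2 / (l * r) <= pp l d.
  move=> rd; have d0 := lt_le_trans r20 rd.
  apply: le_trans (pp_ge d0); rewrite lerD2l lerN2.
  have -> : 2 / (l * r) = (l * (r / 2))^-1 by field; rewrite !gt_eqF.
  rewrite lef_pV2 ?posrE; [|exact: mulr_gt0..].
  by apply: ler_wpM2l => //; exact: ltW.
have := H _ d1; have := H _ d2; lra.
Qed.

Definition kap (z : P2) : R := phi l z.1 * phi l z.2.

Lemma kap_ge0 z : 0 <= kap z.
Proof. by apply: mulr_ge0; exact: phi_ge0. Qed.

Lemma kap_le z : kap z <= (2^-1 * l) * (2^-1 * l).
Proof. by apply: ler_pM; [exact: phi_ge0|exact: phi_ge0|exact: phi_le|exact: phi_le]. Qed.

Lemma kap_continuous y : continuous (fun x => kap (sub2 x y)).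
Proof.
move=> x.
have c1 : {for x, continuous (fun x : P2 => phi l (x.1 - y.1))}.
  by apply: (@continuous_comp _ _ _ (fun x : P2 => x.1) (fun t => phi l (t - y.1)));
    [exact: cvg_fst|exact: phi_shift_continuous].
have c2 : {for x, continuous (fun x : P2 => phi l (x.2 - y.2))}.
  by apply: (@continuous_comp _ _ _ (fun x : P2 => x.2) (fun t => phi l (t - y.2)));
    [exact: cvg_snd|exact: phi_shift_continuous].
exact: (continuousM c1 c2).
Qed.

Lemma kap_mass y : (\int[@leb2 R]_(x in csq r) (kap (sub2 x y))%:E = (pmass y.1 * pmass y.2)%:E)%E.
Proof.
exact: (integral_csq r0 (phi_shift_continuous (c := y.1)) (phi_shift_continuous (c := y.2))
  (fun t => phi_ge0 _) (fun t => phi_ge0 _) (phi_primitive y.1) (phi_primitive y.2)).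
Qed.

Lemma phi_mass1 c : (\int[@leb2 R]_(x in csq r) (phi l (x.1 - c))%:E = (pmass c * (2 * r))%:E)%E.
Proof.
have c1 : continuous (fun _ : R => 1 : R) by exact: (derive_continuous (fun z => is_derive_cst (1 : R) z 1)).
have := integral_csq r0 (phi_shift_continuous (c := c)) c1
  (fun t => phi_ge0 _) (fun t => ler01) (phi_primitive c) (fun t => is_derive_id t (1 : R)).
by under eq_integral do rewrite mulr1; move=> ->; congr (_%:E); rewrite /pmass; ring.
Qed.

Lemma phi_mass2 c : (\int[@leb2 R]_(x in csq r) (phi l (x.2 - c))%:E = (pmass c * (2 * r))%:E)%E.
Proof.
have c1 : continuous (fun _ : R => 1 : R) by exact: (derive_continuous (fun z => is_derive_cst (1 : R) z 1)).
have := integral_csq r0 c1 (phi_shift_continuous (c := c))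
  (fun t => ler01) (fun t => phi_ge0 _) (fun t => is_derive_id t (1 : R)) (phi_primitive c).
by under eq_integral do rewrite mul1r; move=> ->; congr (_%:E); rewrite /pmass; ring.
Qed.

(** From |z| <= e + z^2 / e in each variable: the first moment is traded for the mass and for
    [sqr_phi_le]. *)
Lemma kap_moment e y x : 0 < e ->
  kap (sub2 x y) * (`|x.1 - y.1| + `|x.2 - y.2|) <=
  2 * e * kap (sub2 x y) + (2 * l * e)^-1 * (phi l (x.1 - y.1) + phi l (x.2 - y.2)).
Proof.
move=> e0; rewrite /kap /=.
set a := x.1 - y.1; set b := x.2 - y.2.
have H z : `|z| <= e + e^-1 * z ^+ 2.
  have ee : 0 < e^-1 by rewrite invr_gt0.
  rewrite -(real_normK (num_real z)); have := sqr_ge0 (`|z| - e); move: (normr_ge0 z).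
  move: `|z| => w w0 hw; rewrite -(ler_pM2l e0) mulrDr mulrA divff ?gt_eqF// mul1r.
  nra.
have p1 := phi_ge0 a; have p2 := phi_ge0 b.
have q1 := sqr_phi_le a; have q2 := sqr_phi_le b.
have ei : 0 <= e^-1 by rewrite invr_ge0 ltW.
have k0 : 0 <= phi l a * phi l b by exact: mulr_ge0.
apply: (@le_trans _ _ (phi l a * phi l b * (e + e^-1 * a ^+ 2 + (e + e^-1 * b ^+ 2)))).
  by apply: ler_wpM2l => //; apply: lerD; exact: H.
rewrite [leLHS](_ : _ = 2 * e * (phi l a * phi l b) +
   (e^-1 * ((a ^+ 2 * phi l a) * phi l b) + e^-1 * ((b ^+ 2 * phi l b) * phi l a))); last by ring.
rewrite lerD2l [leRHS](_ : _ = e^-1 * ((2 * l)^-1 * phi l b) + e^-1 * ((2 * l)^-1 * phi l a)); last first.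
  by field; rewrite !gt_eqF.
by apply: lerD; apply: ler_wpM2l => //; apply: ler_wpM2r.
Qed.

(** Two errors: the Lipschitz constant Q times the first moment, and B times the mass that falls
    outside the square. *)
Lemma approximate_identity (psi : P2 -> R) (y : P2) (B Q e : R) : 2 <= l * r ->
  continuous psi -> (forall x, csq r x -> `|psi x| <= B) -> 0 <= Q ->
  (forall x, csq r x -> `|psi x - psi y| <= Q * (`|x.1 - y.1| + `|x.2 - y.2|)) ->
  square (r / 2) y -> 0 < e ->
  `| \int[@leb2 R]_(x in csq r) (kap (sub2 x y) * psi x) - psi y| <=
    Q * (2 * e + 2 * r / (l * e)) + B * (4 / (l * r)).
Proof.
move=> lr cpsi bpsi Q0 lip [y1 y2] e0.
have mC := @measurable_csq R r.
have ck := kap_continuous (y := y).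
have kb x : `|kap (sub2 x y)| <= (2^-1 * l) * (2^-1 * l) by rewrite ger0_norm ?kap_ge0// kap_le.
have ik : (@leb2 R).-integrable (csq r) (fun x : T2 => (kap (sub2 x y))%:E).
  exact: integrable_csq ck (fun x _ => kb x).
have Cy : csq r y.
  by split; rewrite /= in_itv /= -ler_norml; [apply: le_trans (ltW y1) _|apply: le_trans (ltW y2) _];
    rewrite ler_pdivrMr// mulr2n mulrDr mulr1 lerDl ltW.
have B0 : 0 <= B by exact: le_trans (normr_ge0 _) (bpsi y Cy).
have ikp : (@leb2 R).-integrable (csq r) (fun x : T2 => (kap (sub2 x y) * psi x)%:E).
  apply: (@integrable_csq r ((2^-1 * l) * (2^-1 * l) * B) (fun x => kap (sub2 x y) * psi x)).
    by move=> x; exact: (continuousM (ck x) (cpsi x)).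
  by move=> x Cx; rewrite normrM; apply: ler_pM => //; exact: bpsi.
have ikc := @integrableZl _ _ _ (@leb2 R) (csq r) mC (psi y) _ ik.
pose m := pmass y.1 * pmass y.2.
have mE : \int[@leb2 R]_(x in csq r) kap (sub2 x y) = m by rewrite /Rintegral kap_mass.
have p1 := pmass_le1 y.1; have p2 := pmass_le1 y.2.
have q1 := pmass_ge y1; have q2 := pmass_ge y2.
have lr0 : 0 < l * r by exact: mulr_gt0.
have dle : 2 / (l * r) <= 1 by rewrite ler_pdivrMr// mul1r.
have m01 : 1 - 4 / (l * r) <= m <= 1.
  rewrite /m; set d := 2 / (l * r) in q1 q2 dle.
  have -> : 4 / (l * r) = 2 * d by rewrite /d; field; rewrite !gt_eqF.
  move: (pmass y.1) (pmass y.2) q1 q2 p1 p2 => u v *.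
  by apply/andP; split; nra.
(* The value psi y is compared with psi y times the mass [m], which is within 4 / (l r) of 1. *)
have E : \int[@leb2 R]_(x in csq r) (kap (sub2 x y) * psi x) - psi y =
    \int[@leb2 R]_(x in csq r) (kap (sub2 x y) * psi x - psi y * kap (sub2 x y)) - psi y * (1 - m).
  by rewrite RintegralB// (RintegralZl _ mC ik) mE; ring.
rewrite E; apply: le_trans (ler_normB _ _) _; apply: lerD; last first.
  rewrite normrM; apply: ler_pM => //; first exact: bpsi.
  case/andP: m01 => m1 m2.
  by rewrite ger0_norm; lra.
have i1 : (@leb2 R).-integrable (csq r) (fun x : T2 => (kap (sub2 x y) * psi x - psi y * kap (sub2 x y))%:E).
  exact: (integrableB mC ikp ikc).
have pc1 : continuous (fun x : P2 => phi l (x.1 - y.1)).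
  by move=> x; apply: (@continuous_comp _ _ _ (fun x : P2 => x.1) (fun t => phi l (t - y.1)));
    [exact: cvg_fst|exact: phi_shift_continuous].
have pc2 : continuous (fun x : P2 => phi l (x.2 - y.2)).
  by move=> x; apply: (@continuous_comp _ _ _ (fun x : P2 => x.2) (fun t => phi l (t - y.2)));
    [exact: cvg_snd|exact: phi_shift_continuous].
have pb z : `|phi l z| <= 2^-1 * l by rewrite ger0_norm ?phi_ge0// phi_le.
have j1 : (@leb2 R).-integrable (csq r) (fun x : T2 => (phi l (x.1 - y.1))%:E).
  exact: integrable_csq pc1 (fun x _ => pb _).
have j2 : (@leb2 R).-integrable (csq r) (fun x : T2 => (phi l (x.2 - y.2))%:E).
  exact: integrable_csq pc2 (fun x _ => pb _).
have j3 := integrableD mC j1 j2.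
have j4 := @integrableZl _ _ _ (@leb2 R) (csq r) mC ((2 * l * e)^-1) _ j3.
have j5 := @integrableZl _ _ _ (@leb2 R) (csq r) mC (2 * e) _ ik.
have j6 := integrableD mC j5 j4.
have j7 := @integrableZl _ _ _ (@leb2 R) (csq r) mC Q _ j6.
apply: le_trans (le_normr_Rintegral mC i1) _.
apply: (@le_trans _ _ (\int[@leb2 R]_(x in csq r) (Q * (2 * e * kap (sub2 x y) +
   (2 * l * e)^-1 * (phi l (x.1 - y.1) + phi l (x.2 - y.2)))))).
  apply: le_Rintegral => //; first exact: (@integrable_norm _ _ _ (@leb2 R) (csq r) _ i1).
  move=> x Cx; rewrite [psi y * _]mulrC -mulrBr normrM ger0_norm ?kap_ge0//.
  apply: le_trans (ler_wpM2l (kap_ge0 _) (lip _ Cx)) _.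
  by rewrite mulrCA; apply: ler_wpM2l => //; exact: kap_moment.
rewrite (RintegralZl _ mC j6); apply: ler_wpM2l => //.
rewrite (RintegralD mC j5 j4) (RintegralZl _ mC ik) (RintegralZl _ mC j3) (RintegralD mC j1 j2).
rewrite mE /Rintegral phi_mass1 phi_mass2 /=; apply: lerD.
  by rewrite -[leRHS]mulr1; apply: ler_wpM2l; [apply: mulr_ge0 => //; exact: ltW|case/andP: m01].
rewrite -mulrDl.
have -> : 2 * r / (l * e) = (2 * l * e)^-1 * (2 * (2 * r)) by field; rewrite !gt_eqF.
apply: ler_wpM2l.
  by rewrite invr_ge0; apply: mulr_ge0; [apply: mulr_ge0 => //|]; exact: ltW.
apply: ler_wpM2r; [by apply: mulr_ge0 => //; exact: ltW|lra].
Qed.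

End Fixed.
End ApproximateIdentity.

(** * Moving the mollification onto the test function *)

Section FubiniKernel.
Variable R : realType.
Local Notation P2 := (R * R)%type.
Local Notation T2 := (measurableTypeR R * measurableTypeR R)%type.
Variables (r : R) (Om : set P2) (f : P2 -> R).
Hypotheses (r0 : 0 < r) (oO : open Om) (OU : Om `<=` square r).
Hypothesis fint : (@leb2 R).-integrable (Om : set T2) (EFin \o (f : T2 -> R)).
Variables (l B : R) (psi : P2 -> R).
Hypotheses (l0 : 0 < l) (cpsi : continuous psi) (bpsi : forall x, `|psi x| <= B)
  (psi0 : forall x, ~ Om x -> psi x = 0).

(** Extension by zero: Fubini is applied on the whole plane, and psi vanishes off [Om] as well. *)
Let fO : T2 -> R := fun y => (f \_ Om) y.
Let h : T2 * T2 -> \bar R := fun z => (psi z.2 * kap l (sub2 z.2 z.1) * fO z.1)%:E.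

Let mfO : measurable_fun setT fO.
Proof.
have /measurable_EFinP mf := measurable_int (@leb2 R) fint.
exact: ((measurable_restrictT (f : T2 -> R) (open_measurable2 oO)).1 mf).
Qed.

Let mphi : measurable_fun [set: measurableTypeR R] (phi l : measurableTypeR R -> measurableTypeR R).
Proof.
apply: continuous_measurable_fun.
exact: (derive_continuous (fun z => rr3_derive z l0)).
Qed.

Let mh : measurable_fun setT h.
Proof.
apply/measurable_EFinP; apply: measurable_funM; last by apply: (measurableT_comp mfO).
apply: measurable_funM.
  apply: measurableT_comp => //.
  by apply: continuous_measurable2; [exact: openT|move=> x _; exact: cpsi].
apply: measurable_funM; apply: (measurableT_comp mphi); apply: measurable_funB => /=.
- by apply: (measurableT_comp (measurable_fst)); exact: measurable_snd.
- by apply: (measurableT_comp (measurable_fst)); exact: measurable_fst.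
- by apply: (measurableT_comp (measurable_snd)); exact: measurable_snd.
- by apply: (measurableT_comp (measurable_snd)); exact: measurable_fst.
Qed.

Let B0 : 0 <= B. Proof. exact: le_trans (normr_ge0 _) (bpsi (0, 0)). Qed.
Let c : R := (2^-1 * l) * (2^-1 * l).
Let c0 : 0 <= c. Proof. by apply: mulr_ge0; apply: mulr_ge0 => //; exact: ltW. Qed.

Let psi_csq (x : P2) : ~ csq r x -> psi x = 0.
Proof. by move=> nC; apply: psi0 => Ox; apply: nC; exact: (square_csq (OU Ox)). Qed.

Let ipsi : (@leb2 R).-integrable (csq r) (EFin \o (psi : T2 -> R)).
Proof. exact: integrable_csq cpsi (fun x _ => bpsi x). Qed.

Let L : {sigma_finite_measure set T2 -> \bar R} := @leb2 R.

Let ih : (L \x L)%E.-integrable setT h.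
Proof.
apply: ((@integrable21ltyP _ _ T2 T2 R L L h mh).2 _).
have [mf /integrableP[_ N1]] : measurable_fun setT (EFin \o fO) /\ (@leb2 R).-integrable setT (EFin \o fO).
  have i1 : (@leb2 R).-integrable setT (EFin \o fO).
    have := (integrable_mkcond (EFin \o (f : T2 -> R)) (open_measurable2 oO)).1 fint.
    apply: eq_integrable => // y _; rewrite /fO /= !patchE; by case: ifP.
  by split => //; exact: measurable_int i1.
pose N := (\int[@leb2 R]_y `|(fO y)%:E|)%E.
have N0 : (0 <= N)%E by exact: integral_ge0.
have mah : measurable_fun setT (abse \o h) by exact: (measurableT_comp (@abse_measurable R setT) mh).
have mpsi : measurable_fun [set: T2] (psi : T2 -> R).
  by apply: continuous_measurable2; [exact: openT|move=> x _; exact: cpsi].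
(* As [kap] is bounded by c and psi has bounded support, the double integral of |h| is at most c
   times the L1 norms of psi and f. *)
apply: (@le_lt_trans _ _ (\int[@leb2 R]_x ((c * `|psi x|)%:E * N))%E).
  apply: ge0_le_integral; first exact: measurableT.
  - by move=> x _; exact: integral_ge0.
  - apply: (@measurable_fun_fubini_tonelli_G _ _ T2 T2 R L (abse \o h) mah) => z.
    exact: abse_ge0.
  - apply: emeasurable_funM; last exact: measurable_cst.
    by apply/measurable_EFinP; apply: measurable_funM; [exact: measurable_cst|exact: measurableT_comp].
  move=> x _; rewrite -ge0_integralZl//; last 2 first.
  - exact: measurableT_comp.
  - by rewrite lee_fin mulr_ge0.
  apply: ge0_le_integral => //.
  - apply: measurableT_comp => //; apply: (measurableT_comp mh).
    exact: measurable_pair2.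
  - by apply: emeasurable_funM; [exact: measurable_cst|exact: measurableT_comp].
  move=> y _; rewrite /h /= lee_fin normrM; apply: ler_wpM2r => //; rewrite normrM.
  rewrite mulrC; apply: ler_wpM2r; first exact: normr_ge0.
  by rewrite ger0_norm; [exact: kap_le|exact: kap_ge0].
have Nfin : N \is a fin_num by rewrite ge0_fin_numE.
rewrite -(fineK Nfin).
have -> : (\int[@leb2 R]_x ((c * `|psi x|)%:E * (fine N)%:E) =
   \int[@leb2 R]_(x in csq r) ((c * fine N)%:E * `|(psi x)%:E|))%E.
  rewrite [RHS]integral_mkcond; apply: eq_integral => x _; rewrite patchE.
  case: ifPn => [_|/negP nC]; first by rewrite -!EFinM mulrAC.
  by rewrite psi_csq ?normr0 ?mulr0 ?mul0e// => Cx; apply: nC; rewrite inE.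
rewrite ge0_integralZl//; last 3 first.
- exact: measurable_csq.
- by apply: measurableT_comp => //; exact: measurable_int ipsi.
- by rewrite lee_fin mulr_ge0// fine_ge0.
have /integrableP[_ P1] := ipsi.
by apply: lte_mul_pinfty => //; rewrite lee_fin mulr_ge0// fine_ge0.
Qed.

Definition mollified (y : P2) : R := \int[@leb2 R]_(x in csq r) (kap l (sub2 x y) * psi x).

Lemma kap_sm s : sm s (kap l).
Proof. by apply: (@sm_tens R s true (phi l) (phi l)) => k; exact: sm_phi. Qed.

(** f is merely integrable while psi is regular, so the convergence is measured on psi. *)
Lemma convol_kap_fubini :
  (@leb2 R).-integrable (Om : set T2) (fun y : T2 => (f y * mollified y)%:E) /\
  \int[@leb2 R]_(x in (Om : set T2)) (convol Om f (kap l) x * psi x) =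
  \int[@leb2 R]_(y in (Om : set T2)) (f y * mollified y).
Proof.
have mO := open_measurable2 oO; have mC := @measurable_csq R r.
have FE x : fubini_G (@leb2 R) h x = ((fun x => (convol Om f (kap l) x * psi x)%:E) \_ (Om : set T2)) x.
  rewrite patchE; case: ifPn => [|/negP nO]; last first.
    rewrite /fubini_G integral0_eq// => y _; rewrite /h /= psi0 ?mul0r// => Ox.
    by apply: nO; rewrite inE.
  rewrite inE => Ox.
  have ic := convol_integrable r0 oO OU fint (kap_sm (2 * r)) (OU Ox).
  rewrite EFinM muleC /convol /Rintegral fineK; last exact: integrable_fin_num.
  rewrite -integralZl// integral_mkcond /fubini_G; apply: eq_integral => y _.
  rewrite /h /fO /= !patchE; case: ifP => _; last by rewrite mulr0.
  by rewrite -EFinM; congr (_%:E); ring.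
have GE y : fubini_F (@leb2 R) h y = ((fun y => (f y * mollified y)%:E) \_ (Om : set T2)) y.
  rewrite patchE; case: ifPn => [|/negP nO]; last first.
    rewrite /fubini_F integral0_eq// => x _; rewrite /h /fO /= patchE.
    by case: ifPn => [Oy|_]; [case: (nO Oy)|rewrite mulr0].
  rewrite inE => Oy.
  have ikp : (@leb2 R).-integrable (csq r) (fun x : T2 => (kap l (sub2 x y) * psi x)%:E).
    apply: (@integrable_csq R r (c * B) (fun x => kap l (sub2 x y) * psi x)).
      by move=> x; exact: (continuousM (kap_continuous l0 (y := y) (x := x)) (cpsi (x := x))).
    move=> x _; rewrite normrM; apply: ler_pM => //.
    by rewrite ger0_norm; [exact: kap_le|exact: kap_ge0].
  rewrite EFinM /mollified /Rintegral fineK; last exact: integrable_fin_num.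
  rewrite -integralZl// [RHS]integral_mkcond /fubini_F; apply: eq_integral => x _.
  rewrite /h /fO /= !patchE mem_set//.
  case: ifPn => [_|/negP nC]; first by rewrite -EFinM; congr (_%:E); ring.
  by rewrite psi_csq ?mul0r// => Cx; apply: nC; rewrite inE.
split.
  apply/(integrable_mkcond _ mO).
  by apply: eq_integrable (integrable_fubini_F ih) => // y _; rewrite GE.
rewrite /Rintegral; congr fine; rewrite integral_mkcond [RHS]integral_mkcond.
under eq_integral do rewrite -FE.
under [RHS]eq_integral do rewrite -GE.
by rewrite (integral21_prod_meas1 ih) -(integral12_prod_meas1 ih).
Qed.

End FubiniKernel.

(** * Weak convergence of the primitives to the right-hand side *)

Section WeakLimit.
Variable R : realType.
Local Notation P2 := (R * R)%type.
Local Notation T2 := (measurableTypeR R * measurableTypeR R)%type.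
Variables (r : R) (Om : set P2) (f : P2 -> R).
Hypotheses (r0 : 0 < r) (oO : open Om) (OU2 : Om `<=` square (r / 2)).
Hypothesis fint : (@leb2 R).-integrable (Om : set T2) (EFin \o (f : T2 -> R)).
Hypothesis f32 : (@leb2 R).-integrable (Om : set T2) (fun y : T2 => (`|f y| * Num.sqrt `|f y|)%:E).
Variable T : R.
Hypothesis T2le : 2 <= T.
Local Notation S := (T ^+ 3).
Local Notation aa := (aa Om f T).
Local Notation bb := (bb Om f T).

Lemma subr_square : Om `<=` square r.
Proof.
move=> x /OU2[h1 h2]; have h : r / 2 <= r by rewrite ler_pdivrMr// mulr2n mulrDr mulr1 lerDl ltW.
by split; [exact: lt_le_trans h1 h|exact: lt_le_trans h2 h].
Qed.
Let OU := subr_square.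

Lemma test_integrable (phi g : P2 -> R) (s : seq bool) : test_function Om phi -> sm r g ->
  (@leb2 R).-integrable (Om : set T2) (fun x : T2 => (g x * foldr (@pd R) phi s x)%:E).
Proof.
move=> /test_deriv[K [cK KO] /(_ s)[h1 h2 h3 [M h4]]] sg.
have [G hG] := sg.
apply: (@integrable_bounded2 R Om r (fun x => g x * foldr (@pd R) phi s x) (G 0%N * M) oO OU).
  by move=> x Ox; exact: (continuousM (sm_continuous sg (OU Ox)) (h2 x)).
by move=> x Ox; rewrite normrM; apply: ler_pM => //; exact: (bnd_norm (hG 0%N) (OU Ox)).
Qed.

Lemma ibp2 (phi g : P2 -> R) (k : bool) : test_function Om phi -> sm r g ->
  zint Om (fun x => g x * pd k (pd k phi) x - pd k (pd k g) x * phi x).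
Proof.
move=> hphi sg; have h1 := ibp_test r0 oO OU k [:: k] hphi sg.
have h2 := ibp_test r0 oO OU k [::] hphi (sm_pd k sg).
have alg (a b c d p q : R) : (b * p + a * c) + - (d * q + b * p) = a * c - d * q by ring.
by apply: (zint_eq oO _ (zintD oO h1 (zintN oO h2))) => x _; exact: alg.
Qed.

Lemma zint_Rintegral (g : P2 -> R) : zint Om g ->
  \int[@leb2 R]_(x in (Om : set T2)) g x = 0.
Proof. by move=> [_ h]; rewrite /Rintegral h. Qed.

Lemma hessian_primitives (phi : P2 -> R) j : test_function Om phi ->
  \int[@leb2 R]_(x in (Om : set T2)) (aa j x * pd2 (pd2 phi) x + bb j x * pd1 (pd1 phi) x) =
  - \int[@leb2 R]_(x in (Om : set T2)) (convol Om f (kap (S ^+ j)) x * phi x).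
Proof.
move=> hphi; have [M _ hM] := cls_aa_bb r0 oO OU fint f32 T2le.
have sa := sm_cls (hM j).1; have sb := sm_cls (hM j).2.
have mO := open_measurable2 oO.
have iA := test_integrable [:: true; true] hphi sa.
have iB := test_integrable [:: false; false] hphi sb.
have iAB := integrableD mO iA iB.
have alg (a b c d p q q' : R) : (a * c - p * q) + (b * d - q' * q) = a * c + b * d + - (p + q') * q by ring.
have z : zint Om (fun x => aa j x * pd2 (pd2 phi) x + bb j x * pd1 (pd1 phi) x +
    convol Om f (kap (S ^+ j)) x * phi x).
  apply: (zint_eq oO _ (zintD oO (ibp2 true hphi sa) (ibp2 false hphi sb))) => x Ox.
  have e := curl_aa_bb r0 oO OU fint f32 T2le j (OU Ox).
  have -> : convol Om f (kap (S ^+ j)) x = - (pd true (pd true (aa j)) x + pd false (pd false (bb j)) x).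
    by rewrite e opprK.
  exact: alg.
have iC : (@leb2 R).-integrable (Om : set T2) (fun x : T2 => (convol Om f (kap (S ^+ j)) x * phi x)%:E).
  have h := integrableB mO z.1 iAB.
  apply: eq_integrable h => // x _ /=.
  by rewrite -EFinD; congr (_%:E); rewrite addrAC subrr add0r.
have := zint_Rintegral z; rewrite (RintegralD mO iAB iC) => h.
by apply/eqP; rewrite -addr_eq0 h.
Qed.

(** By [hessian_primitives] and Fubini the quantity is the integral of f times phi minus mollified
    phi, at most the L1 norm of f times an error that is uniform on [Om]. *)
Lemma weak_limit (phi : P2 -> R) (e : R) : test_function Om phi -> 0 < e ->
  exists J, forall j, (J <= j)%N ->
  `| \int[@leb2 R]_(x in (Om : set T2)) (aa j x * pd2 (pd2 phi) x + bb j x * pd1 (pd1 phi) x)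
    + \int[@leb2 R]_(x in (Om : set T2)) (f x * phi x) | <= e.
Proof.
move=> hphi e0; have mO := open_measurable2 oO.
have [K [cK KO] hs] := test_deriv hphi.
have [h1 h2 h3 [B h4]] := hs [::].
have [_ _ _ [Q1 k1]] := hs [:: false]; have [_ _ _ [Q2 k2]] := hs [:: true].
pose Q := Num.max Q1 Q2.
have kQ i x : `|pd i phi x| <= Q.
  by rewrite /Q le_max; case: i; [rewrite (k2 x) orbT|rewrite (k1 x)].
have Q0 : 0 <= Q by exact: le_trans (normr_ge0 _) (kQ true (0, 0)).
have B0 : 0 <= B by exact: le_trans (normr_ge0 _) (h4 (0, 0)).
have lip x y : csq r x -> Om y -> `|phi x - phi y| <= Q * (`|x.1 - y.1| + `|x.2 - y.2|).
  move=> [/= x1 x2] Oy; apply: (@lipschitz_square R (2 * r) phi Q) => //.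
    move: x1 x2; rewrite !in_itv /= -!ler_norml => x1 x2.
    by split; [apply: le_lt_trans x1 _|apply: le_lt_trans x2 _]; rewrite mulr2n mulrDl mul1r ltrDl.
  have [y1 y2] := OU Oy.
  by split; [apply: lt_trans y1 _|apply: lt_trans y2 _]; rewrite mulr2n mulrDl mul1r ltrDl.
have phi0 x : ~ Om x -> phi x = 0 by move=> nO; apply: h3 => Kx; apply: nO; exact: KO.
pose D := \int[@leb2 R]_(x in (Om : set T2)) `|f x|.
have D0 : 0 <= D by exact: Rintegral_ge0.
pose W := D + 1; have W0 : 0 < W by rewrite ltr_wpDl.
have eW : 0 < e / W by exact: divr_gt0.
have [e1 [m [e10 m0 hm]]] := mollification_scale r0 Q0 B0 eW.
have [J hJ] := half_small m (@ltr01 R).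
exists J => j Jj; set l := S ^+ j.
have S2 : 2 <= S.
  apply: le_trans T2le _; rewrite exprS ler_peMr//; first exact: le_trans T2le.
  by rewrite exprn_ege1// (le_trans _ T2le)// ler1n.
have l2 : 2 ^+ J <= l.
  apply: (@le_trans _ _ (2 ^+ j)); first by rewrite ler_eXn2l// ltr1n.
  by rewrite lerXn2r ?nnegrE// (le_trans _ S2).
have l0 : 0 < l by apply: lt_le_trans l2; rewrite exprn_gt0.
have ml : m <= l.
  by apply: le_trans l2; move: hJ; rewrite ltr_pdivrMr ?mul1r ?exprn_gt0// => /ltW.
have [lr be] := hm l ml.
have [iM eM] := convol_kap_fubini r0 oO OU fint l0 h2 h4 phi0.
rewrite hessian_primitives// -/l eM.
have ip : (@leb2 R).-integrable (Om : set T2) (fun y : T2 => (f y * phi y)%:E).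
  apply: (@integrableMl _ T2 R (@leb2 R) (Om : set T2) mO
    (EFin \o (f : T2 -> R)) (phi : T2 -> R)); first exact: fint.
    by apply: continuous_measurable2 => // x _; exact: h2.
  by exists B; split; rewrite ?num_real// => M' MM' x Ox; exact: le_trans (h4 _) (ltW MM').
rewrite addrC -(RintegralB mO ip iM).
have iB := integrableB mO ip iM.
apply: le_trans (le_normr_Rintegral mO iB) _.
pose b := Q * (2 * e1 + 2 * r / (l * e1)) + B * (4 / (l * r)).
have ifn := @integrable_norm _ _ _ (@leb2 R) (Om : set T2) _ fint.
have ifb := @integrableZl _ _ _ (@leb2 R) (Om : set T2) mO b _ ifn.
have lrp : 0 < l * r by exact: mulr_gt0.
have lep : 0 < l * e1 by exact: mulr_gt0.
have b0 : 0 <= b.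
  rewrite /b; apply: addr_ge0; apply: mulr_ge0 => //; last by apply: divr_ge0 => //; exact: ltW.
  apply: addr_ge0; first by apply: mulr_ge0 => //; exact: ltW.
  by apply: divr_ge0; [apply: mulr_ge0 => //|]; exact: ltW.
apply: (@le_trans _ _ (\int[@leb2 R]_(x in (Om : set T2)) (b * `|f x|))).
  apply: le_Rintegral => //; first exact: (@integrable_norm _ _ _ (@leb2 R) (Om : set T2) _ iB).
  move=> y Oy; rewrite -mulrBr normrM mulrC; apply: ler_wpM2r => //.
  rewrite distrC; apply: (approximate_identity l0 r0 lr h2 (fun x _ => h4 x) Q0 _ (OU2 Oy) e10).
  by move=> x Cx; exact: lip.
rewrite (RintegralZl _ mO ifn) -/D.
have DW : D <= W by rewrite lerDl.
apply: (@le_trans _ _ (b * W)); first exact: ler_wpM2l.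
by rewrite -ler_pdivlMr.
Qed.

End WeakLimit.

(** * Smooth approximation of the initial datum *)

Section McShane.
Variable R : realType.
Local Notation P2 := (R * R)%type.
Implicit Types (C : set P2) (v : P2 -> R).

Definition dist1 (x y : P2) : R := `|x.1 - y.1| + `|x.2 - y.2|.

Lemma dist1_ge0 x y : 0 <= dist1 x y. Proof. exact: addr_ge0. Qed.

Lemma dist1_triangle x y z : dist1 x z <= dist1 x y + dist1 y z.
Proof.
rewrite /dist1 addrACA; apply: lerD.
  by rewrite (le_trans _ (ler_normD _ _))// addrA subrK.
by rewrite (le_trans _ (ler_normD _ _))// addrA subrK.
Qed.

Lemma within_continuous_eps C v (x : P2) : {within C, continuous v} -> C x ->
  forall e, 0 < e -> exists2 d, 0 < d & forall z, C z -> dist1 x z < d -> `|v x - v z| < e.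
Proof.
move=> /subspace_continuousP cv Cx e e0.
have /cvgrPdist_lt/(_ e e0) := cv x Cx.
rewrite /within /= => /nbhs_ballP[d /= d0 H]; exists d => // z Cz hz.
apply: H => //; split; rewrite /ball /=; apply: le_lt_trans hz.
  by rewrite /dist1 lerDl.
by rewrite /dist1 lerDr.
Qed.

Lemma uniform_modulus C v (e : R) : compact C -> {within C, continuous v} -> 0 < e ->
  exists2 d, 0 < d & forall x z, C x -> C z -> dist1 x z < d -> `|v x - v z| < e.
Proof.
move=> cC cv e0.
have /near_covering_withinP ncC := (compact_near_coveringP C).1 cC.
have := ncC R (nbhs (0 : R)) (fun d x => forall z, C z -> dist1 x z < d -> `|v x - v z| < e) _ _.
case=> [x Cx|d /= d0 H].
  have e2 : 0 < e / 2 by rewrite divr_gt0.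
  have [d d0 hd] := within_continuous_eps cv Cx e2.
  have d2 : 0 < d / 4 by rewrite divr_gt0.
  exists (ball x (d / 4), ball (0 : R) (d / 4)); first by split; exact: nbhsx_ballx.
  case=> y t [/= [y1 y2] ht] Cy z Cz hz.
  have td : t < d / 4 by move: ht; rewrite /ball /= sub0r normrN; apply: le_lt_trans; exact: ler_norm.
  have xy : dist1 x y < d / 2.
    have -> : d / 2 = d / 4 + d / 4 by field.
    by rewrite /dist1; apply: ltrD.
  have h1 : `|v x - v y| < e / 2 by apply: hd => //; apply: lt_trans xy _; lra.
  have h2 : `|v x - v z| < e / 2.
    by apply: hd => //; apply: le_lt_trans (dist1_triangle x y z) _; lra.
  rewrite (_ : v y - v z = (v x - v z) - (v x - v y)); last by ring.
  by apply: le_lt_trans (ler_normB _ _) _; rewrite [ltRHS](splitr e); exact: ltrD.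
exists (d / 2); first by rewrite divr_gt0.
move=> x z Cx Cz; apply: (H (d / 2)) => //.
rewrite /ball /= sub0r normrN ger0_norm; last by rewrite ltW// divr_gt0.
by rewrite ltr_pdivrMr// mulr2n mulrDr mulr1 ltrDl.
Qed.

Lemma compact_bound C v : compact C -> {within C, continuous v} ->
  exists2 B, 0 <= B & forall x, C x -> `|v x| <= B.
Proof.
move=> cC cv; have [M [_ HM]] : bounded_set (v @` C).
  by apply: compact_bounded; exact: continuous_compact.
exists (`|M| + 1); first exact: addr_ge0.
move=> x Cx; apply: HM; last by exists x.
by rewrite (le_lt_trans (ler_norm M))// ltrDl.
Qed.

(** The infimum over y in C of v y + Q dist1 x y is Q-Lipschitz on the whole plane and at most v on
    C. *)
Lemma mcshane C v (e : R) : compact C -> C !=set0 -> {within C, continuous v} -> 0 < e ->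
  exists psi, exists2 Q, 0 <= Q &
    (forall x y, `|psi x - psi y| <= Q * dist1 x y) /\ (forall x, C x -> `|v x - psi x| <= e).
Proof.
move=> cC [x0 Cx0] cv e0.
have [B B0 hB] := compact_bound cC cv.
have [d d0 hd] := uniform_modulus cC cv e0.
(* With this slope a point at distance at least d pays 2 B, the largest possible oscillation of v,
   so only points within the modulus of continuity compete. *)
pose Q := 2 * B / d.
have Q0 : 0 <= Q by rewrite divr_ge0 ?mulr_ge0// ltW.
pose A x := [set v y + Q * dist1 x y | y in C].
have Alb x : has_inf (A x).
  split; first by exists (v x0 + Q * dist1 x x0); exists x0.
  exists (- B) => _ [y Cy <-]; have := hB y Cy; rewrite ler_norml => /andP[h _].
  by rewrite -[- B]addr0; apply: lerD => //; rewrite mulr_ge0// dist1_ge0.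
pose psi x := inf (A x).
have P1 x y : C y -> psi x <= v y + Q * dist1 x y.
  by move=> Cy; apply: ge_inf; [case: (Alb x)|exists y].
have P2' x m : (forall y, C y -> m <= v y + Q * dist1 x y) -> m <= psi x.
  by move=> h; apply: lb_le_inf; [case: (Alb x)|move=> _ [y Cy <-]; exact: h].
have L x y : psi x - psi y <= Q * dist1 x y.
  rewrite lerBlDr addrC -lerBlDr; apply: P2' => z Cz.
  rewrite lerBlDr -addrA -mulrDr; apply: le_trans (P1 x z Cz) _.
  by rewrite lerD2l; apply: ler_wpM2l => //; rewrite addrC; exact: dist1_triangle.
exists psi, Q => //; split.
  move=> x y; rewrite ler_norml L andbT lerNl opprB.
  by rewrite /dist1 (distrC x.1) (distrC x.2); exact: L.
move=> x Cx.
have h1 : psi x <= v x by have := P1 x x Cx; rewrite /dist1 !subrr normr0 addr0 mulr0 addr0.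
have h2 : v x - e <= psi x.
  apply: P2' => y Cy.
  have [h|h] := ltP (dist1 x y) d.
    have := hd x y Cx Cy h; rewrite ltr_norml => /andP[_ k].
    have : 0 <= Q * dist1 x y by rewrite mulr_ge0// dist1_ge0.
    lra.
  have k : 2 * B <= Q * dist1 x y.
    by rewrite /Q -mulrA -[leLHS]mulr1; apply: ler_wpM2l; [rewrite mulr_ge0|rewrite mulrC ler_pdivlMr// mul1r].
  have := hB x Cx; have := hB y Cy; rewrite !ler_norml => /andP[? _] /andP[_ ?].
  lra.
by rewrite ger0_norm ?subr_ge0//; lra.
Qed.

End McShane.

Section SmoothApproximation.
Variable R : realType.
Local Notation P2 := (R * R)%type.
Local Notation T2 := (measurableTypeR R * measurableTypeR R)%type.

Lemma squareS (r s : R) : r <= s -> square r `<=` square s.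
Proof. by move=> rs x [h1 h2]; split; [exact: lt_le_trans h1 rs|exact: lt_le_trans h2 rs]. Qed.

Lemma bndS (r s : R) n G (f : P2 -> R) : r <= s -> bnd s n G f -> bnd r n G f.
Proof.
move=> rs; elim: n G f => [|n IH] G f [h1 h2]; split.
- by move=> x /(squareS rs); exact: h1.
- by [].
- by move=> x /(squareS rs); exact: h1.
case: h2 => h2 h3; split; first by move=> x /(squareS rs); exact: h2.
by move=> i; apply: IH; exact: h3.
Qed.

Definition gkap (l : R) : P2 -> R := fun z => ((2^-1 * l) * (2^-1 * l)) *
  ((along false (rr l) z * along false (rr l) z) * (along true (rr l) z * along true (rr l) z)).

Lemma kap_ker l z : kap l z = ker l l z * gkap l z.
Proof. by rewrite /kap /phi /ker /gkap /along /=; ring. Qed.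

Lemma cls_gkap (s l : R) : 0 < l -> exists2 M, 0 <= M & cls s M (9 * l) (gkap l).
Proof.
move=> l0; have L0 : 0 <= 9 * l by rewrite mulr_ge0// ltW.
have c1 := @cls_rr R s l (9 * l) false l0 (lexx _).
have c2 := @cls_rr R s l (9 * l) true l0 (lexx _).
have n3 : 0 <= 3 * 1 * 1 :> R by rewrite !mulr_ge0.
have := clsZ ((2^-1 * l) * (2^-1 * l)) (clsM n3 n3 L0 (clsM ler01 ler01 L0 c1 c1) (clsM ler01 ler01 L0 c2 c2)).
by move=> h; eexists; last exact: h; apply: mulr_ge0 => //; apply: mulr_ge0 => //; apply: mulr_ge0.
Qed.

Lemma kap_even (l : R) (x y : P2) : kap l (sub2 x y) = kap l (sub2 y x).
Proof.
have E z : phi l (- z) = phi l z by rewrite /phi /rr /ee mulrN sqrrN.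
by rewrite /kap /= -(opprB y.1) E -(opprB y.2) E.
Qed.

(** The convolution results are reused with psi cut off to [csq r] in the role of f. The output has
    to lie in a class [cls r M L], because the starting frequency of the iteration is later chosen
    above a multiple of L. *)
Lemma smooth_approximation (r e : R) (C : set P2) (v : P2 -> R) :
  0 < r -> 0 < e -> compact C -> C !=set0 -> C `<=` square (r / 2) ->
  {within C, continuous v} ->
  exists V M L, [/\ 0 <= M, 0 <= L, cls r M L V & forall x, C x -> `|v x - V x| <= e].
Proof.
move=> r0 e0 cC C0 CU cv; have e2 : 0 < e / 2 by rewrite divr_gt0.
have [psi [Q Q0 [lip vpsi]]] := mcshane cC C0 cv e2.
pose B := `|psi (0, 0)| + Q * (2 * r).
have B0 : 0 <= B by apply: addr_ge0 => //; apply: mulr_ge0 => //; apply: mulr_ge0 => //; exact: ltW.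
have bpsi x : csq r x -> `|psi x| <= B.
  move=> [/=]; rewrite !in_itv /= -!ler_norml => x1 x2.
  rewrite -(subrK (psi (0, 0)) (psi x)) /B addrC.
  apply: le_trans (ler_normD _ _) _; rewrite lerD2l; apply: le_trans (lip _ _) _.
  by apply: ler_wpM2l => //; rewrite /dist1 /= !subr0 mulr2n mulrDl mul1r; exact: lerD.
have cpsi : continuous psi.
  move=> x; pose s := `|x.1| + `|x.2| + 1.
  have Ux : square s x.
    by split; rewrite /s -addrA; [rewrite ltrDl|rewrite addrCA ltrDl]; rewrite ltr_wpDl.
  apply: (@lipschitz_continuous R s psi Q x Ux) => y z _ _; exact: lip.
have [e1 [l [e10 l0 hl]]] := mollification_scale r0 Q0 B0 e2.
have [lr hb] := hl l (lexx _).
have r20 : 0 < 2 * r by rewrite mulr_gt0.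
have rr2 : r <= 2 * r by rewrite mulr2n mulrDl mul1r lerDl ltW.
have oS := @square_open R (2 * r); have mS := open_measurable2 oS.
have mC := @measurable_csq R r.
have CS : csq r `<=` (square (2 * r) : set T2).
  move=> x [/=]; rewrite !in_itv /= -!ler_norml => x1 x2.
  by split; [apply: le_lt_trans x1 _|apply: le_lt_trans x2 _]; rewrite mulr2n mulrDl mul1r ltrDl.
pose f : P2 -> R := fun y => ((psi : T2 -> R) \_ (csq r)) y.
have fint : (@leb2 R).-integrable (square (2 * r) : set T2) (EFin \o (f : T2 -> R)).
  have h := (integrable_mkcond (EFin \o (psi : T2 -> R)) mC).1 (integrable_csq cpsi bpsi).
  have h2 := integrableS measurableT mS (@subsetT _ _) h.
  apply: eq_integrable h2; first exact: mS.
  by move=> y _; rewrite /f /= !patchE; case: ifP.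
pose V := convol (square (2 * r)) f (kap l).
have [M M0 hM] := cls_gkap (2 * (2 * r)) l0.
pose I := \int[@leb2 R]_(y in (square (2 * r) : set T2)) `|f y|.
have I0 : 0 <= I by exact: Rintegral_ge0.
have hI x : square (2 * r) x ->
    \int[@leb2 R]_(y in (square (2 * r) : set T2)) (`|f y| * ker l l (sub2 x y)) <= I.
  move=> Ux; have ifn := @integrable_norm _ _ _ (@leb2 R) (square (2 * r) : set T2) _ fint.
  have kb y := ker_bnd (sub2 x y) l0 l0.
  apply: le_Rintegral => //.
    have ik := convol_integrable r20 oS (fun y h => h) fint (ker_sm (2 * (2 * r)) l0 l0) Ux.
    have h := @integrable_norm _ _ _ (@leb2 R) (square (2 * r) : set T2) _ ik.
    apply: eq_integrable h; first exact: mS.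
    by move=> y _ /=; rewrite normrM; case/andP: (kb y) => k1 k2; rewrite (ger0_norm k1).
  by move=> y _; rewrite -[leRHS]mulr1; apply: ler_wpM2l => //; case/andP: (kb y).
have L9 : 9 * l <= 9 * l by [].
have cV : cls (2 * r) (I * M) (4 * (9 * l)) V.
  have := cls_convol r20 oS (fun y h => h) fint l0 l0 M0 I0 L9 L9 hI hM.
  apply: cls_eq => y Uy; apply: (convol_eq (r := 2 * r)) => // z _.
  by rewrite -kap_ker.
have IM : 0 <= I * M by exact: mulr_ge0.
exists V, (I * M), (4 * (9 * l)); split => //.
- by do ?apply: mulr_ge0 => //; exact: ltW.
- by move=> n; exact: bndS rr2 (cV n).
move=> x Cx; have Ux := CU x Cx.
have VE : V x = \int[@leb2 R]_(y in csq r) (kap l (sub2 y x) * psi y).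
  rewrite /V /convol Rintegral_mkcond [RHS]Rintegral_mkcond; apply: eq_Rintegral => y _.
  rewrite !patchE /f patchE; case: ifPn => [_|/negP nS].
    by case: ifP => _; [rewrite kap_even mulrC|rewrite mul0r].
  by case: ifPn => // hC; case: nS; rewrite inE; apply: CS; rewrite inE in hC.
have A : `|V x - psi x| <= e / 2.
  rewrite VE; apply: le_trans hb.
  apply: (approximate_identity l0 r0 lr cpsi bpsi Q0 _ Ux e10).
  by move=> y _; exact: lip.
rewrite (_ : v x - V x = (v x - psi x) - (V x - psi x)); last by ring.
apply: le_trans (ler_normB _ _) _; rewrite [leRHS](splitr e); apply: lerD => //.
exact: vpsi.
Qed.

End SmoothApproximation.

(** * The limit equation *)

Section LimitEquation.
Variable R : realType.
Local Notation P2 := (R * R)%type.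
Local Notation T2 := (measurableTypeR R * measurableTypeR R)%type.
Variables (r : R) (Om : set P2) (f : P2 -> R).
Hypotheses (r0 : 0 < r) (oO : open Om) (OU2 : Om `<=` square (r / 2)).
Hypothesis fint : (@leb2 R).-integrable (Om : set T2) (EFin \o (f : T2 -> R)).
Hypothesis f32 : (@leb2 R).-integrable (Om : set T2) (fun y : T2 => (`|f y| * Num.sqrt `|f y|)%:E).
Let OU : Om `<=` square r. Proof. exact: subr_square. Qed.
Local Notation U := (square r).

Lemma Rintegral_bound (g : P2 -> R) (c : R) :
  (@leb2 R).-integrable (Om : set T2) (EFin \o (g : T2 -> R)) ->
  (forall x, Om x -> `|g x| <= c) ->
  `| \int[@leb2 R]_(x in (Om : set T2)) g x | <= c * fine (@leb2 R (Om : set T2)).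
Proof.
move=> ig gc; have mO := open_measurable2 oO.
apply: le_trans (le_normr_Rintegral mO ig) _.
rewrite -(Rintegral_cst _ mO); apply: le_Rintegral => //.
  exact: (@integrable_norm _ _ _ (@leb2 R) (Om : set T2) _ ig).
apply: (@integrable_bounded2 R Om r (fun=> c) `|c| oO OU) => // x _.
exact: cvg_cst.
Qed.

Lemma uniform_limit_continuous (u : nat -> P2 -> R) (w : P2 -> R) (K : R) (x : P2) :
  (forall n y, U y -> {for y, continuous (u n)}) ->
  (forall n y, U y -> `|u n y - w y| <= K / 2 ^+ n) -> U x -> {for x, continuous w}.
Proof.
move=> cu hu Ux; apply/cvgrPdist_lt => e e0.
have e3 : 0 < e / 3 by rewrite divr_gt0.
have [n hn] := half_small K e3.
have /cvgrPdist_lt/(_ _ e3) hc := cu n x Ux.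
have hU : nbhs x U by apply: open_nbhs_nbhs; split => //; exact: square_open.
apply: filterS2 hU hc => y Uy hy.
have h1 := le_lt_trans (hu n x Ux) hn; have h2 := le_lt_trans (hu n y Uy) hn.
rewrite (_ : w x - w y = (u n x - u n y) + ((u n y - w y) - (u n x - w x))); last by ring.
apply: le_lt_trans (ler_normD _ _) _; have -> : e = e / 3 + (e / 3 + e / 3) by field.
apply: ltrD => //; apply: le_lt_trans (ler_normB _ _) _; exact: ltrD.
Qed.

Lemma quadratic_diff (a b a' b' C d : R) : `|a| <= C -> `|b'| <= C + d ->
  `|a' - a| <= d -> `|b' - b| <= d -> `|a * b - a' * b'| <= (2 * C + d) * d.
Proof.
move=> ha hb' da db.
rewrite (_ : a * b - a' * b' = - (a * (b' - b)) - (a' - a) * b'); last by ring.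
apply: le_trans (ler_normB _ _) _; rewrite normrN !normrM.
have -> : (2 * C + d) * d = C * d + d * (C + d) by ring.
by apply: lerD; apply: ler_pM.
Qed.

Lemma half_sqr_bound (a p N B : R) : `|a| <= N -> `|p| <= B ->
  `|2^-1 * a ^+ 2 * p| <= 2^-1 * N ^+ 2 * B.
Proof.
move=> ha hp; rewrite (normrM (2^-1 * a ^+ 2) p) (normrM 2^-1 (a ^+ 2)) normrX.
have n2 : 0 <= 2^-1 :> R by [].
have q : `|a| ^+ 2 <= N ^+ 2 by rewrite lerXn2r ?nnegrE// (le_trans _ ha).
rewrite (ger0_norm n2); apply: ler_pM => //.
exact: ler_wpM2l.
Qed.

Lemma state_alg (a b c1 c2 c3 p q p' q' X Y Z : R) : p' = p -> q' = q ->
  (a + 0 - 2^-1 * (p' * p') - (c1 + c3)) * X - 2 * (0 - 2^-1 * (p' * q') - c3) * Y +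
  (b + 0 - 2^-1 * (q' * q') - (c2 + c3)) * Z =
  (a * X + b * Z + (p * q * Y - 2^-1 * p ^+ 2 * X - 2^-1 * q ^+ 2 * Z)) -
  ((c1 + c3) * X - 2 * c3 * Y + (c2 + c3) * Z).
Proof. by move=> -> ->; field. Qed.

Lemma correction_bound (c1 c2 c3 X Y Z d B : R) : `|c1| <= d -> `|c2| <= d -> `|c3| <= d ->
  `|X| <= B -> `|Y| <= B -> `|Z| <= B ->
  `|(c1 + c3) * X - 2 * c3 * Y + (c2 + c3) * Z| <= 6 * d * B.
Proof.
move=> h1 h2 h3 hX hY hZ.
have -> : 6 * d * B = ((d + d) * B + (2 * d) * B) + (d + d) * B by ring.
apply: le_trans (ler_normD _ _) _; apply: lerD.
  apply: le_trans (ler_normB _ _) _; apply: lerD.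
    rewrite normrM; apply: ler_pM => //.
    by apply: le_trans (ler_normD _ _) _; exact: lerD.
  rewrite normrM (normrM 2) (ger0_norm (ler0n _ _)); apply: ler_pM => //.
  exact: ler_wpM2l.
rewrite normrM; apply: ler_pM => //.
by apply: le_trans (ler_normD _ _) _; exact: lerD.
Qed.

Lemma hessian_diff_bound (a b a' b' X Y Z m B : R) :
  `|a * b - a' * b'| <= m -> `|a * a - a' * a'| <= m -> `|b * b - b' * b'| <= m ->
  `|X| <= B -> `|Y| <= B -> `|Z| <= B ->
  `|(a * b * Y - 2^-1 * a ^+ 2 * X - 2^-1 * b ^+ 2 * Z) -
    (a' * b' * Y - 2^-1 * a' ^+ 2 * X - 2^-1 * b' ^+ 2 * Z)| <= 2 * m * B.
Proof.
move=> h1 h2 h3 hX hY hZ.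
rewrite (_ : _ - _ = (a * b - a' * b') * Y - 2^-1 * ((a * a - a' * a') * X)
  - 2^-1 * ((b * b - b' * b') * Z)); last by field.
have n2 : 0 <= 2^-1 :> R by [].
have -> : 2 * m * B = (m * B + 2^-1 * (m * B)) + 2^-1 * (m * B) by field.
have H u w : `|u| <= m -> `|w| <= B -> `|u * w| <= m * B.
  by move=> hu hw; rewrite normrM; apply: ler_pM.
apply: le_trans (ler_normB _ _) _; apply: lerD.
  apply: le_trans (ler_normB _ _) _; apply: lerD; first exact: H.
  by rewrite (normrM 2^-1) (ger0_norm n2); apply: ler_wpM2l => //; exact: H.
by rewrite (normrM 2^-1) (ger0_norm n2); apply: ler_wpM2l => //; exact: H.
Qed.

Lemma norm_perturb (a b C d : R) : `|b| <= C -> `|a - b| <= d -> `|a| <= C + d.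
Proof.
by move=> hb hab; rewrite -(subrK b a) addrC; apply: le_trans (ler_normD _ _) _; exact: lerD.
Qed.

Lemma combine_bounds (IV Iv IC IA IP e z1 z2 : R) : `|IV - Iv| <= z1 -> `|IC| <= z2 ->
  `|IA + IP| <= e / 2 -> IA + Iv = IC -> z1 + z2 <= e / 2 -> `|IV - IP| <= e.
Proof.
move=> h1 h2 h3 h z.
rewrite (_ : IV - IP = (IV - Iv) + IC - (IA + IP)); last by rewrite -h; ring.
apply: le_trans (ler_normB _ _) _; rewrite [leRHS](splitr e); apply: lerD => //.
by apply: le_trans (ler_normD _ _) _; apply: le_trans z; exact: lerD.
Qed.

Variable T : R.
Hypothesis T2le : 2 <= T.
Local Notation aa := (aa Om f T).
Local Notation bb := (bb Om f T).

(** At stage n the state, tested against phi, is an exact identity between the primitives, the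
    quadratic expression in grad v_n and the coefficients. The primitives tend to minus the integral
    of f phi, the quadratic part converges because gradients converge uniformly, and the
    coefficients are O(2^-n). *)
Lemma very_weak_limit (V : P2 -> R) (v c1 c2 c3 : nat -> P2 -> R) (idx : nat -> nat) (C K : R) :
  0 <= C -> 0 <= K -> (forall n, sm r (v n)) ->
  (forall k n x, U x -> `|pd k (v n) x - pd k V x| <= K / 2 ^+ n) ->
  (forall k x, U x -> `|pd k V x| <= C) ->
  (forall n x, U x -> [/\ `|c1 n x| <= K / 2 ^+ n, `|c2 n x| <= K / 2 ^+ n & `|c3 n x| <= K / 2 ^+ n]) ->
  (forall n, [/\ sm r (c1 n), sm r (c2 n) & sm r (c3 n)]) ->
  (forall n, (n <= idx n)%N) ->
  (forall n, state r (fr0 (R := R)) (aa (idx n)) (bb (idx n)) (fun=> 0) (v n) (c1 n) (c2 n) (c3 n)) ->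
  very_weak_hessian_eq Om V f.
Proof.
move=> C0 K0 sv dv dV hc sc hidx hst phi hphi; have mO := open_measurable2 oO.
have [M _ hM] := cls_aa_bb r0 oO OU fint f32 T2le.
have [Ks [cK KO] hs] := test_deriv hphi.
have [_ p11c _ [B1 b1]] := hs [:: false; false].
have [_ p21c _ [B2 b2]] := hs [:: true; false].
have [_ p22c _ [B3 b3]] := hs [:: true; true].
pose B := Num.max B1 (Num.max B2 B3).
have k1 x : `|pd1 (pd1 phi) x| <= B by rewrite /B le_max (b1 x).
have k2 x : `|pd2 (pd1 phi) x| <= B by rewrite /B !le_max (b2 x) orbT.
have k3 x : `|pd2 (pd2 phi) x| <= B by rewrite /B !le_max (b3 x) !orbT.
have B0 : 0 <= B by exact: le_trans (normr_ge0 _) (k1 (0, 0)).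
pose G (u1 u2 : P2 -> R) x := u1 x * u2 x * pd2 (pd1 phi) x
   - 2^-1 * u1 x ^+ 2 * pd2 (pd2 phi) x - 2^-1 * u2 x ^+ 2 * pd1 (pd1 phi) x.
have cV k x : U x -> {for x, continuous (pd k V)}.
  move=> Ux; apply: (@uniform_limit_continuous (fun n => pd k (v n)) _ K x) => // n y Uy.
    exact: (sm_continuous (sm_pd k (sv n)) Uy).
  exact: dv.
have Gb u1 u2 N x : `|u1 x| <= N -> `|u2 x| <= N -> `|G u1 u2 x| <= 2 * N ^+ 2 * B.
  move=> h1 h2; rewrite /G; apply: le_trans (ler_normB _ _) _.
  have -> : 2 * N ^+ 2 * B = (N * N * B + 2^-1 * N ^+ 2 * B) + 2^-1 * N ^+ 2 * B by field.
  apply: lerD; last exact: half_sqr_bound.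
  apply: le_trans (ler_normB _ _) _; apply: lerD; last exact: half_sqr_bound.
  rewrite (normrM (u1 x * u2 x)) (normrM (u1 x)).
  by apply: ler_pM => //; exact: ler_pM.
have Gi u1 u2 N : (forall x, Om x -> {for x, continuous u1}) -> (forall x, Om x -> {for x, continuous u2}) ->
   (forall x, Om x -> `|u1 x| <= N) -> (forall x, Om x -> `|u2 x| <= N) ->
   (@leb2 R).-integrable (Om : set T2) (EFin \o (G u1 u2 : T2 -> R)).
  move=> h1 h2 h3 h4; apply: (@integrable_bounded2 R Om r (G u1 u2) (2 * N ^+ 2 * B) oO OU).
    move=> x Ox; have d1 := h1 x Ox; have d2 := h2 x Ox.
    have c2' : {for x, continuous (fun _ : P2 => 2^-1 : R)} by exact: cvg_cst.
    apply: (@continuousB _ _ _ (fun x => u1 x * u2 x * pd2 (pd1 phi) x - 2^-1 * u1 x ^+ 2 * pd2 (pd2 phi) x)).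
      apply: (@continuousB _ _ _ (fun x => u1 x * u2 x * pd2 (pd1 phi) x)).
        exact: (continuousM (continuousM d1 d2) (p21c x)).
      exact: (continuousM (continuousM c2' (continuousM d1 d1)) (p22c x)).
    exact: (continuousM (continuousM c2' (continuousM d2 d2)) (p11c x)).
  by move=> x Ox; apply: Gb; [exact: h3|exact: h4].
have iV : (@leb2 R).-integrable (Om : set T2) (EFin \o (G (pd1 V) (pd2 V) : T2 -> R)).
  by apply: (@Gi _ _ C) => x /OU Ux; [exact: (cV false)|exact: (cV true)|exact: (dV false)|exact: (dV true)].
have vb k n x : U x -> `|pd k (v n) x| <= C + K.
  move=> Ux; apply: (norm_perturb (dV k x Ux)).
  apply: le_trans (dv k n x Ux) _; rewrite ler_pdivrMr ?exprn_gt0// ler_peMr//.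
  by rewrite exprn_ege1// ler1n.
have ivn n : (@leb2 R).-integrable (Om : set T2) (EFin \o (G (pd1 (v n)) (pd2 (v n)) : T2 -> R)).
  apply: (@Gi _ _ (C + K)) => x /OU Ux.
  - exact: (sm_continuous (sm_pd false (sv n)) Ux).
  - exact: (sm_continuous (sm_pd true (sv n)) Ux).
  - exact: (vb false).
  - exact: (vb true).
have [h1 h2 h3 [Bp h4]] := hs [::].
have ip : (@leb2 R).-integrable (Om : set T2) (fun y : T2 => (f y * phi y)%:E).
  apply: (@integrableMl _ T2 R (@leb2 R) (Om : set T2) mO
    (EFin \o (f : T2 -> R)) (phi : T2 -> R)); first exact: fint.
    by apply: continuous_measurable2 => // x _; exact: h2.
  by exists Bp; split; rewrite ?num_real// => M' MM' x Ox; exact: le_trans (h4 _) (ltW MM').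
suff E : \int[@leb2 R]_(x in (Om : set T2)) G (pd1 V) (pd2 V) x =
    \int[@leb2 R]_(x in (Om : set T2)) (f x * phi x).
  have := congr1 EFin E; rewrite /Rintegral fineK; last exact: integrable_fin_num.
  by rewrite fineK; last exact: integrable_fin_num.
apply/eqP; rewrite -subr_eq0 -normr_le0; apply/ler_addgt0Pl => e e0; rewrite addr0.
have e2 : 0 < e / 2 by rewrite divr_gt0.
have [J hJ] := weak_limit r0 oO OU2 fint f32 T2le hphi e2.
pose mu := fine (@leb2 R (Om : set T2)).
have mu0 : 0 <= mu by rewrite fine_ge0.
(* [Z / 2 ^+ n] bounds the gradient error and the coefficient error together; n is also taken above
   the index [J] of the weak limit. *)
pose Z := (2 * ((2 * C + K) * K) * B) * mu + (6 * K * B) * mu.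
have [n0 hn0] := half_small Z e2.
pose n := maxn n0 J.
have Jn : (J <= idx n)%N by apply: leq_trans (hidx n); exact: leq_maxr.
pose dn := K / 2 ^+ n.
have dn0 : 0 <= dn by rewrite divr_ge0.
have dnK : dn <= K by rewrite ler_pdivrMr ?exprn_gt0// ler_peMr// exprn_ege1// ler1n.
have Zn : (2 * ((2 * C + K) * dn) * B) * mu + (6 * dn * B) * mu <= e / 2.
  rewrite /dn (_ : _ + _ = Z / 2 ^+ n); last by rewrite /Z; field; rewrite gt_eqF.
  apply: le_trans (ltW hn0); apply: ler_wpM2l.
    have CK : 0 <= 2 * C + K by apply: addr_ge0 => //; exact: mulr_ge0.
    by apply: addr_ge0; do ?apply: mulr_ge0.
  by rewrite lef_pV2 ?posrE ?exprn_gt0// ler_eXn2l ?ltr1n// leq_maxl.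
have [sc1 sc2 sc3] := sc n.
have sa := sm_cls (hM (idx n)).1; have sb := sm_cls (hM (idx n)).2.
have iA := test_integrable r0 oO OU2 [:: true; true] hphi sa.
have iB := test_integrable r0 oO OU2 [:: false; false] hphi sb.
have iAB := integrableD mO iA iB.
pose Cc x := (c1 n x + c3 n x) * pd2 (pd2 phi) x - 2 * c3 n x * pd2 (pd1 phi) x +
  (c2 n x + c3 n x) * pd1 (pd1 phi) x.
pose A x := aa (idx n) x * pd2 (pd2 phi) x + bb (idx n) x * pd1 (pd1 phi) x.
have Zt : zint Om (fun x => (A x + G (pd1 (v n)) (pd2 (v n)) x) - Cc x).
  apply: (zint_eq oO _ (triv_zint r0 oO OU hphi (hst n))) => x Ox.
  have D1 : dop (R := R) fr0.1 (v n) x = pd1 (v n) x by rewrite /dop mul1r mul0r addr0.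
  have D2 : dop (R := R) fr0.2 (v n) x = pd2 (v n) x by rewrite /dop mul1r mul0r add0r.
  exact: state_alg D1 D2.
have iAG := integrableD mO iAB (ivn n).
have iC : (@leb2 R).-integrable (Om : set T2) (EFin \o (Cc : T2 -> R)).
  have h := integrableB mO iAG Zt.1.
  apply: eq_integrable h; first exact: mO.
  have alg (a b g c : R) : (a%:E + b%:E + g%:E - (a + b + g - c)%:E)%E = c%:E.
    by rewrite [in RHS](_ : c = a + b + g - (a + b + g - c)) //; ring.
  by move=> x _; exact: alg.
have eqn : \int[@leb2 R]_(x in (Om : set T2)) A x +
    \int[@leb2 R]_(x in (Om : set T2)) G (pd1 (v n)) (pd2 (v n)) x =
    \int[@leb2 R]_(x in (Om : set T2)) Cc x.
  have := zint_Rintegral Zt; rewrite (RintegralB mO iAG iC) (RintegralD mO iAB (ivn n)).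
  by move=> h; apply/eqP; rewrite -subr_eq0 h.
have b1' : `| \int[@leb2 R]_(x in (Om : set T2)) G (pd1 V) (pd2 V) x -
    \int[@leb2 R]_(x in (Om : set T2)) G (pd1 (v n)) (pd2 (v n)) x| <= 2 * ((2 * C + K) * dn) * B * mu.
  rewrite -(RintegralB mO iV (ivn n)); apply: Rintegral_bound; first exact: (integrableB mO iV (ivn n)).
  move=> x /OU Ux.
  have d1 : `|pd1 (v n) x - pd1 V x| <= dn by exact: (dv false).
  have d2 : `|pd2 (v n) x - pd2 V x| <= dn by exact: (dv true).
  have e1 : `|pd1 V x| <= C by exact: (dV false).
  have e2' : `|pd2 V x| <= C by exact: (dV true).
  have V1 : `|pd1 (v n) x| <= C + dn.
    exact: norm_perturb e1 d1.
  have V2 : `|pd2 (v n) x| <= C + dn.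
    exact: norm_perturb e2' d2.
  have C2 : (2 * C + dn) * dn <= (2 * C + K) * dn by apply: ler_wpM2r => //; rewrite lerD2l.
  have m1 := le_trans (quadratic_diff e1 V2 d1 d2) C2.
  have m2 := le_trans (quadratic_diff e1 V1 d1 d1) C2.
  have m3 := le_trans (quadratic_diff e2' V2 d2 d2) C2.
  exact: hessian_diff_bound.
have b2' : `| \int[@leb2 R]_(x in (Om : set T2)) Cc x| <= 6 * dn * B * mu.
  apply: Rintegral_bound => // x /OU Ux; have [q1 q2 q3] := hc n x Ux.
  exact: correction_bound.
have b3' := hJ _ Jn.
exact: combine_bounds b1' b2' b3' eqn Zn.
Qed.

End LimitEquation.

(** * Parameters, integrability of the right-hand side, enclosing square *)

Section Preparation.
Variable R : realType.
Local Notation P2 := (R * R)%type.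
Local Notation T2 := (measurableTypeR R * measurableTypeR R)%type.

(** With d = 1 - 3 theta > 0 and q = 10^4, take T with T^d = 2 q and tau = q / T. Then T tau = q,
    and tau T^(3 theta) = q T^(-d) = 1/2. *)
Lemma choose_parameters (theta : R) : 0 < theta -> theta < 1 / 3 ->
  exists T tau : R, [/\ 2 <= T, 0 < tau, tau <= 2^-1, 10 ^+ 4 <= T * tau &
    T^-1 <= tau /\ tau * (T ^+ 3) `^ theta <= 2^-1].
Proof.
move=> th0 th1.
have [q [q1 qE]] : exists q : R, 1 <= q /\ q = 10 ^+ 4 by exists (10 ^+ 4); rewrite exprn_ege1// ler1n.
rewrite -qE {qE}.
pose d := 1 - 3 * theta; have d0 : 0 < d by rewrite /d; lra.
have d1 : d <= 1 by rewrite /d; lra.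
have q0 : 0 < q by lra.
pose T := (2 * q) `^ d^-1.
have TE : T `^ d = 2 * q by rewrite /T -powRrM mulVf ?gt_eqF// powRr1//; lra.
have T2 : 2 * q <= T.
  rewrite -[leLHS]powRr1; last by lra.
  by rewrite /T; apply: ler_powR; [lra|rewrite -[leLHS]invr1 lef_pV2 ?posrE].
have T0 : 0 < T by lra.
have ST : (T ^+ 3) `^ theta = T / (2 * q).
  rewrite -TE -powR_mulrn; last by exact: ltW.
  rewrite -powRrM (_ : 3%:R * theta = 1 - d); last by rewrite /d; ring.
  by rewrite powRB ?powRr1 ?(gt_eqF T0) ?implybT//; exact: ltW.
exists T, (q / T); split.
- by lra.
- exact: divr_gt0.
- by rewrite ler_pdivrMr// mulrC ler_pdivlMr//; lra.
- by rewrite mulrC divfK// gt_eqF.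
split; first by rewrite ler_pdivlMr// mulVf// gt_eqF.
by rewrite ST le_eqVlt; apply/orP; left; apply/eqP; field; rewrite !gt_eqF.
Qed.

(** On a set of finite measure both |f| and |f|^(3/2) are dominated by 1 + |f|^p. *)
Lemma Lp_integrable (Om : set P2) (r p : R) (f : P2 -> R) : open Om -> Om `<=` square r ->
  3 / 2 <= p -> Lp Om p f ->
  (@leb2 R).-integrable (Om : set T2) (EFin \o (f : T2 -> R)) /\
  (@leb2 R).-integrable (Om : set T2) (fun y : T2 => (`|f y| * Num.sqrt `|f y|)%:E).
Proof.
move=> oO OU hp [mf0 fp]; have mO := open_measurable2 oO.
have mf : measurable_fun (Om : set T2) (f : T2 -> R) by exact: mf0.
have maf : measurable_fun (Om : set T2) (fun y : T2 => `|f y|) by exact: measurableT_comp.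
have mp : measurable_fun (Om : set T2) (fun y : T2 => `|f y| `^ p).
  exact: (measurableT_comp (measurable_powR p) maf).
have ip : (@leb2 R).-integrable (Om : set T2) (fun y : T2 => (`|f y| `^ p)%:E).
  apply/integrableP; split; first exact/measurable_EFinP.
  apply: le_lt_trans fp; rewrite le_eqVlt; apply/orP; left; apply/eqP.
  by apply: eq_integral => y _; rewrite /= ger0_norm// powR_ge0.
have i1 : (@leb2 R).-integrable (Om : set T2) (fun y : T2 => 1%:E).
  by apply: (@integrable_bounded2 R Om r (fun=> 1) `|1| oO OU) => // x _; exact: cvg_cst.
have ig : (@leb2 R).-integrable (Om : set T2) (fun y : T2 => (1 + `|f y| `^ p)%:E) by exact: (integrableD mO i1 ip).
have g0 (y : P2) : 0 <= 1 + `|f y| `^ p by rewrite addr_ge0// powR_ge0.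
have P u : 1 <= u -> u <= u `^ p.
  by move=> u1; rewrite -{1}[u]powRr1; [apply: ler_powR => //; lra|lra].
have P32 u : 1 <= u -> u * Num.sqrt u <= u `^ p.
  move=> u1; have u0 : 0 <= u by lra.
  rewrite -powR12_sqrt// -{1}[u]powRr1// -powRD; last by rewrite (gt_eqF (_ : 0 < u)) ?implybT//; lra.
  by apply: ler_powR => //; lra.
split.
  apply: le_integrable ig => //; first exact/measurable_EFinP.
  move=> y _; rewrite /= lee_fin [leRHS]ger0_norm//.
  have [h|/ltW h] := leP `|f y| 1; first by apply: le_trans h _; rewrite lerDl powR_ge0.
  by apply: le_trans (P _ h) _; rewrite lerDr.
apply: le_integrable ig => //.
  apply/measurable_EFinP; apply: measurable_funM => //.
  by apply: (measurableT_comp _ maf); apply: continuous_measurable_fun; exact: sqrt_continuous.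
move=> y _; rewrite /= lee_fin [leRHS]ger0_norm// ger0_norm; last by rewrite mulr_ge0// sqrtr_ge0.
have [h|/ltW h] := leP `|f y| 1; last by apply: le_trans (P32 _ h) _; rewrite lerDr.
apply: (@le_trans _ _ 1); last by rewrite lerDl powR_ge0.
by rewrite mulr_ile1 ?sqrtr_ge0// -[leRHS]sqrtr1 ler_sqrt.
Qed.

Lemma closure_box (Om : set P2) : bounded2 Om -> exists r, [/\ 0 < r, closure Om `<=` square (r / 2) & compact (closure Om)].
Proof.
move=> [M hM]; pose N := `|M| + 1.
have N0 : 0 < N by rewrite ltr_wpDl.
pose K : set P2 := `[- N, N]%classic `*` `[- N, N]%classic.
have cK : compact K by apply: compact_setX; exact: segment_compact.
have clK : closed K by apply: compact_closed => //; exact: norm_hausdorff.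
have MN : M <= N by rewrite (le_trans (ler_norm M))// lerDl.
have OK : closure Om `<=` K.
  rewrite (closure_id K).1//; apply: closureS => x /hM[h1 h2].
  by split; rewrite /= in_itv /= -ler_norml; [exact: le_trans h1 MN|exact: le_trans h2 MN].
exists (4 * N); split; first exact: mulr_gt0.
  have hN : N < 4 * N / 2 by rewrite ltr_pdivlMr//; lra.
  move=> x /OK[/=]; rewrite !in_itv /= -!ler_norml => h1 h2.
  by split; [exact: le_lt_trans h1 hN|exact: le_lt_trans h2 hN].
exact: subclosed_compact (@closed_closure _ _) cK OK.
Qed.

Lemma iter_rotf3 n : iter (3 * n) rotf (fr0 (R := R)) = fr0.
Proof.
elim: n => [|n IH]; first by rewrite muln0.
rewrite mulnS iterD IH /= /rotf /fr0 /=.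
by congr (((_, _), (_, _))); ring.
Qed.

End Preparation.

(** * Construction of the solution *)

Section Construction.
Variable R : realType.
Local Notation P2 := (R * R)%type.
Local Notation T2 := (measurableTypeR R * measurableTypeR R)%type.
Variables (r : R) (Om : set P2) (f : P2 -> R).
Hypotheses (r0 : 0 < r) (oO : open Om) (OU2 : Om `<=` square (r / 2)).
Hypothesis fint : (@leb2 R).-integrable (Om : set T2) (EFin \o (f : T2 -> R)).
Hypothesis f32 : (@leb2 R).-integrable (Om : set T2) (fun y : T2 => (`|f y| * Num.sqrt `|f y|)%:E).
Let OU : Om `<=` square r. Proof. exact: subr_square. Qed.
Local Notation U := (square r).
Variables (T tau : R).
Hypotheses (T2le : 2 <= T) (tau0 : 0 < tau) (tau1 : tau <= 2^-1) (Tt : 10 ^+ 4 <= T * tau)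
  (Ti : T^-1 <= tau).
Local Notation S := (T ^+ 3).
Local Notation aa := (aa Om f T).
Local Notation bb := (bb Om f T).
Local Notation CA := (CA Om f T).

(* Coefficients of diag(aa, bb) in the directions e1, e2 and -e1-e2, cyclically
   continued in k; the third vanishes. *)
Definition defect (m i k : nat) : P2 -> R :=
  match (k %% 3)%N with 0%N => aa (m + i) | 1%N => bb (m + i) | _ => fun=> 0 end.

Lemma defect_periodic m i k : defect m i k.+3 = defect m i k.
Proof. by rewrite /defect -addn3 modnDr. Qed.

(** [T^-1 <= tau] turns the decay T^-2 of the increments into tau^2; the starting index m brings the
    constant [CA] below the first budget. *)
Lemma cls_defect_inc m (s0 : R) : CA * (T ^- 2) ^+ m <= 8^-1 * s0 ^+ 2 * tau ^+ 6 ->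
  forall i k, cls r (8^-1 * (s0 * tau ^+ i) ^+ 2 * tau ^+ 6) (324 * S ^+ m * S ^+ i.+1)
     (fun x => defect m i.+1 k x - defect m i k x).
Proof.
move=> hm i k.
have T0 : 0 < T by exact: lt_le_trans T2le.
have C0 := CA_ge0 Om f T2le.
have x0 : 0 <= T ^- 2 by rewrite invr_ge0 exprn_ge0// ltW.
have xt : T ^- 2 <= tau ^+ 2.
  by rewrite -exprVn lerXn2r ?nnegrE ?invr_ge0//; exact: ltW.
have le1 : CA * (T ^- 2) ^+ (m + i) <= 8^-1 * (s0 * tau ^+ i) ^+ 2 * tau ^+ 6.
  rewrite exprD mulrA.
  have -> : 8^-1 * (s0 * tau ^+ i) ^+ 2 * tau ^+ 6 = (8^-1 * s0 ^+ 2 * tau ^+ 6) * (tau ^+ 2) ^+ i.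
    by rewrite exprMn -!exprM (mulnC i); ring.
  apply: ler_pM => //; first by apply: mulr_ge0 => //; exact: exprn_ge0.
    exact: exprn_ge0.
  by rewrite lerXn2r ?nnegrE//; exact: exprn_ge0 (ltW tau0).
have LE : 324 * S ^+ m * S ^+ i.+1 = 324 * S ^+ (m + i).+1 by rewrite -mulrA -exprD addnS.
have L0 : 0 <= 324 * S ^+ (m + i).+1.
  by apply: mulr_ge0; [exact: ler0n|do 2 apply: exprn_ge0; exact: ltW].
have n0 : 0 <= CA * (T ^- 2) ^+ (m + i) by apply: mulr_ge0 => //; exact: exprn_ge0.
rewrite LE /defect addnS.
have [hA hB] := cls_aa_bb_inc r0 oO OU fint f32 T2le (m + i).
case: (k %% 3)%N => [|[|_]].
- exact: cls_le n0 le1 L0 (lexx _) hA.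
- exact: cls_le n0 le1 L0 (lexx _) hB.
apply: (@cls_eq _ _ _ _ (fun=> 0)); first by move=> y _; rewrite subrr.
by apply: cls_cst => //; rewrite normr0; exact: le_trans le1.
Qed.

(** Any symmetric field decomposes along the three directions, so every v starts a state with zero
    trivial field; positivity of the coefficient to be removed is arranged inside [step]. *)
Lemma initial_state (A1 A2 v : P2 -> R) :
  state r fr0 A1 A2 (fun=> 0) v
    (fun x => A1 x - 2^-1 * (pd1 v x * pd1 v x) + 2^-1 * (pd1 v x * pd2 v x))
    (fun x => A2 x - 2^-1 * (pd2 v x * pd2 v x) + 2^-1 * (pd1 v x * pd2 v x))
    (fun x => - (2^-1 * (pd1 v x * pd2 v x))).
Proof.
have D1 g x : dop (R := R) fr0.1 g x = pd1 g x by rewrite /dop mul1r mul0r addr0.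
have D2 g x : dop (R := R) fr0.2 g x = pd2 g x by rewrite /dop mul1r mul0r add0r.
have z i (x : P2) : pd i (fun=> 0 : R) x = 0 by have [_ ->] := partials_cst (0 : R) x.
exists (fun=> 0), (fun=> 0); split; [exact: sm_cst|exact: sm_cst|].
move=> x _; rewrite !D1 !D2 (z false x : pd1 _ x = 0) (z true x : pd2 _ x = 0).
move: (A1 x) (A2 x) (pd1 v x) (pd2 v x) => a b p q.
by split; ring.
Qed.

Lemma cls_initial (A v00 : P2 -> R) (M N L K : R) i : 0 <= M -> 0 <= N -> 0 <= L ->
  8 * L <= K -> cls r M K A -> cls r N L v00 ->
  cls r (M + 3 * (N * L) ^+ 2) K
   (fun x => A x - 2^-1 * (pd i v00 x * pd i v00 x) + 2^-1 * (pd1 v00 x * pd2 v00 x)).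
Proof.
move=> M0 N0 L0 LK hA hv.
have NL : 0 <= N * L by exact: mulr_ge0.
have L8 : 0 <= 8 * L by exact: mulr_ge0.
have K0 : 0 <= K by exact: le_trans LK.
have hp k := cls_le NL (lexx _) L8 LK (cls_pd k hv).
have := clsD (clsB hA (clsZ (2^-1) (clsM NL NL K0 (hp i) (hp i))))
  (clsZ (2^-1) (clsM NL NL K0 (hp false) (hp true))).
have n2 : 0 <= 2^-1 :> R by [].
rewrite (ger0_norm n2) -addrA.
by have -> : 2^-1 * (3 * (N * L) * (N * L)) + 2^-1 * (3 * (N * L) * (N * L)) = 3 * (N * L) ^+ 2 by field.
Qed.

Lemma pow2_large (Z : R) : exists m, Z <= 2 ^+ m.
Proof.
have [m hm] := half_small Z (@ltr01 R).
by exists m; move: hm; rewrite ltr_pdivrMr ?mul1r ?exprn_gt0// => /ltW.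
Qed.

Lemma le_sum4 (a b c d : R) : 0 <= a -> 0 <= b -> 0 <= c -> 0 <= d ->
  [/\ a <= a + b + c + d, b <= a + b + c + d, c <= a + b + c + d & d <= a + b + c + d].
Proof. by move=> *; split; lra. Qed.

Lemma le_sqr_add1 (a : R) : 0 <= a -> a <= (a + 1) ^+ 2.
Proof. by move=> a0; rewrite expr2; nra. Qed.

Lemma budget_chain (w a b c : R) : w <= 4^-1 * a -> 0 <= a -> a <= b -> b <= c ->
  w <= 2^-1 * b /\ w <= c.
Proof. by move=> *; split; lra. Qed.

Lemma construction (theta eta N L : R) (v00 : P2 -> R) : 0 < theta -> theta < 1 ->
  tau * S `^ theta <= 2^-1 -> 0 < eta -> 0 <= N -> 0 <= L -> cls r N L v00 ->
  exists V : P2 -> R, [/\ forall x, U x -> `|v00 x - V x| <= eta,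
      forall x, U x -> has_partials V x,
      exists C : R, forall x y, U x -> U y ->
        [/\ `|V x| <= C, (forall k, `|pd k V x| <= C),
          `|V x - V y| <= C * dist2 x y `^ theta &
          forall k, `|pd k V x - pd k V y| <= C * dist2 x y `^ theta] &
      very_weak_hessian_eq Om V f].
Proof.
move=> th0 th1 tS eta0 N0 L0 hv.
have T0 : 0 < T by exact: lt_le_trans T2le.
have [Mab Mab0 hab] := cls_aa_bb r0 oO OU fint f32 T2le.
pose W := Mab + 3 * (N * L) ^+ 2.
have NL : 0 <= N * L by exact: mulr_ge0.
have W0 : 0 <= W by apply: addr_ge0 => //; apply: mulr_ge0 => //; exact: exprn_ge0.
(* Then s0 tau^2 = 2 (W + 1), so even the smallest initial budget (s0 tau^2)^2 / 4 = (W + 1)^2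
   exceeds [W], the bound on the initial coefficients. *)
pose s0 := 2 * (W + 1) / tau ^+ 2.
have W10 : 0 < W + 1 by rewrite ltr_wpDl.
have t20 : 0 < tau ^+ 2 by exact: exprn_gt0.
have s00 : 0 < s0 by apply: divr_gt0 => //; exact: mulr_gt0.
have tau11 : tau < 1 by apply: le_lt_trans tau1 _; rewrite invf_lt1// ltr1n.
have S2 : 2 <= S.
  apply: le_trans T2le _; rewrite exprS ler_peMr//; first exact: ltW.
  by rewrite exprn_ege1// (le_trans _ T2le)// ler1n.
have C0 := CA_ge0 Om f T2le.
(* Four lower bounds for the initial frequency: [z1] for small increments of A, [z2] for the
   frequency of D^2 v00, [z3] for its size, and [z4] for the distance of at most eta from v00 to
   V. *)
pose z1 := CA / (8^-1 * s0 ^+ 2 * tau ^+ 6).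
pose z2 := 8 * (8 * L).
pose z3 := N * L * (8 * L) * tau / (144 * s0).
pose z4 := 2 * (576 * s0) * 64 / eta.
have z10 : 0 < 8^-1 * s0 ^+ 2 * tau ^+ 6 by do ?apply: mulr_gt0 => //; exact: exprn_gt0.
have p1 : 0 <= z1 by apply: divr_ge0 => //; exact: ltW.
have p2 : 0 <= z2 by apply: mulr_ge0 => //; exact: mulr_ge0.
have s144 : 0 < 144 * s0 by apply: mulr_gt0; [exact: ltr0Sn|exact: s00].
have s576 : 0 <= 576 * s0 by apply: mulr_ge0; [exact: ler0n|exact: ltW].
have p3 : 0 <= z3.
  by apply: divr_ge0; [apply: mulr_ge0; [apply: mulr_ge0 => //; exact: mulr_ge0|exact: ltW]|exact: ltW].
have p4 : 0 <= z4.
  by apply: divr_ge0; [apply: mulr_ge0; [exact: mulr_ge0|exact: ler0n]|exact: ltW].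
have [m hm] := pow2_large (z1 + z2 + z3 + z4).
(* Starting the primitives at index m raises the frequency while [s0] stays fixed, because [Mab]
   bounds all the primitives at once. *)
pose Lam := 324 * S ^+ m.
have Sm : 2 ^+ m <= S ^+ m by rewrite lerXn2r ?nnegrE// (le_trans _ S2).
have Sm0 : 0 < S ^+ m by exact: lt_le_trans Sm; exact: exprn_gt0.
have S324 : S ^+ m <= Lam by apply: ler_peMl; [exact: ltW|exact: (ler_nat _ 1 324)].
have Lam0 : 0 < Lam by exact: lt_le_trans S324.
have zS z : z <= z1 + z2 + z3 + z4 -> z <= Lam.
  by move=> h; apply: le_trans h (le_trans hm (le_trans Sm S324)).
have [y1 y2 y3 y4] := le_sum4 p1 p2 p3 p4.
have ha : CA * (T ^- 2) ^+ m <= 8^-1 * s0 ^+ 2 * tau ^+ 6.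
  have z1m : z1 <= 2 ^+ m by exact: le_trans hm.
  move: z1m; rewrite ler_pdivrMr// => z1m.
  have T20 : 0 < (T ^+ 2) ^+ m by do 2 apply: exprn_gt0.
  rewrite exprVn ler_pdivrMr// mulrC; apply: le_trans z1m _.
  apply: ler_wpM2r; first exact: ltW.
  rewrite lerXn2r ?nnegrE//; first by rewrite exprn_ge0// ltW.
  apply: le_trans T2le _; rewrite expr2; apply: ler_peMr; first exact: ltW.
  by apply: le_trans T2le; rewrite ler1n.
have L64 : 8 * (8 * L) <= Lam by exact: zS y2.
have L80 : 0 <= 8 * L by exact: mulr_ge0.
have L88 : 8 * L <= Lam by apply: le_trans L64; rewrite ler_peMl// ler1n.
have hH : N * L * (8 * L) <= 144 * s0 * Lam / tau.
  have : z3 <= Lam by exact: zS y3.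
  by rewrite /z3 ler_pdivrMr// ler_pdivlMr// [Lam * _]mulrC.
pose lam0 := S * Lam / 64.
have lam00 : 0 < lam0 by apply: divr_gt0 => //; apply: mulr_gt0 => //; exact: exprn_gt0.
have heta : 2 * (576 * s0 / lam0) / 2 ^+ 0 <= eta.
  have : z4 <= Lam by exact: zS y4.
  rewrite /z4 ler_pdivrMr// => h.
  have -> : 2 * (576 * s0 / lam0) / 2 ^+ 0 = (2 * (576 * s0) * 64) / (S * Lam).
    by rewrite expr0 /lam0; move: (576 * s0) => x; field; rewrite !gt_eqF.
  have S0 : 0 < S by exact: exprn_gt0.
  rewrite ler_pdivrMr; last exact: mulr_gt0.
  apply: le_trans h _; rewrite mulrC; apply: ler_wpM2l; first exact: ltW.
  by apply: ler_peMl; [exact: ltW|apply: le_trans S2; rewrite ler1n].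
have st2 : s0 * tau ^+ 2 = 2 * (W + 1) by rewrite /s0 divfK// gt_eqF.
have WW := le_sqr_add1 W0.
have b3 : W <= 4^-1 * (s0 * tau ^+ 2) ^+ 2.
  by rewrite st2 (_ : 4^-1 * _ = (W + 1) ^+ 2)//; field.
have st1 : s0 * tau ^+ 2 <= s0 * tau.
  by apply: ler_wpM2l; [exact: ltW|rewrite expr2 ler_piMl//; exact: ltW].
have sq1 : (s0 * tau ^+ 2) ^+ 2 <= (s0 * tau) ^+ 2.
  by rewrite lerXn2r ?nnegrE//; apply: mulr_ge0; exact: ltW.
have sq2 : (s0 * tau) ^+ 2 <= s0 ^+ 2.
  rewrite lerXn2r ?nnegrE//; [by apply: mulr_ge0; exact: ltW|exact: ltW|].
  by rewrite ler_piMr//; exact: ltW.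
have sq0 : 0 <= (s0 * tau ^+ 2) ^+ 2 by exact: sqr_ge0.
have [b2 b1] := budget_chain b3 sq0 sq1 sq2.
have [hA hB] : cls r Mab Lam (aa (m + 0)) /\ cls r Mab Lam (bb (m + 0)).
  by rewrite addn0; exact: hab.
have c1i := cls_le W0 b1 (ltW Lam0) (lexx _) (cls_initial false Mab0 N0 L0 L88 hA hv).
have c2i := cls_le W0 b2 (ltW Lam0) (lexx _) (cls_initial true Mab0 N0 L0 L88 hB hv).
have c3i : cls r (4^-1 * (s0 * tau ^+ 2) ^+ 2) Lam (fun x => - (2^-1 * (pd1 v00 x * pd2 v00 x))).
  have hp k := cls_le NL (lexx _) L80 L88 (cls_pd k hv).
  have h := clsN (clsZ (2^-1) (clsM NL NL (ltW Lam0) (hp false) (hp true))).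
  have q0 : 0 <= 3 * (N * L) ^+ 2 by apply: mulr_ge0 => //; exact: exprn_ge0.
  have n2 : 0 <= 2^-1 :> R by [].
  have qE : `|2^-1| * (3 * (N * L) * (N * L)) = 2^-1 * (3 * (N * L) ^+ 2).
    by rewrite (ger0_norm n2); ring.
  rewrite qE in h; apply: cls_le h; [exact: mulr_ge0| |exact: ltW|exact: lexx].
  apply: le_trans b3; rewrite /W -[leLHS]add0r; apply: lerD => //.
  by rewrite ler_piMl// invf_le1// ler1n.
have hv2 i j : cls r (144 * s0 * Lam / tau) Lam (pd i (pd j v00)).
  exact: cls_le (mulr_ge0 NL L80) hH (mulr_ge0 (ler0n R 8) L80) L64 (cls_pd i (cls_pd j hv)).
have [v [c1 [c2 [c3 [v0E hI]]]]] := iteration r0 tau0 tau11 Tt Lam0 s00 (defect_periodic m)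
  (cls_defect_inc ha) (sm_cls hv) hv2 c1i c2i c3i (initial_state (aa (m + 0)) (bb (m + 0)) v00).
have S1 : 1 <= S by apply: le_trans S2; rewrite ler1n.
have sv i : sm r (v i) by case: (hI i).
have lE i : S * (Lam * S ^+ i) / 64 = lam0 * S ^+ i by rewrite /lam0; field.
have inc i : cls r (576 * (s0 * tau ^+ i) / (lam0 * S ^+ i)) (lam0 * S ^+ i)
    (fun x => v i.+1 x - v i x).
  by case: (hI i) => _; rewrite lE.
have [V [hV1 hV2 hV3 [C hC]]] := limit_hoelder r0 (ler0n R 576) s00 lam00 S1 tau0 tau1 tS th0 th1 sv inc.
have U0 : U (0, 0) by split; rewrite /= normr0.
have Cge0 : 0 <= C by case: (hC _ _ U0 U0) => h _ _ _; exact: le_trans h.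
exists V; split => //.
- by move=> x Ux; rewrite -v0E; apply: le_trans (hV1 0%N x Ux) heta.
- by exists C.
pose K := 2 * (576 * s0) + s0 ^+ 2.
have s020 : 0 <= s0 ^+ 2 by exact: sqr_ge0.
have s5762 : 0 <= 2 * (576 * s0) by exact: mulr_ge0.
have K0 : 0 <= K by exact: addr_ge0.
have half n : (2 ^+ (3 * n))^-1 <= (2 ^+ n)^-1 :> R.
  by rewrite lef_pV2 ?posrE ?exprn_gt0// ler_eXn2l ?ltr1n// leq_pmull.
have half0 n : 0 <= (2 ^+ n)^-1 :> R by rewrite invr_ge0 exprn_ge0.
have cK i : (s0 * tau ^+ i) ^+ 2 <= s0 ^+ 2 / 2 ^+ i.
  rewrite exprMn; apply: ler_wpM2l => //; rewrite -exprM mulnC exprM -exprVn.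
  have h : tau ^+ 2 <= 2^-1 by apply: le_trans tau1; rewrite expr2; apply: ler_piMl; exact: ltW.
  by apply: lerXn2r; rewrite ?nnegrE//; exact: ltW.
(* Only multiples of 3 are used: there the frame is back to [fr0], in which the weak formulation is
   written. *)
apply: (@very_weak_limit R r Om f r0 oO OU2 fint f32 T T2le V (fun n => v (3 * n)%N)
  (fun n => c1 (3 * n)%N) (fun n => c2 (3 * n)%N) (fun n => c3 (3 * n)%N)
  (fun n => (m + 3 * n)%N) C K Cge0 K0).
- by move=> n; exact: sv.
- move=> k n x Ux; apply: le_trans (hV3 k _ x Ux) _.
  by apply: ler_pM => //; rewrite /K lerDl.
- by move=> k x Ux; case: (hC _ _ Ux Ux).
- move=> n x Ux; have [_ _ [k1 k2 k3] _] := hI (3 * n)%N.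
  have B c : cls r ((s0 * tau ^+ (3 * n)) ^+ 2) (Lam * S ^+ (3 * n)) c -> `|c x| <= K / 2 ^+ n.
    move=> hc; apply: le_trans (cls_norm hc Ux) _; apply: le_trans (cK _) _.
    by apply: ler_pM => //; rewrite /K lerDr.
  by split; exact: B.
- by move=> n; have [_ _ [k1 k2 k3] _] := hI (3 * n)%N; split; [exact: sm_cls k1|exact: sm_cls k2|exact: sm_cls k3].
- by move=> n; apply: leq_trans (leq_addl _ _); rewrite leq_pmull.
move=> n; have [_ _ _ st] := hI (3 * n)%N.
rewrite iter_rotf3 in st; move: st.
have E0 : (3 * n %% 3 = 0)%N by rewrite modnMr.
have E1 : ((3 * n).+1 %% 3 = 1)%N by rewrite -addn1 mulnC modnMDl.
have E2 : ((3 * n).+2 %% 3 = 2)%N by rewrite -addn2 mulnC modnMDl.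
by rewrite /defect E0 E1 E2.
Qed.

End Construction.

Theorem theorem1p1 (R : realType) (Om : set (R * R)) (p : R) (f : R * R -> R)
  (hopen : open Om) (hbdd : bounded2 Om) (hsc : simply_connected2 Om)
  (hsmooth : smooth_boundary Om) (hp : 3 / 2 <= p) (hf : Lp Om p f)
  (theta : R) (htheta0 : 0 < theta) (htheta : theta < 1 / 3)
  (v0 : R * R -> R) (hv0 : {within closure Om, continuous v0})
  (eps : R) (heps : 0 < eps) :
  exists v : R * R -> R,
    [/\ C1theta Om theta v, very_weak_hessian_eq Om v f &
        exists M : R, M < eps /\
          forall x, closure Om x -> `|v0 x - v x| <= M].
Proof.
have [r [r0 CU cC]] := closure_box hbdd.
have OC : Om `<=` closure Om by exact: subset_closure.
have OU2 : Om `<=` square (r / 2) by move=> x /OC/CU.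
have OU := subr_square r0 OU2.
have CUr : closure Om `<=` square r by apply: (subr_square r0).
have [fint f32] := Lp_integrable hopen OU hp hf.
have [T [tau [T2 t0 t1 Tt [Ti tS]]]] := choose_parameters htheta0 htheta.
have C0 : closure Om !=set0 by case: hsc => -[x Ox] _ _; exists x; exact: OC.
have e4 : 0 < eps / 4 by rewrite divr_gt0.
have th1 : theta < 1 by lra.
have [v00 [N [L [N0 L0 hv vv]]]] := smooth_approximation r0 e4 cC C0 CU hv0.
have [V [h1 h2 [C hC] h4]] := construction r0 hopen OU2 fint f32 T2 t0 t1 Tt Ti htheta0 th1 tS e4 N0 L0 hv.
exists V; split => //.
  split.
  (* V is defined and Lipschitz on a square containing the closure, so continuity up to the boundary
     is immediate. *)
  - apply: continuous_in_subspaceT => x; rewrite inE => /CUr Ux.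
    apply: (@lipschitz_continuous R r V C x Ux); apply: (lipschitz_square h2) => i y Uy.
    by case: (hC _ _ Uy Uy).
  - by move=> x /OU; exact: h2.
  exists C => x y /OU Ux /OU Uy; have [k1 k2 k3 k4] := hC _ _ Ux Uy.
  by split; split => //; [exact: (k2 false)|exact: (k2 true)|exact: (k4 false)|exact: (k4 true)].
(* One eps/4 is spent on the smooth approximation and one on the iteration; stopping at eps/2 makes
   the bound strict. *)
exists (eps / 2); split; first by rewrite ltr_pdivrMr// mulr2n mulrDr mulr1 ltrDl.
move=> x Cx; rewrite (_ : v0 x - V x = (v0 x - v00 x) + (v00 x - V x)); last by ring.
apply: le_trans (ler_normD _ _) _; have -> : eps / 2 = eps / 4 + eps / 4 by field.
by apply: lerD; [exact: vv|exact: h1 (CUr x Cx)].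
Qed.
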